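(* Let $0<\beta<1/4$. For each $N\geq1$ let $H$ be an $N\times N$ GOE random matrix, with law denoted $\mathbb{P}_N$, set $M=\beta H$, and let $\Gamma_N(M)$ be the log-Sobolev constant associated with the quenched Sherrington--Kirkpatrick (SK) measure on $N$ sites with coupling matrix $M$. Then there exists $c_\beta<\infty$ (depending only on $\beta$) such that $$\lim_{N\to\infty}\mathbb{P}_N\big(\Gamma_N(M)<c_\beta\big)=1.$$
   Context: GOE: $H=(H_{xy})_{1\le x,y\le N}$ is a real symmetric random matrix with independent centred Gaussian entries (up to the symmetry $H_{xy}=H_{yx}$), of variance $1/N$ above the diagonal (and $2/N$ on the diagonal; the diagonal entries do not affect the measure below). Quenched SK measure: for a fixed real symmetric $N\times N$ matrix $M$, it is the probability measure $\nu=\nu_M$ on $\{-1,+1\}^N$ given by $$\nu(\sigma)=\frac1Z\exp\Big(-\frac12\sum_{x,y=1}^N M_{xy}\sigma_x\sigma_y\Big),$$ with $Z$ the normalising constant. Log-Sobolev constant: $\Gamma_N(M)$ is the smallest constant $\Gamma\ge 0$ such that for all $F:\{-1,+1\}^N\to\mathbb{R}$, $$\mathrm{ent}_\nu(F^2)\leq \Gamma\sum_{x=1}^N\nu\big(|F(\sigma)-F(\sigma^x)|^2\big),$$ where $\sigma^x$ is $\sigma$ with the sign of the coordinate $\sigma_x$ flipped, $\nu(G)=\sum_\sigma \nu(\sigma)G(\sigma)$, and $\mathrm{ent}_\nu(G)=\nu(G\log G)-\nu(G)\log\nu(G)$ for $G\ge0$, with $0\log0=0$. *)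

(* Defs.v *)
From HB Require Import structures.
From mathcomp Require Import all_boot all_order all_algebra.
From mathcomp Require Import all_classical all_reals all_analysis.
Import Order.TTheory GRing.Theory Num.Theory.
Import numFieldNormedType.Exports.

Set Implicit Arguments.
Unset Strict Implicit.
Unset Printing Implicit Defensive.

Local Open Scope classical_set_scope.
Local Open Scope ring_scope.

Section SherringtonKirkpatrick.
Context {R : realType} {N : nat}.

(* Spins are encoded by booleans: false is +1 and true is -1. *)
Definition config := {ffun 'I_N -> bool}.

Definition spin (s : config) (x : 'I_N) : R := (-1) ^+ s x.

Definition flip (s : config) (x : 'I_N) : config :=
  [ffun y => if y == x then ~~ s y else s y].

Definition sk_weight (M : 'M[R]_N) (s : config) : R :=
  expR (- 2^-1 * \sum_(x < N) \sum_(y < N) M x y * spin s x * spin s y).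

Definition sk_partition (M : 'M[R]_N) : R := \sum_(s : config) sk_weight M s.

Definition sk_measure (M : 'M[R]_N) (s : config) : R :=
  sk_weight M s / sk_partition M.

Definition sk_mean (M : 'M[R]_N) (G : config -> R) : R :=
  \sum_(s : config) sk_measure M s * G s.

(* Since ln 0 = 0 in the library, the convention 0 log 0 = 0 holds. *)
Definition sk_ent (M : 'M[R]_N) (G : config -> R) : R :=
  sk_mean M (fun s => G s * ln (G s)) - sk_mean M G * ln (sk_mean M G).

Definition log_sobolev (M : 'M[R]_N) (Gamma : R) : Prop :=
  forall F : config -> R,
    sk_ent M (fun s => F s ^+ 2) <=
    Gamma * \sum_(x < N) sk_mean M (fun s => `|F s - F (flip s x)| ^+ 2).

(* The infimum is attained, the constraints on Gamma being closed; it is taken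
   in the extended reals, so that it would be +oo if no constant were
   admissible. *)
Definition log_sobolev_constant (M : 'M[R]_N) : \bar R :=
  ereal_inf [set Gamma%:E | Gamma in
    [set Gamma : R | 0 <= Gamma /\ log_sobolev M Gamma]].

End SherringtonKirkpatrick.

Section GOE.
Context {d : measure_display} {T : measurableType d} {R : realType}
  {P : probability T R}.

Definition mutually_independent (I : finType) (X : I -> {RV P >-> R}) : Prop :=
  forall (J : {set I}) (B : I -> set R),
    (forall i, i \in J -> measurable (B i)) ->
    P (\bigcap_(i in [set` J]) (X i @^-1` B i)) =
    (\prod_(i in J) P (X i @^-1` B i))%E.

(* The second argument of normal_prob is the standard deviation, so v is the
   variance. *)
Definition centred_gaussian (v : R) (X : {RV P >-> R}) : Prop :=
  forall A : set R, measurable A ->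
    distribution P X A = normal_prob 0 (Num.sqrt v) A.

Definition is_GOE (N : nat) (H : 'I_N -> 'I_N -> {RV P >-> R}) : Prop :=
  [/\ forall x y w, H x y w = H y x w,
      forall x y, centred_gaussian ((if x == y then 2 else 1) / N%:R) (H x y) &
      mutually_independent
        (fun p : {p : 'I_N * 'I_N | (p.1 <= p.2)%N} =>
           H (val p).1 (val p).2)].

Definition random_matrix (N : nat) (H : 'I_N -> 'I_N -> {RV P >-> R}) (w : T) :
    'M[R]_N :=
  \matrix_(x, y) H x y w.

End GOE.

(* Main.v *)
(** Replace the coupling by J = c I - M, which gives the same measure and has
    spectrum in [0, j] with j = 2 c < 1 as soon as |u M u| <= c |u|^2, and write
    J as a sum of v_i v_i^T.  For a weight w on configurations the unnormalized
    sum Z^w(t, h) = sum_s w(s) exp (t/2 sum_i (v_i . s)^2 + h . s) solves the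
    heat equation d/dt = 1/2 sum_i (d/dv_i)^2 in the external field h.  At t = 0
    the measures are products and everything is explicit; statements at t = 1
    follow from the parabolic comparison principle.  First, the variance of
    f . s is at most |f|^2 / (1 - j t).  By Gibbs' variational principle this
    bounds the squared mean shift produced by a density by its entropy E,
    and with this bound (1 - j t) E is a subsolution as long as it exceeds the
    Dirichlet form, which is itself a solution.  Tensorization gives the
    comparison at t = 0, hence a log-Sobolev constant 2 / (1 - 2 c).

    It remains to see that |u H u| <= rho |u|^2 with high probability for every
    rho > 2.  Gaussian integration by parts gives loop equations for the joint
    moments of normalized traces of powers of H.  When the total degree is at
    most about N^(1/8), they are dominated by products of slightly inflated
    Catalan numbers, so E tr H^(2k) <= N (4 (1 + eta))^k, and Markov's
    inequality with 2k a power of two close to N^(1/8) concludes. *)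
Require Import Defs.
From HB Require Import structures.
From mathcomp Require Import finmap all_boot all_order all_algebra.
From mathcomp Require Import all_classical all_reals all_analysis.
From mathcomp Require Import measurable_realfun zify ring lra.
Import Order.TTheory GRing.Theory Num.Theory.
Import numFieldNormedType.Exports.

Set Implicit Arguments.
Unset Strict Implicit.
Unset Printing Implicit Defensive.

Local Open Scope classical_set_scope.
Local Open Scope ring_scope.

(** * Parabolic comparison for exponential sums *)

(** The threshold comes from the shift: the numerical radius of beta H approaches 2 beta, and making
    the coupling positive semidefinite doubles it, so j < 1 amounts to 4 beta < 1. Adding c I to the
    exponent is free because spins have square 1. The SK measure has no external field, but
    derivatives in h are what closes the heat equation, so every bound is proved for all h.
    Quotients and logarithms of heat solutions miss the equation only by an explicit square; summed
    over v_i, it costs at most j times a quantity already controlled, and the factor 1 - j t, with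
    derivative -j, pays for exactly this. For the variance the controlling direction is the worst
    one, which is why the comparison principle carries a compact parameter. On the random side no
    spectral theorem is used: powers of two let repeated Cauchy-Schwarz pass from the quadratic form
    to a trace. A degree large compared with log N suffices to beat the factor N; N^(1/8) leaves
    room for the polynomial losses in the loop equations. *)

Section Calculus.
Context {R : realType}.
Implicit Types (f g : R -> R) (x d df dg : R).
Local Notation deriv f x df := (is_derive (x : R) (1 : R) f df).

Lemma is_derive_fD f g x df dg : deriv f x df -> deriv g x dg ->
  deriv (fun y => f y + g y) x (df + dg).
Proof. by move=> ? ?; exact: is_deriveD. Qed.

Lemma is_derive_fB f g x df dg : deriv f x df -> deriv g x dg ->
  deriv (fun y => f y - g y) x (df - dg).
Proof. by move=> ? ?; exact: is_deriveB. Qed.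

Lemma is_derive_fM f g x df dg : deriv f x df -> deriv g x dg ->
  deriv (fun y => f y * g y) x (df * g x + f x * dg).
Proof.
move=> hf hg; apply: (is_derive_eq (is_deriveM hf hg)).
by rewrite /GRing.scale /= addrC [g x * _]mulrC.
Qed.

Lemma is_derive_fcomp f g x df dg : deriv f x df ->
  deriv g (f x) dg -> deriv (fun y => g (f y)) x (df * dg).
Proof.
by move=> hf hg; apply: (is_derive_eq (is_derive1_comp hg hf)); rewrite mulrC.
Qed.

Lemma is_derive_finv f x df : f x != 0 -> deriv f x df ->
  deriv (fun y => (f y)^-1) x (- df / f x ^+ 2).
Proof.
move=> f0 h; apply: (is_derive_eq (is_deriveV f0 h)).
by rewrite /GRing.scale /= mulrC mulNr mulrN.
Qed.

Lemma is_derive_fcst (a x : R) : deriv (fun _ : R => a) x 0.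
Proof. exact: is_derive_cst. Qed.

Lemma is_derive_pos_near f x d : deriv f x d -> 0 < d ->
  exists2 e : R, 0 < e & forall y, 0 < `|y| < e -> 0 < (f (x + y) - f x) / y.
Proof.
move=> [df fd] d0.
have : h^-1 *: ((f \o shift x) (h *: (1 : R)) - f x) @[h --> 0^'] --> d.
  by rewrite -fd; exact: df.
move=> /cvgr_gt /(_ _ d0); rewrite near_withinE => /nbhs_ballP[e /= e0 he].
exists e => // y /andP[y0 ye].
have := he y; rewrite /ball /= sub0r normrN => /(_ ye).
have -> : y != 0 by rewrite -normr_gt0.
move=> /(_ isT); rewrite /GRing.scale /= mulr1 mulrC [y + x]addrC.
by [].
Qed.

(** Functions are restricted to lines through the point of interest, placed at 0. The first
    derivative must exist everywhere so that the mean value theorem applies around that point. *)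
Definition has_deriv2 g (g2 : R) := exists g1 : R -> R,
  (forall x, deriv g x (g1 x)) /\ deriv g1 0 g2.

(** At the minimum the first derivative vanishes; a negative second derivative would make it
    negative just to the right, and the mean value theorem would produce a smaller value. *)
Lemma deriv2_min_ge0 g (g2 : R) : (forall x, g 0 <= g x) -> has_deriv2 g g2 -> 0 <= g2.
Proof.
move=> gmin [g1 [dg dg1]]; rewrite leNgt; apply/negP => g2lt0.
have g10 : g1 0 = 0.
  have h : deriv g 0 0.
    apply: (@derive1_at_min _ g (-1) 1); last by move=> t _; exact: gmin.
    - by rewrite (le_trans (lerN10 _)) ?ler01.
    - by move=> t _; case: (dg t).
    - by rewrite in_itv /= ltrN10 ltr01.
  by move: (dg 0) h => [_ <-] [_ ->].
have [|e e0 he] := is_derive_pos_near (is_deriveN dg1); first by rewrite oppr_gt0.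
have e20 : 0 < e / 2 by rewrite divr_gt0.
have cg : {within `[0, e / 2], continuous g}.
  apply: continuous_subspaceT => y.
  by apply: differentiable_continuous; apply/derivable1_diffP; case: (dg y).
have [c] := @MVT R g g1 0 (e / 2) e20 (fun x _ => dg x) cg.
rewrite in_itv /= => /andP[c0 ce] gc.
have : 0 < (- g1 (0 + c) - - g1 0) / c.
  apply: he; rewrite gtr0_norm// c0 /=; apply: (lt_le_trans ce).
  by rewrite ler_pdivrMr// mulrDr mulr1 lerDl ltW.
rewrite add0r g10 oppr0 subr0 pmulr_lgt0 ?invr_gt0// oppr_gt0 => g1c.
have := gmin (e / 2); rewrite -subr_ge0 gc subr0 pmulr_lge0 ?divr_gt0//.
by rewrite leNgt g1c.
Qed.

(** Only earlier times are compared, because the minimum in time may sit at the final time. *)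
Lemma left_deriv_min g (t d : R) : 0 < t ->
  (forall s, 0 <= s <= t -> g t <= g s) -> deriv g t d -> d <= 0.
Proof.
move=> t0 gmin dg; rewrite leNgt; apply/negP => d0.
have [e e0 he] := is_derive_pos_near dg d0.
pose s := Num.min (e / 2) t.
have s0 : 0 < s by rewrite lt_min divr_gt0.
have st : s <= t by rewrite ge_min lexx orbT.
have se : s < e.
  apply: (@le_lt_trans _ _ (e / 2)); first by rewrite ge_min lexx.
  by rewrite ltr_pdivrMr// mulrDr mulr1 ltrDl.
have := he (- s); rewrite normrN gtr0_norm// s0 se => /(_ isT).
rewrite invrN mulrN oppr_gt0 pmulr_llt0 ?invr_gt0// subr_lt0 ltNge gmin//.
by rewrite subr_ge0 st gerBl ltW.
Qed.

End Calculus.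

Local Notation deriv f x df := (is_derive x%R (1 : _) f df).

Lemma is_derive_fsum {R : realType} (I : Type) (r : seq I) (F : I -> R -> R) (dF : I -> R) (x : R) :
  (forall i, is_derive x (1 : R) (F i) (dF i)) ->
  is_derive x (1 : R) (fun y => \sum_(i <- r) F i y) (\sum_(i <- r) dF i).
Proof.
move=> h; elim: r => [|i r ih].
  rewrite big_nil; rewrite (_ : (fun y => _) = fun=> 0).
    exact: is_derive_fcst.
  by apply/funext => y; rewrite big_nil.
rewrite big_cons; rewrite (_ : (fun y => _) = fun y => F i y + \sum_(j <- r) F j y).
  exact: is_derive_fD.
by apply/funext => y; rewrite big_cons.
Qed.

Lemma continuous_fsum {R : realType} (T : topologicalType) (I : Type) (r : seq I)
    (F : I -> T -> R) :
  (forall i, continuous (F i)) -> continuous (fun y => \sum_(i <- r) F i y).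
Proof.
move=> h; elim: r => [|i r ih].
  rewrite (_ : (fun y => _) = fun=> 0); first by move=> x; exact: cvg_cst.
  by apply/funext => y; rewrite big_nil.
rewrite (_ : (fun y => _) = fun y => F i y + \sum_(j <- r) F j y).
  by move=> x; apply: cvgD; [exact: h | exact: ih].
by apply/funext => y; rewrite big_cons.
Qed.

Section Continuity.
Context {R : realType} {T : topologicalType}.
Implicit Types f g : T -> R.

Lemma continuous_fcst (a : R) : continuous (fun _ : T => a).
Proof. by move=> x; exact: cvg_cst. Qed.

Lemma continuous_fD f g : continuous f -> continuous g ->
  continuous (fun y => f y + g y).
Proof. by move=> hf hg x; apply: cvgD; [exact: hf | exact: hg]. Qed.

Lemma continuous_fM f g : continuous f -> continuous g ->
  continuous (fun y => f y * g y).
Proof. by move=> hf hg x; apply: cvgM; [exact: hf | exact: hg]. Qed.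

Lemma continuous_fB f g : continuous f -> continuous g ->
  continuous (fun y => f y - g y).
Proof. by move=> hf hg x; apply: cvgB; [exact: hf | exact: hg]. Qed.

Lemma continuous_fexp f : continuous f -> continuous (fun y => expR (f y)).
Proof.
by move=> hf x; apply: (@cvg_comp _ _ _ f expR _ _ _ (hf x)); exact: continuous_expR.
Qed.

Lemma continuous_fV f : continuous f -> (forall x, f x != 0) ->
  continuous (fun y => (f y)^-1).
Proof. by move=> hf f0 x; apply: cvgV; [exact: f0 | exact: hf]. Qed.

Lemma continuous_fln f : continuous f -> (forall x, 0 < f x) ->
  continuous (fun y => ln (f y)).
Proof.
move=> hf f0 x; apply: (@cvg_comp _ _ _ f (@ln R) _ _ _ (hf x)).
exact: (continuous_ln (f0 x)).
Qed.

End Continuity.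

(** * Exponential sums over configurations and the heat equation *)

Section Tilt.
Context {R : realType} {N : nat}.
Implicit Types (h : 'rV[R]_N) (s : @config N) (w : @config N -> R) (t : R).

Definition dot h s : R := \sum_(x < N) h 0 x * spin s x.

Lemma dotD h1 h2 s : dot (h1 + h2) s = dot h1 s + dot h2 s.
Proof. by rewrite -big_split; apply: eq_bigr => x _; rewrite !mxE mulrDl. Qed.

Lemma dotZ (a : R) h s : dot (a *: h) s = a * dot h s.
Proof. by rewrite mulr_sumr; apply: eq_bigr => x _; rewrite !mxE mulrA. Qed.

Lemma dot0 s : dot 0 s = 0.
Proof. by rewrite /dot big1 // => x _; rewrite mxE mul0r. Qed.

Lemma continuous_dot s : continuous (fun h => dot h s).
Proof.
apply: continuous_fsum => x; apply: continuous_fM; last exact: continuous_fcst.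
exact: coord_continuous.
Qed.

(** The partition function of free spins in the field h. It is the yardstick for growth at infinity:
    all the exponential sums are O([tilt0]) uniformly in t, and its square is the barrier. *)
Definition tilt0 h : R := \sum_(s : @config N) expR (dot h s).

(** The configuration aligned with the signs of h alone contributes exp (sum_y |h_y|); hence [tilt0]
    is coercive. *)
Lemma tilt0_ge h x : 1 + `|h 0 x| <= tilt0 h.
Proof.
pose s : @config N := [ffun y => h 0 y < 0].
have hs y : h 0 y * spin s y = `|h 0 y|.
  rewrite /spin ffunE; case: (ltP (h 0 y) 0) => hy.
    by rewrite expr1 mulrN1 ltr0_norm.
  by rewrite expr0 mulr1 ger0_norm.
apply: (@le_trans _ _ (expR (dot h s))).
  apply: le_trans (expR_ge1Dx _); rewrite lerD2l /dot (bigD1 x)//= hs lerDl.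
  by apply: sumr_ge0 => y _; rewrite hs.
by rewrite /tilt0 (bigD1 s)//= lerDl; apply: sumr_ge0 => s' _; exact: expR_ge0.
Qed.

Lemma tilt0_gt0 h : 0 < tilt0 h.
Proof.
apply: (@lt_le_trans _ _ (expR (dot h [ffun=> false]))); first exact: expR_gt0.
rewrite /tilt0 (bigD1 [ffun=> false])//= lerDl.
by apply: sumr_ge0 => s' _; exact: expR_ge0.
Qed.

Lemma tilt0_continuous : continuous tilt0.
Proof. by apply: continuous_fsum => s; apply: continuous_fexp; exact: continuous_dot. Qed.

Lemma deriv_expsum (w a b : @config N -> R) (x : R) :
  is_derive x (1 : R) (fun y => \sum_s w s * expR (a s + y * b s))
    (\sum_s w s * b s * expR (a s + x * b s)).
Proof.
apply: is_derive_fsum => s.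
have h := is_derive_fD (is_derive_fcst (a s) x)
  (is_derive_fM (is_derive_id x (1 : R)) (is_derive_fcst (b s) x)).
have := is_derive_fM (is_derive_fcst (w s) x) (is_derive_fcomp h (is_derive_expR _)).
move=> hd; apply: (is_derive_eq hd); rewrite /=; ring.
Qed.

Section Heat.
Context {m : nat} (v : 'I_m -> 'rV[R]_N).

Definition energy s : R := 2^-1 * \sum_i dot (v i) s ^+ 2.

(* For fixed w this is a solution of the heat equation
   d/dt = 1/2 sum_i (d/dv_i)^2. *)
Definition tilt w t h : R := \sum_s w s * expR (t * energy s + dot h s).

Lemma deriv_tilt_time w t h :
  is_derive t (1 : R) (fun t => tilt w t h) (tilt (fun s => w s * energy s) t h).
Proof.
have := deriv_expsum w (dot h) energy t.
rewrite (_ : (fun y => _) = fun t => tilt w t h); last first.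
  by apply/funext => y; apply: eq_bigr => s _; rewrite addrC.
move=> hd; apply: (is_derive_eq hd); apply: eq_bigr => s _; by rewrite [dot h s + _]addrC.
Qed.

Lemma deriv_tilt_dir w t h u x :
  is_derive x (1 : R) (fun y : R => tilt w t (h + y *: u))
    (tilt (fun s => w s * dot u s) t (h + x *: u)).
Proof.
have := deriv_expsum w (fun s => t * energy s + dot h s) (dot u) x.
rewrite (_ : (fun y => _) = fun y : R => tilt w t (h + y *: u)); last first.
  by apply/funext => y; apply: eq_bigr => s _; rewrite dotD dotZ addrA.
move=> hd; apply: (is_derive_eq hd); apply: eq_bigr => s _; by rewrite dotD dotZ addrA.
Qed.

Lemma eq_tilt w1 w2 t h : w1 =1 w2 -> tilt w1 t h = tilt w2 t h.
Proof. by move=> e; apply: eq_bigr => s _; rewrite e. Qed.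

Lemma tiltD w1 w2 t h :
  tilt (fun s => w1 s + w2 s) t h = tilt w1 t h + tilt w2 t h.
Proof. by rewrite -big_split; apply: eq_bigr => s _; rewrite /= mulrDl. Qed.

Lemma tiltZ (a : R) w t h : tilt (fun s => a * w s) t h = a * tilt w t h.
Proof. by rewrite mulr_sumr; apply: eq_bigr => s _; rewrite mulrA. Qed.

Lemma tilt_sum (I : Type) (r : seq I) (w : I -> @config N -> R) t h :
  tilt (fun s => \sum_(i <- r) w i s) t h = \sum_(i <- r) tilt (w i) t h.
Proof.
rewrite exchange_big; apply: eq_bigr => s _.
by rewrite mulr_suml.
Qed.

Lemma tilt_ge0 w t h : (forall s, 0 <= w s) -> 0 <= tilt w t h.
Proof. by move=> w0; apply: sumr_ge0 => s _; rewrite mulr_ge0// expR_ge0. Qed.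

Lemma le_tilt w1 w2 t h : (forall s, w1 s <= w2 s) -> tilt w1 t h <= tilt w2 t h.
Proof. by move=> w0; apply: ler_sum => s _; rewrite ler_wpM2r// expR_ge0. Qed.

Lemma tilt_gt0 w t h : (forall s, 0 < w s) -> 0 < tilt w t h.
Proof.
move=> w0; rewrite /tilt (bigD1 [ffun=> false])//=.
apply: ltr_wpDr; last by rewrite mulr_gt0// expR_gt0.
by apply: sumr_ge0 => s _; rewrite mulr_ge0// ?expR_ge0// ltW.
Qed.

(** This is the heat equation: a time derivative inserts the energy into the weight, two derivatives
    along v_i insert (v_i . s)^2. *)
Lemma tilt_energy w t h : tilt (fun s => w s * energy s) t h =
  2^-1 * \sum_i tilt (fun s => w s * dot (v i) s * dot (v i) s) t h.
Proof.
rewrite -tilt_sum -tiltZ; apply: eq_tilt => s.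
rewrite /energy mulrCA mulr_sumr; congr (_ * _); apply: eq_bigr => i _; ring.
Qed.

Lemma energy_ge0 s : 0 <= energy s.
Proof. by rewrite mulr_ge0// ?invr_ge0// sumr_ge0// => i _; exact: sqr_ge0. Qed.

Lemma tilt_bound w : exists2 C : R, 0 <= C &
  forall t h, 0 <= t <= 1 -> `|tilt w t h| <= C * tilt0 h.
Proof.
exists (\sum_s `|w s| * expR (energy s)).
  by apply: sumr_ge0 => s _; rewrite mulr_ge0// expR_ge0.
move=> t h /andP[t0 t1]; apply: (le_trans (ler_norm_sum _ _ _)).
rewrite mulr_suml; apply: ler_sum => s _.
rewrite normrM [ `|expR _|]ger0_norm ?expR_ge0// expRD -!mulrA ler_wpM2l//.
apply: ler_pM; rewrite ?expR_ge0//.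
  by rewrite ler_expR ler_piMl// energy_ge0.
rewrite /tilt0 (bigD1 s)//= lerDl.
by apply: sumr_ge0 => s' _; exact: expR_ge0.
Qed.

End Heat.
End Tilt.

(** * The comparison principle, with an extra compact parameter *)

Section Comparison.
Context {R : realType} {N m : nat} (v : 'I_m -> 'rV[R]_N).
Context {A : topologicalType} (K : set A).
Implicit Types (h : 'rV[R]_N) (t : R) (a : A).

(** The second derivative of the barrier is at most a multiple of the barrier, so an exponential
    factor in time can absorb it. *)
Lemma tilt0_deriv2 h u (kappa : R) : (forall s, `|dot u s| <= kappa) ->
  exists2 d : R, has_deriv2 (fun y : R => tilt0 (h + y *: u) ^+ 2) d &
    d <= 4 * kappa ^+ 2 * tilt0 h ^+ 2.
Proof.
move=> hk.
pose q k (y : R) := \sum_s dot u s ^+ k * expR (dot h s + y * dot u s).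
have dq k y : is_derive y (1 : R) (q k) (q k.+1 y).
  have hd := deriv_expsum (fun s => dot u s ^+ k) (dot h) (dot u) y.
  by apply: (is_derive_eq hd); apply: eq_bigr => s _; rewrite exprSr.
have q0E y : tilt0 (h + y *: u) = q 0 y.
  by apply: eq_bigr => s _; rewrite expr0 mul1r dotD dotZ.
have -> : (fun y : R => tilt0 (h + y *: u) ^+ 2) = fun y => q 0 y * q 0 y.
  by apply/funext => y; rewrite q0E expr2.
exists (2 * (q 1 0 ^+ 2 + q 0 0 * q 2 0)).
  exists (fun y => q 1 y * q 0 y + q 0 y * q 1 y); split.
    by move=> y; apply: is_derive_fM; exact: dq.
  have hd := is_derive_fD (is_derive_fM (dq 1 0) (dq 0 0)) (is_derive_fM (dq 0 0) (dq 1 0)).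
  by apply: (is_derive_eq hd); ring.
have qb k : `|q k 0| <= kappa ^+ k * tilt0 h.
  have -> : tilt0 h = q 0 0 by rewrite -q0E scale0r addr0.
  apply: (le_trans (ler_norm_sum _ _ _)); rewrite mulr_sumr; apply: ler_sum => s _.
  rewrite expr0 mul1r normrM [ `|expR _|]ger0_norm ?expR_ge0//.
  rewrite ler_wpM2r ?expR_ge0// normrX; apply: lerXn2r; rewrite ?nnegrE//.
  by apply: le_trans (hk s).
have -> : 4 * kappa ^+ 2 * tilt0 h ^+ 2 = 2 * ((kappa * tilt0 h) ^+ 2 + tilt0 h * (kappa ^+ 2 * tilt0 h)) by ring.
have k0 : 0 <= kappa by apply: le_trans (hk [ffun=> false]).
have Z0 : 0 <= tilt0 h := ltW (tilt0_gt0 h).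
rewrite ler_wpM2l//; apply: lerD.
  rewrite -[q 1 0 ^+ 2]ger0_norm ?sqr_ge0// normrX; apply: lerXn2r; rewrite ?nnegrE ?mulr_ge0//; exact: (qb 1%N).
apply: (le_trans (ler_norm _)); rewrite normrM; apply: ler_pM => //.
by apply: le_trans (qb _) _; rewrite expr0 mul1r.
Qed.

Lemma dot_bound : exists2 kappa : R, 0 <= kappa & forall i s, `|dot (v i) s| <= kappa.
Proof.
exists (\sum_i \sum_s `|dot (v i) s|).
  by apply: sumr_ge0 => i _; apply: sumr_ge0.
move=> i s; rewrite (bigD1 i)//= (bigD1 s)//= -addrA lerDl.
by rewrite addr_ge0// ?sumr_ge0// => j _; apply: sumr_ge0.
Qed.

(* The barrier delta * tilt0 h ^+ 2 dominates u at infinity, which forces a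
   negative minimum of the perturbed function to be attained. *)
Lemma parabolic_comparison (u : R -> 'rV[R]_N -> A -> R) (C L : R) :
  compact K ->
  continuous (fun p : R * 'rV[R]_N * A => u p.1.1 p.1.2 p.2) ->
  (forall t h a, 0 <= t <= 1 -> K a -> - (C * tilt0 h) <= u t h a) ->
  (forall h a, K a -> 0 <= u 0 h a) ->
  (forall t h a, 0 <= t <= 1 -> K a -> u t h a < 0 ->
    (forall a', K a' -> u t h a <= u t h a') ->
    exists ut (uii : 'I_m -> R),
    [/\ is_derive t (1 : R) (fun t => u t h a) ut,
      forall i, has_deriv2 (fun y : R => u t (h + y *: v i) a) (uii i) &
      L * u t h a <= ut - 2^-1 * \sum_i uii i]) ->
  forall t h a, 0 <= t <= 1 -> K a -> 0 <= u t h a.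
Proof.
move=> cK cu uC u0 uL t1 h1 a1 t1I a1K; rewrite leNgt; apply/negP => u1.
have [kappa kappa0 hk] := dot_bound.
pose B : R := 2 * m%:R * kappa ^+ 2.
have B0 : 0 <= B by rewrite mulr_ge0// ?mulr_ge0// exprn_ge0.
(* L is the rate in the hypothesis on u, B absorbs half the sum of the second derivatives of the
   barrier, and 1 makes the final inequality strict. *)
pose L' := L + B + 1.
pose b h : R := tilt0 h ^+ 2.
have b0 h : 0 < b h by rewrite exprn_gt0// tilt0_gt0.
pose e (t : R) := expR (- L' * t).
have e0 t : 0 < e t by exact: expR_gt0.
(* With this d the barrier eats up exactly half of the negative value, so U is still negative at the
   given point. *)
pose d : R := - (e t1 * u t1 h1 a1) / (2 * b h1).
have d0 : 0 < d.
  apply: divr_gt0; last by rewrite mulr_gt0.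
  by rewrite oppr_gt0 pmulr_rlt0.
pose U t h a := e t * u t h a + d * b h.
have U1 : U t1 h1 a1 < 0.
  have bn : b h1 != 0 by rewrite gt_eqF.
  have -> : U t1 h1 a1 = 2^-1 * (e t1 * u t1 h1 a1) by rewrite /U /d; field.
  by rewrite pmulr_rlt0 ?invr_gt0// pmulr_rlt0.
pose C' := `|C| * expR `|L'|.
have UC t h a : 0 <= t <= 1 -> K a -> tilt0 h * (d * tilt0 h - C') <= U t h a.
  move=> tI aK; rewrite /U /b.
  have h1' : `|C| * tilt0 h * expR `|L'| >= `|C| * tilt0 h * e t.
    rewrite ler_wpM2l// ?mulr_ge0 ?(ltW (tilt0_gt0 _))// ler_expR.
    apply: (le_trans (ler_norm _)); rewrite normrM normrN.
    case/andP: tI => t0' t1'; rewrite [ `|t|]ger0_norm//.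
    by rewrite ler_piMr.
  have h2' : - (`|C| * tilt0 h) <= u t h a.
    apply: le_trans (uC _ _ _ tI aK); rewrite lerN2 ler_wpM2r//.
      by rewrite (ltW (tilt0_gt0 _)).
    exact: ler_norm.
  have := ler_wpM2l (ltW (e0 t)) h2'; rewrite /C'; lra.
(* If some coordinate exceeds C' / d, then so does [tilt0], and [UC] gives U >= 0; the second
   summand puts h1 inside the box. *)
pose rho := C' / d + \sum_x `|h1 0 x|.
have C'0 : 0 <= C' by rewrite mulr_ge0// expR_ge0.
have sh0 : 0 <= \sum_x `|h1 0 x| by apply: sumr_ge0.
have Cd0 : 0 <= C' / d by rewrite divr_ge0// ltW.
have Uout t h a x : 0 <= t <= 1 -> K a -> rho < `|h 0 x| -> 0 <= U t h a.
  move=> tI aK hx; apply: le_trans (UC _ _ _ tI aK).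
  rewrite mulr_ge0 ?(ltW (tilt0_gt0 _))// subr_ge0 -ler_pdivrMl// mulrC.
  apply: le_trans (tilt0_ge h x); move: hx; rewrite /rho; lra.
pose box := [set h : 'rV[R]_N | forall x, `[- rho, rho]%classic (h 0 x)].
have cbox : compact box.
  apply: (@rV_compact _ _ (fun=> `[- rho, rho]%classic)) => _.
  exact: segment_compact.
pose D := (`[0 : R, 1]%classic `*` box) `*` K.
have cD : compact D by apply: compact_setX => //; apply: compact_setX => //; exact: segment_compact.
have D1 : D (t1, h1, a1).
  split => //=; split => /=; first by rewrite in_itv.
  move=> x /=; rewrite in_itv /= -ler_norml /rho.
  by rewrite (bigD1 x)//= addrCA lerDl addr_ge0// sumr_ge0.
have cU : continuous (fun p : R * 'rV[R]_N * A => U p.1.1 p.1.2 p.2).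
  apply: continuous_fD.
    apply: continuous_fM => //; apply: continuous_fexp; apply: continuous_fM.
      exact: continuous_fcst.
    move=> p; apply: (@cvg_comp _ _ _ fst fst); [exact: cvg_fst | exact: cvg_fst].
  apply: continuous_fM; first exact: continuous_fcst.
  have ct : continuous (fun p : R * 'rV[R]_N * A => tilt0 p.1.2).
    move=> p; apply: (@cvg_comp _ _ _ (fun p : R * 'rV[R]_N * A => p.1.2) tilt0); last exact: tilt0_continuous.
    by apply: (@cvg_comp _ _ _ fst snd); [exact: cvg_fst | exact: cvg_snd].
  by rewrite /b; under eq_fun do rewrite expr2; apply: continuous_fM.
have [|p pD pmin] := compact_EVT_min _ cD (continuous_subspaceT cU).
  by exists (t1, h1, a1).
move: p pD pmin => [[t0 h0] a0]; rewrite inE => -[/= [/= t0I h0box] a0K] pmin.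
have U0 : U t0 h0 a0 < 0.
  by apply: le_lt_trans U1; apply: (pmin (t1, h1, a1)); rewrite inE.
rewrite /= in_itv /= in t0I.
(* The minimum over the compact box is global, since U is nonnegative outside the box and negative
   at the minimum. *)
have Umin t h a : 0 <= t <= 1 -> K a -> U t0 h0 a0 <= U t h a.
  move=> tI aK; case: (pselect (box h)) => hb.
    by apply: (pmin (t, h, a)); rewrite inE; split => //=; split => //=; rewrite in_itv.
  have [x] : exists x, ~ `[- rho, rho]%classic (h 0 x) by apply/existsNP.
  rewrite /= in_itv /= -ler_norml => /negP; rewrite -ltNge => hx.
  exact: le_trans (ltW U0) (Uout _ _ _ x tI aK hx).
have ult0 : u t0 h0 a0 < 0.
  rewrite -(pmulr_rlt0 _ (e0 t0)); apply: le_lt_trans U0.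
  by rewrite /U lerDl mulr_ge0// ltW.
have t00 : 0 < t0.
  case/andP: t0I => t0' _; rewrite lt_neqAle t0' andbT; apply/negP => /eqP t0E.
  by move: ult0; rewrite -t0E ltNge u0.
(* U and u differ by a positive factor and a term that do not depend on the parameter, so a0 also
   minimizes u among all parameters. *)
have [|ut [uii [dut duii Lu]]] := uL t0 h0 a0 t0I a0K ult0.
  move=> a' a'K; have := Umin t0 h0 a' t0I a'K.
  by rewrite /U lerD2r ler_pM2l.
have [bii bii1 bii2] : exists2 bii : 'I_m -> R,
    forall i, has_deriv2 (fun y : R => b (h0 + y *: v i)) (bii i) &
    forall i, bii i <= 4 * kappa ^+ 2 * b h0.
  have hb i : {d : R | has_deriv2 (fun y : R => b (h0 + y *: v i)) d /\ d <= 4 * kappa ^+ 2 * b h0}.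
    apply/cid; have [d' h3 h4] := tilt0_deriv2 h0 (hk i); by exists d'.
  by exists (fun i => sval (hb i)) => i; case: (svalP (hb i)).
have dUt : is_derive t0 (1 : R) (fun t => U t h0 a0)
    (- L' * e t0 * u t0 h0 a0 + e t0 * ut).
  have de : is_derive t0 (1 : R) e (- L' * e t0).
    have h3 := is_derive_fM (is_derive_fcst (- L') t0) (is_derive_id t0 (1 : R)).
    have h4 := is_derive_fcomp h3 (is_derive_expR _).
    by apply: (is_derive_eq h4); rewrite mul0r add0r mulr1.
  have h3 := is_derive_fD (is_derive_fM de dut) (is_derive_fcst (d * b h0) t0).
  by apply: (is_derive_eq h3); rewrite addr0.
have Ut0 : - L' * e t0 * u t0 h0 a0 + e t0 * ut <= 0.
  apply: left_deriv_min t00 _ dUt => s /andP[s0 s1]; apply: Umin => //.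
  by rewrite s0 (le_trans s1)//; case/andP: t0I.
have Uii0 i : 0 <= e t0 * uii i + d * bii i.
  have dU2 : has_deriv2 (fun y : R => U t0 (h0 + y *: v i) a0) (e t0 * uii i + d * bii i).
    have [g1 [dg1 dg2]] := duii i; have [k1 [dk1 dk2]] := bii1 i.
    exists (fun y => e t0 * g1 y + d * k1 y); split.
      move=> y.
      have h3 := is_derive_fD (is_derive_fM (is_derive_fcst (e t0) y) (dg1 y))
        (is_derive_fM (is_derive_fcst d y) (dk1 y)).
      by apply: (is_derive_eq h3); rewrite !mul0r !add0r.
    have h3 := is_derive_fD (is_derive_fM (is_derive_fcst (e t0) 0) dg2)
        (is_derive_fM (is_derive_fcst d 0) dk2).
    by apply: (is_derive_eq h3); rewrite !mul0r !add0r.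
  apply: deriv2_min_ge0 dU2 => y; rewrite scale0r addr0.
  exact: Umin.
have S1 : 0 <= e t0 * \sum_i uii i + d * \sum_i bii i.
  by rewrite !mulr_sumr -big_split sumr_ge0// => i _; exact: Uii0.
have S2 : \sum_i bii i <= m%:R * (4 * kappa ^+ 2 * b h0).
  rewrite -[X in X%:R](card_ord m) -sum1_card natr_sum mulr_suml.
  by apply: ler_sum => i _; rewrite mul1r; exact: bii2.
have S3 : d * \sum_i bii i <= 2 * B * (d * b h0).
  have -> : 2 * B * (d * b h0) = d * (m%:R * (4 * kappa ^+ 2 * b h0)) by rewrite /B; ring.
  by rewrite ler_wpM2l// ltW.
(* The two derivative signs and [Lu] combine to 0 <= (B + 1) U - d b at the minimum, although U < 0
   < d b there. *)
have S4 := ler_wpM2l (ltW (e0 t0)) Lu.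
have S5 : 0 <= (B + 1) * - U t0 h0 a0.
  by rewrite mulr_ge0// ?addr_ge0// oppr_ge0 ltW.
have S6 : 0 < d * b h0 by rewrite mulr_gt0.
move: Ut0 S1 S3 S4 S5 S6; rewrite /U /L'.
move: (\sum_i uii i) (\sum_i bii i) => s1 s2.
lra.
Qed.

End Comparison.

(** * Variance and entropy along the heat flow *)

Section SecondDerivatives.
Context {R : realType}.
Variables (p q p1 q1 : R -> R).
Hypotheses (q_gt0 : forall y, 0 < q y)
  (dp : forall y : R, is_derive y (1 : R) p (p1 y))
  (dq : forall y : R, is_derive y (1 : R) q (q1 y)).

Let q_neq0 y : q y != 0. Proof. by rewrite gt_eqF. Qed.

Lemma deriv_sqr_div (y : R) : is_derive y (1 : R) (fun y => p y ^+ 2 / q y)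
  (2 * p y * p1 y / q y - p y ^+ 2 * q1 y / q y ^+ 2).
Proof.
have hd := is_derive_fM (is_derive_fM (dp y) (dp y)) (is_derive_finv (q_neq0 y) (dq y)).
apply: (is_derive_eq hd); have := q_neq0 y.
by move=> ?; field.
Qed.

(** The terms linear in [p2] and [q2] match the time derivative when p and q solve the heat
    equation. What remains is a square, and for p the tilt of f . s and q the mass it is the square
    of a covariance. *)
Lemma deriv2_sqr_div (p2 q2 : R) :
  is_derive (0 : R) (1 : R) p1 p2 -> is_derive (0 : R) (1 : R) q1 q2 ->
  has_deriv2 (fun y => p y ^+ 2 / q y)
    (2 * p 0 * p2 / q 0 - p 0 ^+ 2 * q2 / q 0 ^+ 2
     + 2 * (p1 0 - p 0 / q 0 * q1 0) ^+ 2 / q 0).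
Proof.
move=> dp1 dq1.
exists (fun y => 2 * p y * p1 y / q y - p y ^+ 2 * q1 y / q y ^+ 2); split.
  exact: deriv_sqr_div.
have dqV := is_derive_finv (q_neq0 0) (dq 0).
have h1 := is_derive_fM (is_derive_fM (is_derive_fM (is_derive_fcst 2 0) (dp 0)) dp1) dqV.
have q2_neq0 : q 0 ^+ 2 != 0 by rewrite expf_neq0.
have h2 := is_derive_fM (is_derive_fM (is_derive_fM (dp 0) (dp 0)) dq1)
  (is_derive_finv (f := fun y => q y ^+ 2) q2_neq0 (is_derive_fM (dq 0) (dq 0))).
have hd := is_derive_fB h1 h2.
apply: (is_derive_eq hd); have := q_neq0 0.
by move=> ?; field.
Qed.

Hypothesis p_gt0 : forall y, 0 < p y.
Let p_neq0 y : p y != 0. Proof. by rewrite gt_eqF. Qed.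

Let dln (y : R) : is_derive y (1 : R) (fun y => ln (p y) - ln (q y)) (p1 y / p y - q1 y / q y).
Proof.
apply: is_derive_fB.
  exact: is_derive_fcomp (dp y) (is_derive1_ln (p_gt0 y)).
exact: is_derive_fcomp (dq y) (is_derive1_ln (q_gt0 y)).
Qed.

Lemma deriv_mul_ln (y : R) : is_derive y (1 : R) (fun y => p y * (ln (p y) - ln (q y)))
  (p1 y * (ln (p y) - ln (q y) + 1) - p y / q y * q1 y).
Proof.
have hd := is_derive_fM (dp y) (dln y).
apply: (is_derive_eq hd); have := q_neq0 y; have := p_neq0 y.
by move=> ? ?; field; apply/andP.
Qed.

(** The same mechanism for the entropy: the surplus is p times the squared logarithmic derivative of
    p / q, which will be a squared shift of the mean. *)
Lemma deriv2_mul_ln (p2 q2 : R) :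
  is_derive (0 : R) (1 : R) p1 p2 -> is_derive (0 : R) (1 : R) q1 q2 ->
  has_deriv2 (fun y => p y * (ln (p y) - ln (q y)))
    (p2 * (ln (p 0) - ln (q 0) + 1) - p 0 / q 0 * q2
     + p 0 * (p1 0 / p 0 - q1 0 / q 0) ^+ 2).
Proof.
move=> dp1 dq1.
exists (fun y => p1 y * (ln (p y) - ln (q y) + 1) - p y / q y * q1 y); split.
  exact: deriv_mul_ln.
have h1 := is_derive_fM dp1 (is_derive_fD (dln 0) (is_derive_fcst 1 0)).
have h2 := is_derive_fM (is_derive_fM (dp 0) (is_derive_finv (q_neq0 0) (dq 0))) dq1.
have hd := is_derive_fB h1 h2.
apply: (is_derive_eq hd); have := q_neq0 0; have := p_neq0 0.
by move=> ? ?; field; apply/andP.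
Qed.

End SecondDerivatives.

Section Covariance.
Context {R : realType} {N m : nat} (v : 'I_m -> 'rV[R]_N).
Implicit Types (h f : 'rV[R]_N) (w : @config N -> R) (t : R).

Local Notation tilt := (tilt v).
Local Notation mass := (tilt (fun=> 1)).

Definition vdot f h : R := \sum_x f 0 x * h 0 x.

Lemma vdot_ge0 f : 0 <= vdot f f.
Proof. by apply: sumr_ge0 => x _; rewrite -expr2 sqr_ge0. Qed.

Lemma vdotZr f h (a : R) : vdot f (a *: h) = a * vdot f h.
Proof. by rewrite mulr_sumr; apply: eq_bigr => x _; rewrite !mxE; ring. Qed.

Lemma vdotZl f h (a : R) : vdot (a *: f) h = a * vdot f h.
Proof. by rewrite mulr_sumr; apply: eq_bigr => x _; rewrite !mxE; ring. Qed.

Lemma vdot_eq0 f : vdot f f = 0 -> f = 0.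
Proof.
move=> /eqP; rewrite psumr_eq0; last by move=> x _; rewrite -expr2 sqr_ge0.
move=> /allP h; apply/rowP => x; rewrite mxE.
by have := h x (mem_index_enum x); rewrite mulf_eq0 orbb => /eqP.
Qed.

Lemma mass_gt0 t h : 0 < mass t h.
Proof. exact: tilt_gt0. Qed.

(* The mass times the covariance of w1 and w2 under the normalized tilt. *)
Definition tcov w1 w2 t h :=
  tilt (fun s => w1 s * w2 s) t h - tilt w1 t h * tilt w2 t h / mass t h.

Lemma tcovC w1 w2 t h : tcov w1 w2 t h = tcov w2 w1 t h.
Proof.
rewrite /tcov [tilt w1 t h * _]mulrC; congr (_ - _).
by apply: eq_tilt => s; rewrite mulrC.
Qed.

Lemma tcov_ge0 w t h : 0 <= tcov w w t h.
Proof.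
have q0 := mass_gt0 t h; set c := tilt w t h / mass t h.
have : 0 <= tilt (fun s => (w s * w s + (- (2 * c) * w s)) + c ^+ 2 * 1) t h.
  apply: tilt_ge0 => s.
  by rewrite (_ : _ + _ = (w s - c) ^+ 2) ?sqr_ge0//; ring.
rewrite !tiltD !tiltZ /tcov.
rewrite (_ : _ + _ = tilt (fun s => w s * w s) t h - tilt w t h * tilt w t h / mass t h)//.
by rewrite /c; field; rewrite gt_eqF.
Qed.

Lemma tcovDl w1 w2 w t h :
  tcov (fun s => w1 s + w2 s) w t h = tcov w1 w t h + tcov w2 w t h.
Proof.
rewrite /tcov tiltD (@eq_tilt _ _ _ _ _ (fun s => w1 s * w s + w2 s * w s)).
  by rewrite tiltD; ring.
by move=> s; rewrite mulrDl.
Qed.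

Lemma tcovZl (a : R) w1 w t h :
  tcov (fun s => a * w1 s) w t h = a * tcov w1 w t h.
Proof.
rewrite /tcov tiltZ (@eq_tilt _ _ _ _ _ (fun s => a * (w1 s * w s))).
  by rewrite tiltZ; ring.
by move=> s; rewrite mulrA.
Qed.

Lemma tcov_suml (I : finType) (a : I -> R) (w1 : I -> @config N -> R) w t h :
  tcov (fun s => \sum_i a i * w1 i s) w t h = \sum_i a i * tcov (w1 i) w t h.
Proof.
rewrite /tcov tilt_sum (@eq_tilt _ _ _ _ _ (fun s => \sum_i a i * (w1 i s * w s))).
  rewrite tilt_sum -mulrA mulr_suml -sumrB; apply: eq_bigr => i _.
  by rewrite !tiltZ; ring.
by move=> s; rewrite mulr_suml; apply: eq_bigr => i _; rewrite mulrA.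
Qed.

Lemma tcov_eq w1 w1' w t h : w1 =1 w1' -> tcov w1 w t h = tcov w1' w t h.
Proof.
by move=> e; rewrite /tcov (eq_tilt _ _ _ e); congr (_ - _); apply: eq_tilt => s; rewrite e.
Qed.

Lemma tcov_dot f w t h :
  tcov (dot f) w t h = \sum_x f 0 x * tcov (fun s => spin s x) w t h.
Proof. by rewrite -tcov_suml. Qed.

Lemma tcov_dotB f1 f2 (c : R) t h :
  tcov (dot (f1 - c *: f2)) (dot (f1 - c *: f2)) t h =
  tcov (dot f1) (dot f1) t h - 2 * c * tcov (dot f2) (dot f1) t h
  + c ^+ 2 * tcov (dot f2) (dot f2) t h.
Proof.
have e : dot (f1 - c *: f2) =1 (fun s => dot f1 s + (- c) * dot f2 s).
  by move=> s; rewrite dotD -scaleNr dotZ.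
rewrite (tcov_eq _ _ _ e) tcovDl tcovZl ![tcov _ (dot (f1 - _)) _ _]tcovC.
rewrite !(tcov_eq _ _ _ e) !tcovDl !tcovZl [tcov (dot f1) (dot f2) _ _]tcovC.
ring.
Qed.

Lemma spin_sqr (s : @config N) x : spin s x * spin s x = 1 :> R.
Proof. by rewrite /spin -expr2 -exprM muln2 -signr_odd odd_double expr0. Qed.

Lemma tilt_product (S : pred 'I_N) h :
  tilt (fun s => \prod_x (if S x then spin s x else 1)) 0 h =
  \prod_x (\sum_(b : bool) (if S x then (-1) ^+ b else 1) * expR (h 0 x * (-1) ^+ b)).
Proof.
rewrite (bigA_distr_bigA (fun x (b : bool) => (if S x then (-1) ^+ b else 1) * expR (h 0 x * (-1) ^+ b))).
apply: eq_bigr => s _; rewrite mul0r add0r /dot expR_sum -big_split.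
by apply: eq_bigr.
Qed.

(** At t = 0 the spins are independent: the four sums in [tcov] share the factor [P0] of the other
    sites and differ only in the factors at x and y. *)
Lemma tcov_spin_neq x y h : x != y ->
  tcov (fun s => spin s x) (fun s => spin s y) 0 h = 0.
Proof.
move=> xy; have yx : y != x by rewrite eq_sym.
pose g c z : R := \sum_(b : bool) (if c then (-1) ^+ b else 1) * expR (h 0 z * (-1) ^+ b).
pose P0 : R := \prod_(z < N | (z != x) && (z != y)) g false z.
have E (S : pred 'I_N) w : (forall s, w s = \prod_x (if S x then spin s x else 1)) ->
    (forall z, z != x -> z != y -> S z = false) ->
    tilt w 0 h = g (S x) x * (g (S y) y * P0).
  move=> e S0; rewrite (@eq_tilt _ _ _ _ w _ _ _ e) tilt_product (bigD1 x)//= (bigD1 y)//=.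
  congr (_ * (_ * _)); apply: eq_bigr => z /andP[zx zy].
  by rewrite S0.
rewrite /tcov (E pred0 (fun=> 1))//; last by move=> s; rewrite big1.
rewrite (E (pred1 x) (fun s => spin s x)); last 2 first.
- by move=> s; rewrite (bigD1 x)//= eqxx big1 ?mulr1// => z /negPf ->.
- by move=> z /= /negPf ->.
rewrite (E (pred1 y) (fun s => spin s y)); last 2 first.
- by move=> s; rewrite (bigD1 y)//= eqxx big1 ?mulr1// => z /negPf ->.
- by move=> z /= _ /negPf ->.
rewrite (E (pred2 x y) (fun s => spin s x * spin s y)); last 2 first.
- move=> s; rewrite (bigD1 x)//= eqxx (bigD1 y)//= eqxx orbT big1 ?mulr1//.
  by move=> z /andP[/negPf -> /negPf ->].
- by move=> z /= /negPf -> /negPf ->.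
rewrite /= !eqxx (negPf xy) (negPf yx) orbT.
have pos (z : 'I_N) : g false z != 0.
  by rewrite /g big_bool /= gt_eqF// !mul1r addr_gt0// expR_gt0.
have P00 : P0 != 0 by apply/prodf_neq0 => z _; exact: pos.
by field; rewrite P00 !pos.
Qed.

(** The initial condition for the variance: only diagonal terms survive, and a sign has variance at
    most 1. *)
Lemma tcov_product f h :
  tcov (dot f) (dot f) 0 h <= vdot f f * mass 0 h.
Proof.
rewrite tcov_dot mulr_suml; apply: ler_sum => x _.
rewrite tcovC tcov_dot (bigD1 x)//= big1 ?addr0; last first.
  by move=> y yx; rewrite tcov_spin_neq// mulr0.
rewrite mulrA -expr2 ler_wpM2l ?sqr_ge0//.
rewrite /tcov (@eq_tilt _ _ _ _ _ (fun=> 1)); last by move=> s; exact: spin_sqr.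
by rewrite gerBl divr_ge0 ?(ltW (mass_gt0 _ _))// -expr2 sqr_ge0.
Qed.

Lemma dot_sqr_le f s : vdot f f = 1 -> dot f s * dot f s <= N%:R ^+ 2.
Proof.
move=> f1.
have fx x : `|f 0 x| <= 1.
  rewrite -(@ler_pXn2r _ 2)// ?nnegrE// expr1n -normrX ger0_norm ?sqr_ge0//.
  rewrite -f1 /vdot (bigD1 x)//= -expr2 lerDl.
  by apply: sumr_ge0 => y _; rewrite -expr2 sqr_ge0.
rewrite -expr2 -[_ ^+ 2]ger0_norm ?sqr_ge0// normrX; apply: lerXn2r; rewrite ?nnegrE//.
apply: (le_trans (ler_norm_sum _ _ _)).
rewrite -[X in X%:R](card_ord N) -sum1_card natr_sum; apply: ler_sum => x _.
by rewrite normrM /spin normr_sign mulr1.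
Qed.

Lemma sphere_compact : compact [set f | vdot f f = 1].
Proof.
apply: bounded_closed_compact.
  exists 1; split; first exact: num_real.
  move=> r r1 f /= f1; rewrite /Num.norm /= mx_normrE.
  apply: bigmax_le => /=; first by apply: ltW; apply: lt_trans r1.
  move=> [i x] _ /=; rewrite ord1; apply: le_trans (ltW r1).
  rewrite -(@ler_pXn2r _ 2)// ?nnegrE// expr1n -normrX ger0_norm ?sqr_ge0//.
  rewrite -f1 /vdot (bigD1 x)//= -expr2 lerDl.
  by apply: sumr_ge0 => y _; rewrite -expr2 sqr_ge0.
rewrite (_ : [set f | _] = (fun f => vdot f f) @^-1` [set 1]); last by [].
apply: closed_comp; last exact: closed_eq.
move=> f _; apply: continuous_fsum => x; apply: continuous_fM; exact: coord_continuous.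
Qed.

End Covariance.

(** * Variance of linear functions of the spins along the flow *)

Section VarianceBound.
Context {R : realType} {N m : nat} (v : 'I_m -> 'rV[R]_N) (j : R).
Hypotheses (j_ge0 : 0 <= j) (j_lt1 : j < 1)
  (v_le : forall w : 'rV[R]_N, \sum_i vdot (v i) w ^+ 2 <= j * vdot w w).
Implicit Types (h f : 'rV[R]_N) (w : @config N -> R) (t : R).

Local Notation tilt := (tilt v).
Local Notation mass := (tilt (fun=> 1)).
Local Notation tcov := (tcov v).

Lemma tilt_continuous_param (A : topologicalType) (w : A -> @config N -> R) :
  (forall s, continuous (fun a => w a s)) ->
  continuous (fun p : R * 'rV[R]_N * A => tilt (w p.2) p.1.1 p.1.2).
Proof.
move=> cw; apply: continuous_fsum => s; apply: continuous_fM.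
  move=> p; apply: (@cvg_comp _ _ _ snd (w ^~ s)); first exact: cvg_snd.
  exact: cw.
apply/continuous_fexp/continuous_fD.
  apply: continuous_fM; last exact: continuous_fcst.
  by move=> p; apply: (@cvg_comp _ _ _ fst fst); exact: cvg_fst.
move=> p; apply: (@cvg_comp _ _ _ (fun p : R * 'rV[R]_N * A => p.1.2) (dot ^~ s)).
  by apply: (@cvg_comp _ _ _ fst snd); [exact: cvg_fst | exact: cvg_snd].
exact: continuous_dot.
Qed.

Definition covvec w t h : 'rV[R]_N := \row_x tcov (fun s => spin s x) w t h.

Lemma tcov_covvec f w t h : tcov (dot f) w t h = vdot f (covvec w t h).
Proof. by rewrite tcov_dot; apply: eq_bigr => x _; rewrite mxE. Qed.

Lemma jt_bounds t : 0 <= t <= 1 -> 0 < 1 - j * t <= 1.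
Proof.
move=> /andP[t0 t1]; rewrite subr_gt0 gerBl mulr_ge0// andbT.
by apply: le_lt_trans j_lt1; rewrite ler_piMr.
Qed.

(** A maximizer f is a top eigenvector of the covariance matrix, so its covariance vector W has
    length lambda times the mass q. Spectral theory is avoided: the variance in direction W - lambda
    q f is nonnegative, the one in direction W is at most lambda |W|^2, and together they bound
    |W|^2. *)
Lemma tcov_max_direction f t h (lambda : R) : 0 < lambda -> vdot f f = 1 ->
  tcov (dot f) (dot f) t h = lambda * mass t h ->
  (forall g, tcov (dot g) (dot g) t h <= lambda * vdot g g * mass t h) ->
  vdot (covvec (dot f) t h) (covvec (dot f) t h) <= lambda ^+ 2 * mass t h ^+ 2.
Proof.
move=> l0 f1 fl gl; have q0 := mass_gt0 v t h.
set W := covvec (dot f) t h; set q := mass t h.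
have := tcov_ge0 v (dot (W - (lambda * q) *: f)) t h.
have fW : tcov (dot f) (dot W) t h = vdot W W by rewrite tcovC tcov_covvec.
rewrite tcov_dotB fW fl -/q => h1.
have h2 := gl W; rewrite -/q in h2.
have : 0 <= (lambda * q) * (lambda ^+ 2 * q ^+ 2 - vdot W W).
  by move: h1 h2; move: (tcov (dot W) _ _ _) => X; lra.
by rewrite pmulr_rge0 ?subr_ge0// mulr_gt0.
Qed.

(** At the worst unit direction, with variance lambda, the heat operator applied to u leaves j
    lambda q - (1 - j t) sum_i (v_i . W)^2 / q. By [v_le] and the bound on |W|^2 this is at least j
    lambda u, as the comparison principle requires. *)
Lemma variance_bound t h f : 0 <= t <= 1 ->
  (1 - j * t) * tcov (dot f) (dot f) t h <= vdot f f * mass t h.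
Proof.
pose u t h f := mass t h - (1 - j * t) * tcov (dot f) (dot f) t h.
have [C C0 hC] := tilt_bound v (fun=> N%:R ^+ 2).
have tcov_le f1 t1 h1 : vdot f1 f1 = 1 ->
    tcov (dot f1) (dot f1) t1 h1 <= tilt (fun=> N%:R ^+ 2) t1 h1.
  move=> f11; rewrite /tcov; apply: (@le_trans _ _ (tilt (fun s => dot f1 s * dot f1 s) t1 h1)).
    by rewrite gerBl divr_ge0 ?(ltW (mass_gt0 _ _ _))// -expr2 sqr_ge0.
  by apply: le_tilt => s; exact: dot_sqr_le.
suff H : forall t h f, 0 <= t <= 1 -> vdot f f = 1 -> 0 <= u t h f.
  move=> tI; have [f0|f0] := eqVneq (vdot f f) 0.
    have -> := vdot_eq0 f0.
    have e0 : dot (0 : 'rV[R]_N) =1 (fun s => 0 * dot 0 s).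
      by move=> s; rewrite mul0r dot0.
    rewrite (tcov_eq _ _ _ _ e0) tcovZl mul0r mulr0.
    by rewrite mulr_ge0// ?vdot_ge0// (ltW (mass_gt0 _ _ _)).
  have fp : 0 < vdot f f by rewrite lt_neqAle eq_sym f0 vdot_ge0.
  pose c := (Num.sqrt (vdot f f))^-1.
  have c2 : c ^+ 2 = (vdot f f)^-1 by rewrite exprVn sqr_sqrtr// ltW.
  have := H t h (c *: f) tI; rewrite vdotZr vdotZl mulrA -expr2 c2 mulVf// => /(_ erefl).
  have e1 : dot (c *: f) =1 (fun s => c * dot f s) by move=> s; rewrite dotZ.
  rewrite /u (tcov_eq _ _ _ _ e1) tcovZl tcovC (tcov_eq _ _ _ _ e1) tcovZl.
  rewrite mulrA -expr2 c2 => /(mulr_ge0 (ltW fp)).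
  rewrite mulrBr [X in _ - X](_ : _ = (1 - j * t) * tcov (dot f) (dot f) t h) ?subr_ge0//.
  by field.
move=> {t h f} t h f tI fK.
pose K := [set f : 'rV[R]_N | vdot f f = 1].
(* The rate must not depend on the point: since u < 0 and lambda <= N^2, the lower bound j lambda u
   is weakened to j N^2 u. *)
apply: (@parabolic_comparison R N m v _ K u C (j * N%:R ^+ 2)) => //; first 4 last.
- move=> {t h f tI fK} t h f tI fK u0 umin.
  have /andP[a0 a1] := jt_bounds tI.
  have q0 := mass_gt0 v t h; have qn0 : mass t h != 0 by rewrite gt_eqF.
  set q := mass t h in q0 qn0 *.
  pose lambda := tcov (dot f) (dot f) t h / q.
  have fl : tcov (dot f) (dot f) t h = lambda * q by rewrite /lambda divfK.
  have uE : u t h f = q * (1 - (1 - j * t) * lambda) by rewrite /u fl -/q; ring.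
  have al1 : 1 < (1 - j * t) * lambda.
    by move: u0; rewrite uE pmulr_rlt0// subr_lt0.
  have l0 : 0 < lambda by rewrite -(pmulr_rgt0 _ a0) (lt_trans _ al1).
  have lN : lambda <= N%:R ^+ 2.
    rewrite /lambda ler_pdivrMr//; apply: le_trans (tcov_le _ _ _ fK) _.
    rewrite -tiltZ; apply: le_tilt => s; by rewrite mulr1.
  have gl1 g : vdot g g = 1 -> tcov (dot g) (dot g) t h <= lambda * q.
    by move=> /umin; rewrite /u lerD2l lerN2 ler_pM2l// fl.
  have gl g : tcov (dot g) (dot g) t h <= lambda * vdot g g * q.
    have [g0|g0] := eqVneq (vdot g g) 0.
      have -> := vdot_eq0 g0.
      have e0 : dot (0 : 'rV[R]_N) =1 (fun s => 0 * dot 0 s).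
        by move=> s; rewrite mul0r dot0.
      rewrite (tcov_eq _ _ _ _ e0) tcovZl mul0r.
      by apply: mulr_ge0 (ltW q0); apply: mulr_ge0 (ltW l0) (vdot_ge0 _).
    have gp : 0 < vdot g g by rewrite lt_neqAle eq_sym g0 vdot_ge0.
    pose c := (Num.sqrt (vdot g g))^-1.
    have c2 : c ^+ 2 = (vdot g g)^-1 by rewrite exprVn sqr_sqrtr// ltW.
    have := gl1 (c *: g); rewrite vdotZr vdotZl mulrA -expr2 c2 mulVf// => /(_ erefl).
    have e1 : dot (c *: g) =1 (fun s => c * dot g s) by move=> s; rewrite dotZ.
    rewrite (tcov_eq _ _ _ _ e1) tcovZl tcovC (tcov_eq _ _ _ _ e1) tcovZl.
    rewrite mulrA -expr2 c2 => /(ler_wpM2l (ltW gp)).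
    by rewrite mulVKf// mulrCA mulrA.
  have WW := tcov_max_direction l0 fK fl gl.
  set W := covvec (dot f) t h in WW; rewrite -/q in WW.
  pose p := tilt (dot f) t h.
  pose w2 := (fun s : @config N => dot f s * dot f s).
  pose D (w : @config N -> R) i s := w s * dot (v i) s.
  have dW (w : @config N -> R) i y : is_derive y (1 : R) (fun y : R => tilt w t (h + y *: v i))
      (tilt (D w i) t (h + y *: v i)).
    exact: deriv_tilt_dir.
  have dW1 (w : @config N -> R) i : is_derive (0 : R) (1 : R)
      (fun y : R => tilt (D w i) t (h + y *: v i)) (tilt (D (D w i) i) t h).
    have hd := deriv_tilt_dir v (D w i) t h (v i) 0.
    by apply: (is_derive_eq hd); rewrite scale0r addr0.
  have E2 (w : @config N -> R) : tilt (fun s => w s * energy v s) t h =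
      2^-1 * \sum_i tilt (D (D w i) i) t h by rewrite tilt_energy.
  have sqE i : tilt (D (dot f) i) t h - p / q * tilt (D (fun=> 1) i) t h = vdot (v i) W.
    rewrite -tcov_covvec tcovC /tcov /D -/p -/q; congr (_ - _).
    rewrite [X in _ * X](@eq_tilt _ _ _ _ _ (dot (v i))); last by move=> s; rewrite mul1r.
    by rewrite mulrAC.
  have dqt := deriv_tilt_time v (fun=> 1) t h.
  have qt_gt0 s : 0 < mass s h by exact: mass_gt0.
  have gen : forall (I : finType) (X Y Z T : I -> R) (x y z s : R),
      \sum_i (x * X i + y * Y i + z * Z i + s * T i) =
      x * \sum_i X i + y * \sum_i Y i + z * \sum_i Z i + s * \sum_i T i.
    by move=> *; rewrite !big_split /= !mulr_sumr.
  (* The time derivative is kept in the unsimplified shape produced by the differentiation rules, so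
     that it is recognized by [exact]; the cancellation is left to [field]. *)
  exists (tilt (fun s => 1 * energy v s) t h - ((0 - (0 * t + j * 1)) * tcov (dot f) (dot f) t h +
    (1 - j * t) * (tilt (fun s => w2 s * energy v s) t h -
      (2 * p * tilt (fun s => dot f s * energy v s) t h / q -
       p ^+ 2 * tilt (fun s => 1 * energy v s) t h / q ^+ 2)))).
  exists (fun i => (1 + (1 - j * t) * - (p ^+ 2 / q ^+ 2)) * tilt (D (D (fun=> 1) i) i) t h +
    (- (1 - j * t)) * tilt (D (D w2 i) i) t h +
    ((1 - j * t) * (2 * p / q)) * tilt (D (D (dot f) i) i) t h +
    ((1 - j * t) * (2 / q)) * vdot (v i) W ^+ 2).
  split.
  + rewrite /u.
    have h1 := is_derive_fB (is_derive_fcst 1 t) (is_derive_fM (is_derive_fcst j t) (is_derive_id t (1 : R))).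
    have h2 := is_derive_fB (deriv_tilt_time v w2 t h)
      (deriv_sqr_div qt_gt0 (fun y => deriv_tilt_time v (dot f) y h)
         (fun y => deriv_tilt_time v (fun=> 1) y h) t).
    exact: (is_derive_fB dqt (is_derive_fM h1 h2)).
  + move=> i; rewrite /u.
    have qy_gt0 (y : R) : 0 < mass t (h + y *: v i) by exact: mass_gt0.
    have [g1 [dg1 dg2]] := deriv2_sqr_div qy_gt0 (dW (dot f) i) (dW (fun=> 1) i)
      (dW1 (dot f) i) (dW1 (fun=> 1) i).
    exists (fun y => tilt (D (fun=> 1) i) t (h + y *: v i) -
       (1 - j * t) * (tilt (D w2 i) t (h + y *: v i) - g1 y)); split.
      move=> y.
      have h3 := is_derive_fB (dW (fun=> 1) i y)
        (is_derive_fM (is_derive_fcst (1 - j * t) y) (is_derive_fB (dW w2 i y) (dg1 y))).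
      by apply: (is_derive_eq h3); rewrite mul0r add0r.
    have h3 := is_derive_fB (dW1 (fun=> 1) i)
        (is_derive_fM (is_derive_fcst (1 - j * t) 0) (is_derive_fB (dW1 w2 i) dg2)).
    apply: (is_derive_eq h3); rewrite scale0r addr0 sqE -/p -/q.
    by field.
  + rewrite gen !E2 uE fl; set S0 := \sum_i _; set S1 := \sum_i _; set S2 := \sum_i _.
    have vW := v_le W.
    have -> : 2^-1 * S0 - ((0 - (0 * t + j * 1)) * (lambda * q) + (1 - j * t) *
      (2^-1 * S1 - (2 * p * (2^-1 * S2) / q - p ^+ 2 * (2^-1 * S0) / q ^+ 2))) -
      2^-1 * ((1 + (1 - j * t) * - (p ^+ 2 / q ^+ 2)) * S0 + - (1 - j * t) * S1 +
        (1 - j * t) * (2 * p / q) * S2 + (1 - j * t) * (2 / q) * \sum_i vdot (v i) W ^+ 2) =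
      j * (lambda * q) - (1 - j * t) * ((\sum_i vdot (v i) W ^+ 2) / q) by field.
    have h1 : (\sum_i vdot (v i) W ^+ 2) / q <= j * lambda ^+ 2 * q.
      rewrite ler_pdivrMr//; apply: (le_trans vW).
      have -> : j * lambda ^+ 2 * q * q = j * (lambda ^+ 2 * q ^+ 2) by ring.
      by rewrite ler_wpM2l.
    have h2 := ler_wpM2l (ltW a0) h1.
    apply: (@le_trans _ _ (j * lambda * (q * (1 - (1 - j * t) * lambda)))); last by lra.
    rewrite ler_wnM2r//; first by rewrite -uE ltW.
    by rewrite ler_wpM2l.
- exact: sphere_compact.
- rewrite /u; apply: continuous_fB.
    by apply: (@tilt_continuous_param _ (fun _ _ => 1)) => s; exact: continuous_fcst.
  have cdot s : continuous (fun f : 'rV[R]_N => dot f s) by exact: continuous_dot.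
  apply: continuous_fM.
    apply: continuous_fB; first exact: continuous_fcst.
    apply: continuous_fM; first exact: continuous_fcst.
    by move=> p; apply: (@cvg_comp _ _ _ fst fst); exact: cvg_fst.
  apply: continuous_fB.
    by apply: (@tilt_continuous_param _ (fun f s => dot f s * dot f s)) => s; exact: continuous_fM.
  apply: continuous_fM.
    apply: continuous_fM; exact: (@tilt_continuous_param _ (fun f s => dot f s)).
  apply: continuous_fV; last by move=> p; rewrite gt_eqF// mass_gt0.
  by apply: (@tilt_continuous_param _ (fun _ _ => 1)) => s; exact: continuous_fcst.
- move=> {t h f tI fK} t h f tI fK.
  have /andP[a0 a1] := jt_bounds tI.
  have h1 := hC t h tI; have h2 := tcov_le f t h fK; have q0 := mass_gt0 v t h.
  have h3 := tcov_ge0 v (dot f) t h.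
  have h4 := ler_norm (tilt (fun=> N%:R ^+ 2) t h).
  have h5 : (1 - j * t) * tcov (dot f) (dot f) t h <= tcov (dot f) (dot f) t h.
    by rewrite ler_piMl.
  by rewrite /u; lra.
- move=> {t h f tI fK} h f fK; rewrite /u mulr0 subr0 mul1r subr_ge0.
  by apply: (le_trans (tcov_product _ _ _)); rewrite fK mul1r.
Qed.

End VarianceBound.

Section TaylorBound.
Context {R : realType}.

Lemma deriv_le0_nincr (f df : R -> R) :
  (forall y : R, is_derive y (1 : R) f (df y)) ->
  (forall y, 0 <= y -> df y <= 0) -> forall y, 0 <= y -> f y <= f 0.
Proof.
move=> dfd df0 y; rewrite le_eqVlt => /predU1P[<-//|y0].
have cf : {within `[0, y], continuous f}.
  apply: continuous_subspaceT => z.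
  by apply: differentiable_continuous; apply/derivable1_diffP; case: (dfd z).
have [c] := @MVT R f df 0 y y0 (fun x _ => dfd x) cf.
rewrite in_itv /= => /andP[c0 _] e; rewrite -subr_le0 e subr0.
by rewrite mulr_le0_ge0// ?df0// ltW.
Qed.

Lemma taylor2_le (f f1 f2 : R -> R) (M : R) :
  (forall y : R, is_derive y (1 : R) f (f1 y)) ->
  (forall y : R, is_derive y (1 : R) f1 (f2 y)) ->
  (forall y, f2 y <= M) -> f 1 <= f 0 + f1 0 + 2^-1 * M.
Proof.
move=> df df1 f2M.
have h1 y : 0 <= y -> f1 y <= f1 0 + M * y.
  move=> y0.
  have dg (z : R) : is_derive z (1 : R) (fun z => f1 z - M * z) (f2 z - M).
    have h := is_derive_fB (df1 z) (is_derive_fM (is_derive_fcst M z) (is_derive_id z (1 : R))).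
    by apply: (is_derive_eq h); rewrite mul0r add0r mulr1.
  have dg0 z : 0 <= z -> f2 z - M <= 0 by rewrite subr_le0.
  by have := deriv_le0_nincr dg dg0 y0; rewrite mulr0 subr0 lerBlDr.
have dg (z : R) : is_derive z (1 : R) (fun z => f z - (f1 0 * z + 2^-1 * M * (z * z)))
    (f1 z - (f1 0 + M * z)).
  have h := is_derive_fB (df z) (is_derive_fD
     (is_derive_fM (is_derive_fcst (f1 0) z) (is_derive_id z (1 : R)))
     (is_derive_fM (is_derive_fcst (2^-1 * M) z)
        (is_derive_fM (is_derive_id z (1 : R)) (is_derive_id z (1 : R))))).
  by apply: (is_derive_eq h); field.
have dg0 z : 0 <= z -> f1 z - (f1 0 + M * z) <= 0.
  by move=> z0; rewrite subr_le0 h1.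
by have := deriv_le0_nincr dg dg0 ler01; lra.
Qed.

(** Legendre duality between exp and g ln g - g, obtained from 1 + z <= exp z at z = y - ln g. *)
Lemma young_expR (g y : R) : 0 < g -> g * y <= g * ln g - g + expR y.
Proof.
move=> g0; have := expR_ge1Dx (y - ln g).
rewrite expRB lnK// ler_pdivlMr//; lra.
Qed.

End TaylorBound.

(** * Entropy of a fixed density along the flow *)

Section EntropyBound.
Context {R : realType} {N m : nat} (v : 'I_m -> 'rV[R]_N) (j : R).
Hypotheses (j_ge0 : 0 <= j) (j_lt1 : j < 1)
  (v_le : forall w : 'rV[R]_N, \sum_i vdot (v i) w ^+ 2 <= j * vdot w w).
Implicit Types (h f : 'rV[R]_N) (w : @config N -> R) (t : R).
Variables (G W : @config N -> R).
Hypothesis G_gt0 : forall s, 0 < G s.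

Local Notation tilt := (tilt v).
Local Notation mass := (tilt (fun=> 1)).
Local Notation tcov := (tcov v).

(** The second derivative of the log-partition function along f is the variance of f . s, bounded by
    [variance_bound] at every field on the line. *)
Lemma log_mass_taylor t h f : 0 <= t <= 1 ->
  ln (mass t (h + f)) <= ln (mass t h) + tilt (dot f) t h / mass t h
    + 2^-1 * ((1 - j * t)^-1 * vdot f f).
Proof.
move=> tI; have /andP[a0 a1] := jt_bounds j_ge0 j_lt1 tI.
have dW (w : @config N -> R) (y : R) : is_derive y (1 : R) (fun y : R => tilt w t (h + y *: f))
      (tilt (fun s => w s * dot f s) t (h + y *: f)).
  exact: deriv_tilt_dir.
have q0 (y : R) : 0 < mass t (h + y *: f) by exact: mass_gt0.
have qn0 (y : R) : mass t (h + y *: f) != 0 by rewrite gt_eqF.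
have d1 (y : R) : is_derive y (1 : R) (fun y : R => ln (mass t (h + y *: f)))
    (tilt (fun s => 1 * dot f s) t (h + y *: f) * (mass t (h + y *: f))^-1).
  exact: is_derive_fcomp (dW _ _) (is_derive1_ln (q0 y)).
have d2 (y : R) := is_derive_fM (dW (fun s => 1 * dot f s) y) (is_derive_finv (qn0 y) (dW (fun=> 1) y)).
have := taylor2_le (M := (1 - j * t)^-1 * vdot f f) d1 d2.
have e1 : (fun s : @config N => 1 * dot f s) =1 dot f by move=> s; rewrite mul1r.
rewrite scale1r !scale0r !addr0 (eq_tilt _ _ _ e1); apply => y.
have := variance_bound j_ge0 j_lt1 v_le (h + y *: f) f tI.
rewrite /tcov (eq_tilt _ _ _ e1) (@eq_tilt _ _ _ _ (fun s => 1 * dot f s * dot f s) (fun s => dot f s * dot f s)); last first.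
  by move=> s; rewrite mul1r.
have := q0 y; have := qn0 y.
move: (mass _ _) (tilt (dot f) _ _) (tilt (fun s => dot f s * dot f s) _ _) => q p p2 qy qy0 hv.
rewrite [leRHS]mulrC ler_pdivlMr// -(@ler_pM2r _ q)//; apply: le_trans _ hv; rewrite -subr_ge0.
by rewrite (_ : _ - _ = 0)//; field.
Qed.

Lemma gibbs_variational (X : @config N -> R) t h :
  tilt (fun s => G s * X s) t h <= tilt (fun s => G s * ln (G s)) t h
    - tilt G t h * ln (tilt G t h) + tilt G t h * ln (tilt (fun s => expR (X s)) t h).
Proof.
have p0 : 0 < tilt G t h by exact: tilt_gt0.
have e0 : 0 < tilt (fun s => expR (X s)) t h by apply: tilt_gt0 => s; exact: expR_gt0.
set p := tilt G t h; set e := tilt (fun s => expR (X s)) t h.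
(* The shift that normalizes exp X to the same total as G, so that the term - G s and the
   exponential cancel after summation. *)
pose k := ln p - ln e.
have : tilt (fun s => G s * X s + k * G s) t h <=
    tilt (fun s => (G s * ln (G s) + (- 1) * G s) + expR k * expR (X s)) t h.
  apply: le_tilt => s; have := young_expR (X s + k) (G_gt0 s).
  by rewrite expRD; lra.
rewrite !tiltD !tiltZ -/p -/e /k expRB lnK// lnK// divfK ?gt_eqF//.
by lra.
Qed.

(** The mass times the entropy of G under the normalized tilt. *)
Definition tent t h := tilt (fun s => G s * ln (G s)) t h
  - tilt G t h * (ln (tilt G t h) - ln (mass t h)).

(** The difference of the mean spin vectors with and without the density G. *)
Definition meanshift t h : 'rV[R]_N :=
  \row_x (tilt (fun s => G s * spin s x) t h / tilt G t h
    - tilt (fun s => spin s x) t h / mass t h).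

Lemma tilt_mul_dot w f t h :
  tilt (fun s => w s * dot f s) t h = \sum_x f 0 x * tilt (fun s => w s * spin s x) t h.
Proof.
rewrite -(@eq_bigr _ _ _ _ _ _ (fun x => tilt (fun s => f 0 x * (w s * spin s x)) t h)).
  rewrite -tilt_sum; apply: eq_tilt => s; rewrite mulr_sumr.
  by apply: eq_bigr => x _; ring.
by move=> x _; rewrite tiltZ.
Qed.

Lemma vdot_meanshift f t h : vdot f (meanshift t h) =
  tilt (fun s => G s * dot f s) t h / tilt G t h - tilt (dot f) t h / mass t h.
Proof.
rewrite tilt_mul_dot (@eq_tilt _ _ _ _ (dot f) (fun s => 1 * dot f s)); last first.
  by move=> s; rewrite mul1r.
rewrite tilt_mul_dot !mulr_suml -sumrB; apply: eq_bigr => x _.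
rewrite !mxE (@eq_tilt _ _ _ _ (fun s => 1 * spin s x) (fun s => spin s x)); first by ring.
by move=> s; rewrite mul1r.
Qed.

Lemma entropic_stability t h : 0 <= t <= 1 ->
  2^-1 * (1 - j * t) * tilt G t h * vdot (meanshift t h) (meanshift t h) <= tent t h.
Proof.
move=> tI; have /andP[a0 a1] := jt_bounds j_ge0 j_lt1 tI.
set a := 1 - j * t in a0 a1 *; set w := meanshift t h.
have p0 : 0 < tilt G t h by exact: tilt_gt0.
(* Tilting by theta w gains theta |w|^2 and costs theta^2 |w|^2 / (2 a); the optimum is theta =
   a. *)
have h1 := gibbs_variational (dot (a *: w)) t h.
have e1 : tilt (fun s => expR (dot (a *: w) s)) t h = mass t (h + a *: w).
  by apply: eq_bigr => s _; rewrite mul1r [dot (h + _) s]dotD addrA [in RHS]expRD [LHS]mulrC.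
have h2 := log_mass_taylor h (a *: w) tI; rewrite -/a in h2.
have h3 := vdot_meanshift (a *: w) t h; rewrite -/w in h3.
have h3' : tilt (fun s => G s * dot (a *: w) s) t h =
    tilt G t h * (vdot (a *: w) w + tilt (dot (a *: w)) t h / mass t h).
  by rewrite h3 subrK mulrC divfK// gt_eqF.
rewrite e1 h3' vdotZl in h1; rewrite vdotZl vdotZr mulKf ?gt_eqF// in h2.
have h4 := ler_wpM2l (ltW p0) h2.
rewrite /tent; lra.
Qed.

Lemma tent_ge0 t h : 0 <= t <= 1 -> 0 <= tent t h.
Proof.
move=> tI; have /andP[a0 a1] := jt_bounds j_ge0 j_lt1 tI.
apply: le_trans (entropic_stability h tI).
by rewrite !mulr_ge0// ?vdot_ge0// ?invr_ge0// ?(ltW a0)// ltW// tilt_gt0.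
Qed.

(** The heat operator applied to u leaves j E - (1 - j t) p / 2 sum_i (v_i . w)^2, with E the
    entropy [tent], p = [tilt G t h] and w the mean shift; it is nonnegative by [v_le] and
    [entropic_stability], so the rate L = 0 suffices. *)
Lemma entropy_bound : (forall h, tent 0 h <= tilt W 0 h) ->
  forall t h, 0 <= t <= 1 -> (1 - j * t) * tent t h <= tilt W t h.
Proof.
move=> H0.
(* A single function is compared here, seen as a constant family over the compact interval
   [0, 1]. *)
pose u t h (_ : R) := tilt W t h - (1 - j * t) * tent t h.
pose GG := (fun s => G s * ln (G s)).
suff H : forall t h (a : R), 0 <= t <= 1 -> `[0 : R, 1]%classic a -> 0 <= u t h a.
  move=> t h tI; have := H t h 0 tI; rewrite /u subr_ge0; apply.
  by rewrite /= in_itv /= lexx ler01.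
have [C1 C10 hC1] := tilt_bound v W.
have [C2 C20 hC2] := tilt_bound v (fun s => GG s + (- 1 * G s + 1)).
apply: (@parabolic_comparison R N m v R `[0, 1]%classic u (C1 + C2) 0).
- exact: segment_compact.
- have ct (w : @config N -> R) : continuous (fun p : R * 'rV[R]_N * R => tilt w p.1.1 p.1.2).
    by apply: (@tilt_continuous_param _ _ _ _ _ (fun _ s => w s)) => s; exact: continuous_fcst.
  apply: continuous_fB => //; apply: continuous_fM.
    apply: continuous_fB; first exact: continuous_fcst.
    apply: continuous_fM; first exact: continuous_fcst.
    by move=> p; apply: (@cvg_comp _ _ _ fst fst); exact: cvg_fst.
  apply: continuous_fB => //; apply: continuous_fM => //; apply: continuous_fB.
    by apply: continuous_fln => // p; exact: tilt_gt0.
  by apply: continuous_fln => // p; exact: tilt_gt0.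
- move=> t h a tI _; have /andP[a0 a1] := jt_bounds j_ge0 j_lt1 tI.
  have h1 := hC1 t h tI; have h2 := hC2 t h tI.
  have h3 := ler_norm (- tilt W t h); rewrite normrN in h3.
  have h4 := ler_norm (tilt (fun s => GG s + (- 1 * G s + 1)) t h).
  have h5 : (1 - j * t) * tent t h <= tent t h by rewrite ler_piMl// tent_ge0.
  (* Young's inequality replaces p (ln q - ln p) by q - p, which leaves a single exponential sum, of
     growth O([tilt0]). *)
  have h6 : tent t h <= tilt (fun s => GG s + (- 1 * G s + 1)) t h.
    have p0 : 0 < tilt G t h by exact: tilt_gt0.
    have := young_expR (ln (mass t h)) p0; rewrite lnK ?posrE ?mass_gt0//.
    rewrite !tiltD tiltZ /tent -/GG; lra.
  by rewrite /u; lra.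
- by move=> h a _; rewrite /u mulr0 subr0 mul1r subr_ge0.
move=> t h a tI _ u0 _.
have /andP[a0 a1] := jt_bounds j_ge0 j_lt1 tI.
have q0 := mass_gt0 v t h; have p0 : 0 < tilt G t h by exact: tilt_gt0.
set q := mass t h in q0; set p := tilt G t h in p0; set ms := meanshift t h.
have qn0 : q != 0 by rewrite gt_eqF.
have pn0 : p != 0 by rewrite gt_eqF.
pose D (w : @config N -> R) i s := w s * dot (v i) s.
have dW (w : @config N -> R) i y : is_derive y (1 : R) (fun y : R => tilt w t (h + y *: v i))
    (tilt (D w i) t (h + y *: v i)).
  exact: deriv_tilt_dir.
have dW1 (w : @config N -> R) i : is_derive (0 : R) (1 : R)
    (fun y : R => tilt (D w i) t (h + y *: v i)) (tilt (D (D w i) i) t h).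
  have hd := deriv_tilt_dir v (D w i) t h (v i) 0.
  by apply: (is_derive_eq hd); rewrite scale0r addr0.
have E2 (w : @config N -> R) : tilt (fun s => w s * energy v s) t h =
    2^-1 * \sum_i tilt (D (D w i) i) t h by rewrite tilt_energy.
have sqE i : tilt (D G i) t h / p - tilt (D (fun=> 1) i) t h / q = vdot (v i) ms.
  rewrite vdot_meanshift; congr (_ - _ / _).
  by apply: eq_tilt => s; rewrite /D mul1r.
have gen : forall (I : finType) (X Y Z T S : I -> R) (x y z s r : R),
    \sum_i (x * X i + y * Y i + z * Z i + s * T i + r * S i) =
    x * \sum_i X i + y * \sum_i Y i + z * \sum_i Z i + s * \sum_i T i + r * \sum_i S i.
  by move=> *; rewrite !big_split /= !mulr_sumr.
pose r := ln p - ln q.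
exists (tilt (fun s => W s * energy v s) t h - ((0 - (0 * t + j * 1)) * tent t h +
  (1 - j * t) * (tilt (fun s => GG s * energy v s) t h -
    (tilt (fun s => G s * energy v s) t h * (r + 1) - p / q * tilt (fun s => 1 * energy v s) t h)))).
exists (fun i => 1 * tilt (D (D W i) i) t h + (- (1 - j * t)) * tilt (D (D GG i) i) t h +
  ((1 - j * t) * (r + 1)) * tilt (D (D G i) i) t h +
  (- (1 - j * t) * (p / q)) * tilt (D (D (fun=> 1) i) i) t h +
  ((1 - j * t) * p) * vdot (v i) ms ^+ 2).
split.
- rewrite /u /tent.
  have h1 := is_derive_fB (is_derive_fcst 1 t) (is_derive_fM (is_derive_fcst j t) (is_derive_id t (1 : R))).
  have qt_gt0 s : 0 < mass s h by exact: mass_gt0.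
  have pt_gt0 s : 0 < tilt G s h by exact: tilt_gt0.
  have h2 := is_derive_fB (deriv_tilt_time v GG t h)
    (deriv_mul_ln qt_gt0 (fun y => deriv_tilt_time v G y h)
       (fun y => deriv_tilt_time v (fun=> 1) y h) pt_gt0 t).
  exact: (is_derive_fB (deriv_tilt_time v W t h) (is_derive_fM h1 h2)).
- move=> i; rewrite /u /tent -/GG.
  have qy_gt0 (y : R) : 0 < mass t (h + y *: v i) by exact: mass_gt0.
  have py_gt0 (y : R) : 0 < tilt G t (h + y *: v i) by exact: tilt_gt0.
  have [g1 [dg1 dg2]] := deriv2_mul_ln qy_gt0 (dW G i) (dW (fun=> 1) i) py_gt0
    (dW1 G i) (dW1 (fun=> 1) i).
  exists (fun y => tilt (D W i) t (h + y *: v i) -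
     (1 - j * t) * (tilt (D GG i) t (h + y *: v i) - g1 y)); split.
    move=> y.
    have h3 := is_derive_fB (dW W i y)
      (is_derive_fM (is_derive_fcst (1 - j * t) y) (is_derive_fB (dW GG i y) (dg1 y))).
    by apply: (is_derive_eq h3); rewrite mul0r add0r.
  have h3 := is_derive_fB (dW1 W i)
      (is_derive_fM (is_derive_fcst (1 - j * t) 0) (is_derive_fB (dW1 GG i) dg2)).
  apply: (is_derive_eq h3); rewrite scale0r addr0 -/p -/q sqE -/r.
  by field.
- rewrite gen !E2 mul0r; set S0 := \sum_i _; set S1 := \sum_i _; set S2 := \sum_i _; set S3 := \sum_i _.
  have h1 := entropic_stability h tI; rewrite -/ms -/p in h1.
  have vW := v_le ms.
  have h2 : (1 - j * t) * (2^-1 * p * (\sum_i vdot (v i) ms ^+ 2)) <= (1 - j * t) * (2^-1 * p * (j * vdot ms ms)).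
    by rewrite ler_pM2l// ler_pM2l// mulr_gt0// invr_gt0.
  have h3 := ler_wpM2l j_ge0 h1.
  have -> : 2^-1 * S0 - ((0 - (0 * t + j * 1)) * tent t h + (1 - j * t) * (2^-1 * S1 - (2^-1 * S2 * (r + 1) - p / q * (2^-1 * S3))))
    - 2^-1 * (1 * S0 + - (1 - j * t) * S1 + (1 - j * t) * (r + 1) * S2 + - (1 - j * t) * (p / q) * S3 +
     (1 - j * t) * p * \sum_i vdot (v i) ms ^+ 2) = j * tent t h - (1 - j * t) * (2^-1 * p * \sum_i vdot (v i) ms ^+ 2).
    by ring.
  by lra.
Qed.

End EntropyBound.

(** * Tensorization *)

Section TwoPoint.
Context {R : realType}.
Implicit Types a b c d p q r x y : R.

(** [young_expR] is used on both terms with the common shift k, for which the two exponentials add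
    up to x1 + x2. *)
Lemma log_sum x1 x2 y1 y2 : 0 < x1 -> 0 < x2 -> 0 < y1 -> 0 < y2 ->
  (x1 + x2) * (ln (x1 + x2) - ln (y1 + y2)) <=
  x1 * (ln x1 - ln y1) + x2 * (ln x2 - ln y2).
Proof.
move=> x10 x20 y10 y20.
have X0 : 0 < x1 + x2 by rewrite addr_gt0.
have Y0 : 0 < y1 + y2 by rewrite addr_gt0.
pose k := ln (x1 + x2) - ln (y1 + y2).
have ek : expR k = (x1 + x2) / (y1 + y2) by rewrite /k expRB !lnK.
have h1 := young_expR (ln y1 + k) x10; have h2 := young_expR (ln y2 + k) x20.
rewrite expRD ek lnK// in h1; rewrite expRD ek lnK// in h2.
have e : y1 * ((x1 + x2) / (y1 + y2)) + y2 * ((x1 + x2) / (y1 + y2)) = x1 + x2.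
  by rewrite -mulrDl mulrCA divff ?mulr1// gt_eqF.
rewrite -/k; lra.
Qed.

Definition ent2 p q a b :=
  p * (a * ln a) + q * (b * ln b) - (p * a + q * b) * ln (p * a + q * b).

(** Two-point entropy is convex and homogeneous: apply the log-sum inequality at each of the two
    points, against the two means. *)
Lemma ent2_subadd p q r r' a b c d : 0 < p -> 0 < q -> 0 < r -> 0 < r' ->
  0 < a -> 0 < b -> 0 < c -> 0 < d ->
  ent2 p q (r * a + r' * c) (r * b + r' * d) <= r * ent2 p q a b + r' * ent2 p q c d.
Proof.
move=> p0 q0 r0 r'0 a0 b0 c0 d0.
pose m1 := p * a + q * b; pose m2 := p * c + q * d.
have m10 : 0 < m1 by rewrite addr_gt0// mulr_gt0.
have m20 : 0 < m2 by rewrite addr_gt0// mulr_gt0.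
have hm : p * (r * a + r' * c) + q * (r * b + r' * d) = r * m1 + r' * m2.
  by rewrite /m1 /m2; ring.
rewrite /ent2 hm -/m1 -/m2.
have h1 := log_sum (mulr_gt0 r0 a0) (mulr_gt0 r'0 c0) (mulr_gt0 r0 m10) (mulr_gt0 r'0 m20).
have h2 := log_sum (mulr_gt0 r0 b0) (mulr_gt0 r'0 d0) (mulr_gt0 r0 m10) (mulr_gt0 r'0 m20).
rewrite (lnM r0 a0) (lnM r'0 c0) (lnM r0 m10) (lnM r'0 m20) in h1.
rewrite (lnM r0 b0) (lnM r'0 d0) (lnM r0 m10) (lnM r'0 m20) in h2.
have := ler_wpM2l (ltW p0) h1; have := ler_wpM2l (ltW q0) h2.
have e : r * m1 + r' * m2 = p * (r * a + r' * c) + q * (r * b + r' * d) by rewrite hm.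
rewrite [X in _ - X * _]e.
rewrite [X in _ <= r * (_ - X * _) + _](_ : _ = p * a + q * b)//.
rewrite [X in _ <= _ + r' * (_ - X * _)](_ : _ = p * c + q * d)//.
lra.
Qed.

(** From ln z <= z - 1, entropy is at most variance over mean. The variance of the square is p q (f
    - g)^2 (f + g)^2, and p q (f + g)^2 is at most 2 m, where m is the mean. The constant 2 is
    uniform in p, hence in the external field. *)
Lemma ent2_sqr_le p q f g : 0 < p -> 0 < q -> p + q = 1 -> f != 0 -> g != 0 ->
  ent2 p q (f ^+ 2) (g ^+ 2) <= 2 * (f - g) ^+ 2.
Proof.
move=> p0 q0 pq f0 g0.
have a0 : 0 < f ^+ 2 by rewrite exprn_even_gt0.
have b0 : 0 < g ^+ 2 by rewrite exprn_even_gt0.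
set a := f ^+ 2 in a0 *; set b := g ^+ 2 in b0 *; pose m := p * a + q * b.
have m0 : 0 < m by rewrite addr_gt0// mulr_gt0.
have mE : m = p * a + q * b by [].
have lnle z : 0 < z -> z * ln z <= z * (ln m + (z / m - 1)).
  move=> z0; rewrite ler_pM2l// -lerBlDl -ln_div ?posrE//.
  have := expR_ge1Dx (ln (z / m)); rewrite lnK ?posrE ?divr_gt0//; lra.
have h1 := ler_wpM2l (ltW p0) (lnle a a0); have h2 := ler_wpM2l (ltW q0) (lnle b b0).
have h3 : ent2 p q a b <= (p * a * a + q * b * b - m * m) / m.
  have -> : (p * a * a + q * b * b - m * m) / m = p * (a * (a / m - 1)) + q * (b * (b / m - 1)).
    have -> : (p * a * a + q * b * b - m * m) / m = (p * a * a + q * b * b) / m - m.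
      by field; rewrite gt_eqF.
    by rewrite {2}mE; ring.
  by rewrite /ent2 -/m; move: h1 h2; rewrite /m; lra.
apply: (le_trans h3); rewrite ler_pdivrMr//.
have e : p * a * a + q * b * b - m * m = p * q * ((f - g) ^+ 2 * (f + g) ^+ 2).
  by rewrite /m /a /b (_ : q = 1 - p); [ring | lra].
rewrite e.
have p1 : p <= 1 by lra.
have q1 : q <= 1 by lra.
have h4 : p * q * (f + g) ^+ 2 <= 2 * m.
  apply: (@le_trans _ _ (p * q * (2 * (a + b)))).
    rewrite ler_pM2l ?mulr_gt0//; have := sqr_ge0 (f - g); rewrite /a /b; lra.
  have : p * q * a <= p * a by rewrite ler_pM2r// ler_piMr// ltW.
  have : p * q * b <= q * b by rewrite ler_pM2r// ler_piMl// ltW.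
  by rewrite /m; lra.
have := ler_wpM2l (sqr_ge0 (f - g)) h4; lra.
Qed.

End TwoPoint.

Section Tensorization.
Context {R : realType} {N : nat} (h : 'rV[R]_N).
Implicit Types (w G : @config N -> R) (s : @config N) (x y : 'I_N).

Definition field_weight x (b : bool) : R := expR (h 0 x * (-1) ^+ b).
Definition site_prob x (b : bool) : R :=
  field_weight x b / (field_weight x true + field_weight x false).

(** The conditional expectation given the other sites under the product measure. Writing it through
    [flip] keeps it a function of whole configurations. *)
Definition site_mean x w s : R :=
  site_prob x (s x) * w s + site_prob x (~~ s x) * w (flip s x).

Lemma site_prob_gt0 x b : 0 < site_prob x b.
Proof. by rewrite divr_gt0 ?addr_gt0// expR_gt0. Qed.

Lemma site_prob_sum x b : site_prob x b + site_prob x (~~ b) = 1.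
Proof.
have n0 : field_weight x true + field_weight x false != 0.
  by rewrite gt_eqF// addr_gt0// expR_gt0.
by rewrite /site_prob -mulrDl; case: b => /=; rewrite ?[field_weight x false + _]addrC divff.
Qed.

Lemma flipK x : involutive (fun s => flip s x).
Proof.
move=> s; apply/ffunP => y; rewrite !ffunE; case: (y =P x) => // ->.
by rewrite negbK.
Qed.

Lemma flip_same s x : flip s x x = ~~ s x.
Proof. by rewrite ffunE eqxx. Qed.

Lemma flip_other s x y : y != x -> flip s x y = s y.
Proof. by rewrite ffunE => /negPf ->. Qed.

Lemma flipC s x y : flip (flip s x) y = flip (flip s y) x.
Proof.
have [->//|xy] := eqVneq x y.
by apply/ffunP => z; rewrite !ffunE; case: (z =P y) => [->|]; rewrite ?[y == x]eq_sym ?(negPf xy).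
Qed.

Lemma expR_dot_flip s x :
  expR (dot h (flip s x)) * field_weight x (s x) =
  expR (dot h s) * field_weight x (~~ s x).
Proof.
rewrite /dot (bigD1 x)//= [in RHS](bigD1 x)//= /field_weight !expRD /spin flip_same.
rewrite (eq_bigr (fun y => h 0 y * (-1) ^+ s y)); first by ring.
by move=> y yx; rewrite flip_other.
Qed.

Definition field_sum w : R := \sum_s w s * expR (dot h s).

Lemma field_sum_site_mean x w : field_sum (site_mean x w) = field_sum w.
Proof.
rewrite /field_sum /site_mean.
under eq_bigr do rewrite mulrDl.
(* After flipping in the second sum both terms carry w s, and the detailed balance relation
   [expR_dot_flip] collects their weights. *)
rewrite big_split /= [X in _ + X](reindex_inj (inv_inj (flipK x))) /=.
rewrite -big_split; apply: eq_bigr => s _ /=; rewrite flipK flip_same negbK.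
have n0 : field_weight x true + field_weight x false != 0.
  by rewrite gt_eqF// addr_gt0// expR_gt0.
have e := expR_dot_flip s x.
have -> : site_prob x (s x) * w s * expR (dot h s) + site_prob x (s x) * w s * expR (dot h (flip s x)) =
  w s * (expR (dot h s) * field_weight x (s x) + expR (dot h (flip s x)) * field_weight x (s x)) /
  (field_weight x true + field_weight x false) by rewrite /site_prob; ring.
rewrite e -mulrDr; case: (s x) => /=; rewrite ?[field_weight x false + _]addrC; by field.
Qed.

Lemma site_mean_gt0 x w : (forall s, 0 < w s) -> forall s, 0 < site_mean x w s.
Proof. by move=> w0 s; rewrite addr_gt0// mulr_gt0// site_prob_gt0. Qed.

Lemma site_mean_flip x w s : site_mean x w (flip s x) = site_mean x w s.
Proof. by rewrite /site_mean flip_same flipK negbK addrC. Qed.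

Definition site_ent x G s : R :=
  ent2 (site_prob x (s x)) (site_prob x (~~ s x)) (G s) (G (flip s x)).

Lemma site_entE x G s :
  site_ent x G s = site_mean x (fun s => G s * ln (G s)) s - site_mean x G s * ln (site_mean x G s).
Proof. by []. Qed.

(** Flips at different sites commute, so this is convexity of the two-point entropy under averaging
    over site y. *)
Lemma site_ent_mean x y G s : x != y -> (forall s, 0 < G s) ->
  site_ent x (site_mean y G) s <= site_mean y (site_ent x G) s.
Proof.
move=> xy G0; have yx : y != x by rewrite eq_sym.
rewrite /site_ent /site_mean !flip_other// (flipC s y x).
by apply: ent2_subadd => //; exact: site_prob_gt0.
Qed.

Definition sites_mean (l : seq 'I_N) G := foldr site_mean G l.

Lemma sites_mean_gt0 l G : (forall s, 0 < G s) -> forall s, 0 < sites_mean l G s.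
Proof. by move=> G0; elim: l => //= x l ih; exact: site_mean_gt0. Qed.

Lemma field_sum_le w1 w2 : (forall s, w1 s <= w2 s) -> field_sum w1 <= field_sum w2.
Proof. by move=> e; apply: ler_sum => s _; rewrite ler_pM2r// expR_gt0. Qed.

Lemma field_sumB w1 w2 : field_sum (fun s => w1 s - w2 s) = field_sum w1 - field_sum w2.
Proof. by rewrite -sumrB; apply: eq_bigr => s _; rewrite mulrBl. Qed.

Lemma site_ent_sites_mean x l G : x \notin l -> (forall s, 0 < G s) ->
  field_sum (site_ent x (sites_mean l G)) <= field_sum (site_ent x G).
Proof.
elim: l => [//|y l ih] /=; rewrite inE negb_or => /andP[xy xl] G0.
apply: le_trans (ih xl G0); rewrite -(field_sum_site_mean y (site_ent x (sites_mean l G))).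
apply: field_sum_le => s; apply: site_ent_mean => // s'.
exact: sites_mean_gt0.
Qed.

(** Averaging out one more site lowers the sum of G ln G by exactly the site entropy of the function
    averaged so far, and averaging has only decreased that site entropy. *)
Lemma entropy_telescope l G : uniq l -> (forall s, 0 < G s) ->
  field_sum (fun s => G s * ln (G s))
    - field_sum (fun s => sites_mean l G s * ln (sites_mean l G s)) <=
  \sum_(x <- l) field_sum (site_ent x G).
Proof.
move=> + G0; elim: l => [_|x l ih /= /andP[xl ul]]; first by rewrite big_nil subrr.
rewrite big_cons; have := ih ul; have := site_ent_sites_mean xl G0.
have -> : field_sum (site_ent x (sites_mean l G)) =
    field_sum (fun s => sites_mean l G s * ln (sites_mean l G s)) -
    field_sum (fun s => site_mean x (sites_mean l G) s * ln (site_mean x (sites_mean l G) s)).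
  rewrite -(field_sum_site_mean x (fun s => sites_mean l G s * ln (sites_mean l G s))).
  by rewrite -field_sumB; apply: eq_bigr => s _; rewrite site_entE.
lra.
Qed.

Lemma sites_mean_flip l G x s : x \in l -> sites_mean l G (flip s x) = sites_mean l G s.
Proof.
elim: l s => //= y l ih s; rewrite inE => /orP[/eqP <-|xl]; first exact: site_mean_flip.
have [->|xy] := eqVneq x y; first exact: site_mean_flip.
have yx : y != x by rewrite eq_sym.
by rewrite /site_mean flip_other// flipC !ih.
Qed.

(** Flips connect all configurations; the induction is on the number of sites where two of them
    differ. *)
Lemma flip_invariant_cst w : (forall s x, w (flip s x) = w s) -> forall s s', w s = w s'.
Proof.
move=> wi.
suff H n : forall s s', #|[pred x | s x != s' x]| = n -> w s = w s'.
  by move=> s s'; exact: (H _ s s' erefl).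
elim: n => [s s' e|n ih s s' e].
  congr w; apply/ffunP => x; apply/eqP; apply: contraT => sx.
  by have := card0_eq e x; rewrite inE sx.
have /card_gt0P[x] : (0 < #|[pred x | s x != s' x]|)%N by rewrite e.
rewrite inE => sx; rewrite -(wi s x); apply: ih.
apply/eqP; rewrite -eqSS -e (cardD1 x [pred x | s x != s' x]) inE sx add1n eqSS; apply/eqP.
apply: eq_card => y; rewrite !inE ffunE; case: (y =P x) => //= ->.
by move: sx; case: (s x); case: (s' x).
Qed.

(** Averaging over every site yields the constant mean of G, so the telescoping sum ends at the full
    entropy. *)
Lemma entropy_product G : (forall s, 0 < G s) ->
  field_sum (fun s => G s * ln (G s))
   - field_sum G * (ln (field_sum G) - ln (field_sum (fun=> 1))) <=
  \sum_x field_sum (site_ent x G).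
Proof.
move=> G0; set l := index_enum 'I_N.
have := entropy_telescope (index_enum_uniq _) G0.
have cst s s' : sites_mean l G s = sites_mean l G s'.
  by apply: flip_invariant_cst => {}s x; apply: sites_mean_flip; exact: mem_index_enum.
pose k := sites_mean l G [ffun=> false].
have k0 : 0 < k by exact: sites_mean_gt0.
have q0 : 0 < field_sum (fun=> 1).
  rewrite /field_sum (bigD1 [ffun=> false])//=; apply: ltr_wpDr.
    by apply: sumr_ge0 => s _; rewrite mul1r expR_ge0.
  by rewrite mul1r expR_gt0.
have e1 : field_sum G = k * field_sum (fun=> 1).
  have -> : field_sum G = field_sum (sites_mean l G).
    by elim: l {cst k k0} => //= x l ih; rewrite field_sum_site_mean.
  by rewrite mulr_sumr; apply: eq_bigr => s _; rewrite mul1r (cst s [ffun=> false]).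
have e2 : field_sum (fun s => sites_mean l G s * ln (sites_mean l G s)) =
    k * ln k * field_sum (fun=> 1).
  by rewrite mulr_sumr; apply: eq_bigr => s _; rewrite mul1r (cst s [ffun=> false]).
by rewrite e2 e1 lnM ?posrE// addrK mulrAC.
Qed.

Lemma entropy_product_sqr (F : @config N -> R) : (forall s, F s != 0) ->
  field_sum (fun s => F s ^+ 2 * ln (F s ^+ 2))
   - field_sum (fun s => F s ^+ 2)
     * (ln (field_sum (fun s => F s ^+ 2)) - ln (field_sum (fun=> 1))) <=
  field_sum (fun s => 2 * \sum_x (F s - F (flip s x)) ^+ 2).
Proof.
move=> F0; have G0 s : 0 < F s ^+ 2 by rewrite exprn_even_gt0 ?F0.
apply: (le_trans (entropy_product G0)).
have -> : field_sum (fun s => 2 * \sum_x (F s - F (flip s x)) ^+ 2) =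
    \sum_x field_sum (fun s => 2 * (F s - F (flip s x)) ^+ 2).
  rewrite exchange_big; apply: eq_bigr => s _.
  by rewrite mulr_sumr mulr_suml.
apply: ler_sum => x _; apply: field_sum_le => s.
by apply: ent2_sqr_le => //; rewrite ?site_prob_gt0// site_prob_sum.
Qed.

End Tensorization.

(** * Log-Sobolev inequality for small numerical radius *)

Section SumOfSquares.
Context {R : realType} {N : nat}.
Implicit Types (J : 'M[R]_N) (u w : 'rV[R]_N).

Definition bil J u w : R := (u *m J *m w^T) 0 0.

Lemma bilDl J u1 u2 w : bil J (u1 + u2) w = bil J u1 w + bil J u2 w.
Proof. by rewrite /bil !mulmxDl mxE. Qed.

Lemma bilZl J (a : R) u w : bil J (a *: u) w = a * bil J u w.
Proof. by rewrite /bil -!scalemxAl mxE. Qed.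

Lemma bilC J u w : J^T = J -> bil J u w = bil J w u.
Proof.
move=> sJ; have -> : bil J w u = ((w *m J *m u^T)^T) 0 0 by rewrite mxE.
by rewrite !trmx_mul trmxK sJ mulmxA.
Qed.

Lemma bil_delta J x u : bil J (delta_mx 0 x) u = vdot (row x J) u.
Proof.
rewrite /bil -rowE mxE; apply: eq_bigr => y _; by rewrite !mxE.
Qed.

Lemma bilE J u : bil J u u = \sum_x \sum_y J x y * u 0 x * u 0 y.
Proof.
rewrite /bil -mulmxA mxE; apply: eq_bigr => x _.
rewrite mxE mulr_sumr; apply: eq_bigr => y _.
by rewrite mxE; ring.
Qed.

Lemma bil_add J u w (a : R) : J^T = J ->
  bil J (u + a *: w) (u + a *: w) = bil J u u + 2 * a * bil J w u + a ^+ 2 * bil J w w.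
Proof.
move=> sJ; rewrite bilDl bilZl (bilC u (_ + _) sJ) (bilC w (_ + _) sJ) !bilDl !bilZl.
by rewrite (bilC u w sJ); ring.
Qed.

(** Completing the square: a positive diagonal entry allows a rank-one square to be split off, which
    leaves a positive semidefinite Schur complement with fewer nonzero rows. If the diagonal
    vanishes, so does J. *)
Lemma psd_sum_of_squares J : J^T = J -> (forall u, 0 <= bil J u u) ->
  exists vs : seq 'rV[R]_N, forall u, bil J u u = \sum_(v <- vs) vdot v u ^+ 2.
Proof.
move: {2}(#|[pred x | row x J != 0]|) (leqnn #|[pred x | row x J != 0]|) => n.
elim: n J => [|n ih] J Jn sJ J0.
  exists [::] => u; rewrite big_nil.
  rewrite /bil; suff -> : J = 0 by rewrite mulmx0 mul0mx mxE.
  apply/row_matrixP => x; rewrite row0; apply/eqP; apply: contraLR Jn => Jx.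
  by rewrite -ltnNge; apply/card_gt0P; exists x.
have sJE x y : J x y = J y x by rewrite -{1}sJ mxE.
have [[x Jx]|/forallNP Jd] := pselect (exists x, J x x != 0); last first.
  have Jd0 x : J x x = 0 by have := Jd x => /negP; rewrite negbK => /eqP.
  exists [::] => u; rewrite big_nil /bil; suff -> : J = 0 by rewrite mulmx0 mul0mx mxE.
  apply/matrixP => x y; rewrite mxE.
  have bxx z : bil J (delta_mx 0 z) (delta_mx 0 z) = 0.
    rewrite bil_delta /vdot (bigD1 z)//= !mxE Jd0 mul0r add0r big1// => i iz.
    by rewrite !mxE eqxx (negPf iz) mulr0.
  have bxy : bil J (delta_mx 0 y) (delta_mx 0 x) = J x y.
    rewrite bilC// bil_delta /vdot (bigD1 y)//= !mxE !eqxx mulr1 big1 ?addr0// => i iy.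
    by rewrite !mxE eqxx (negPf iy) mulr0.
  (* With zero diagonal the form takes the value - 2 (J x y)^2 at this vector. *)
  have := J0 (delta_mx 0 x + (- J x y) *: delta_mx 0 y).
  rewrite bil_add// !bxx bxy mulr0 addr0 add0r => h.
  apply/eqP; rewrite -sqrf_eq0; apply/eqP; apply/le_anti; rewrite sqr_ge0 andbT; lra.
have dxx : bil J (delta_mx 0 x) (delta_mx 0 x) = J x x.
  rewrite bil_delta /vdot (bigD1 x)//= !mxE !eqxx mulr1 big1 ?addr0// => i ix.
  by rewrite !mxE eqxx (negPf ix) mulr0.
set d := J x x in Jx dxx.
have d0 : 0 < d by rewrite lt_neqAle eq_sym Jx -dxx J0.
pose J' := J - d^-1 *: ((row x J)^T *m row x J).
have sJ' : J'^T = J' by rewrite /J' !(linearB, linearZ) /= trmx_mul trmxK sJ.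
have bJ' u : bil J' u u = bil J u u - d^-1 * vdot (row x J) u ^+ 2.
  rewrite /bil /J' mulmxBr mulmxBl [LHS]mxE [X in _ + X]mxE; congr (_ - _).
  rewrite -scalemxAr -scalemxAl [LHS]mxE; congr (_ * _).
  have -> : u *m ((row x J)^T *m row x J) *m u^T = (u *m (row x J)^T) *m (row x J *m u^T).
    by rewrite !mulmxA.
  rewrite [LHS]mxE big_ord1 expr2; congr (_ * _); rewrite [LHS]mxE;
    apply: eq_bigr => y _; rewrite !mxE//.
  by rewrite mulrC.
have J'0 u : 0 <= bil J' u u.
  (* The multiple of the basis vector that minimizes the form; the minimum is the Schur complement
     at u. *)
  have := J0 (u + (- (vdot (row x J) u / d)) *: delta_mx 0 x).
  rewrite bil_add// bil_delta dxx bJ' => h; apply: le_trans h _.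
  by rewrite le_eqVlt; apply/orP; left; apply/eqP; field.
(* By symmetry a zero row of J stays zero, and row x becomes zero. *)
have J'n : (#|[pred y | row y J' != 0%R]| <= n)%N.
  rewrite -ltnS; apply: leq_trans Jn; apply: proper_card; apply/properP; split.
    apply/fintype.subsetP => y; rewrite !inE; apply: contraNN => /eqP Jy.
    have Jyx : J y x = 0 by have := congr1 (fun r : 'rV[R]_N => r 0 x) Jy; rewrite !mxE.
    apply/eqP/rowP => z; have := congr1 (fun r : 'rV[R]_N => r 0 z) Jy; rewrite !mxE => ->.
    by rewrite big_ord1 !mxE (sJE x y) Jyx mul0r mulr0 subr0.
  exists x; rewrite !inE; last first.
    rewrite negbK; apply/eqP/rowP => z; rewrite !mxE big_ord1 !mxE -/d mulrA mulVf ?mul1r ?subrr//.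
  apply: contraNneq Jx => Jx0; have := congr1 (fun r : 'rV[R]_N => r 0 x) Jx0; by rewrite !mxE /d => ->.
have [vs hvs] := ih J' J'n sJ' J'0.
exists ((Num.sqrt d)^-1 *: row x J :: vs) => u.
rewrite big_cons -hvs bJ' vdotZl exprMn exprVn sqr_sqrtr ?(ltW d0)//.
by rewrite addrC subrK.
Qed.

End SumOfSquares.

Section XLogX.
Context {R : realType}.

Lemma xlnx_le_sqrt (y : R) : y <= 1 -> `|y * ln y| <= 2 * Num.sqrt y.
Proof.
move=> y1; have [y0|y0] := leP y 0.
  by rewrite ln0// mulr0 normr0 mulr_ge0// sqrtr_ge0.
have s0 : 0 < Num.sqrt y by rewrite sqrtr_gt0.
have l0 : ln y <= 0 by rewrite -ln1 ler_ln ?posrE.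
rewrite normrM gtr0_norm// ler0_norm//.
have -> : ln y = 2 * ln (Num.sqrt y).
  by rewrite -{1}(sqr_sqrtr (ltW y0)) lnXn// mulr_natl.
have := expR_ge1Dx (- ln (Num.sqrt y)); rewrite expRN lnK ?posrE// => h.
have h1 : - ln (Num.sqrt y) <= (Num.sqrt y)^-1 by lra.
rewrite -{1}(sqr_sqrtr (ltW y0)).
have := ler_wpM2l (sqr_ge0 (Num.sqrt y)) h1.
rewrite [X in _ <= X](_ : _ = Num.sqrt y); last by field; rewrite gt_eqF.
by lra.
Qed.

(** The library value ln z = 0 for z <= 0 makes the function vanish on the left half-line; on the
    right, 2 sqrt y squeezes it to 0. *)
Lemma continuous_xlnx : continuous (fun y : R => y * ln y).
Proof.
move=> y; have [y0|y0|y0] := ltgtP y 0.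
- rewrite /continuous_at (ln0 (ltW y0)) mulr0; apply: cvg_near_cst.
  near=> z; rewrite ln0 ?mulr0//.
  by apply: ltW; near: z; exact: lt_nbhsl.
- by apply: cvgM; [exact: cvg_id | exact: continuous_ln].
rewrite y0 /continuous_at mul0r; apply/norm_cvg0P.
apply: (@squeeze_cvgr _ _ _ R (fun=> 0) (fun y => 2 * Num.sqrt y)).
- near=> z; rewrite normr_ge0 xlnx_le_sqrt//.
  by apply: ltW; near: z; apply: lt_nbhsl.
- exact: cvg_cst.
- have := @continuous_fM R R _ _ (@continuous_fcst R R 2) (@sqrt_continuous R) 0.
  by rewrite /continuous_at sqrtr0 mulr0.
Unshelve. all: by end_near. Qed.

End XLogX.

Lemma cvg_fsum {R : realType} (I : Type) (r : seq I) (f : I -> nat -> R) (l : I -> R) :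
  (forall i, f i n @[n --> \oo] --> l i) ->
  \sum_(i <- r) f i n @[n --> \oo] --> \sum_(i <- r) l i.
Proof.
move=> h; elim: r => [|i r ih].
  by under eq_fun do rewrite big_nil; rewrite big_nil; exact: cvg_cst.
by under eq_fun do rewrite big_cons; rewrite big_cons; apply: cvgD.
Qed.

Section LogSobolev.
Context {R : realType} {N : nat}.
Implicit Types (M : 'M[R]_N) (F : @config N -> R) (s : @config N).

Definition log_sobolev_at M (c : R) F : Prop :=
  sk_ent M (fun s => F s ^+ 2) <=
    c * \sum_(x < N) sk_mean M (fun s => `|F s - F (flip s x)| ^+ 2).

Lemma cvg_log_sobolev_at M c (Fn : nat -> @config N -> R) F :
  (forall s, Fn n s @[n --> \oo] --> F s) -> (forall n, log_sobolev_at M c (Fn n)) ->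
  log_sobolev_at M c F.
Proof.
move=> cF hn.
have cmean (Gn : nat -> @config N -> R) G : (forall s, Gn n s @[n --> \oo] --> G s) ->
    sk_mean M (Gn n) @[n --> \oo] --> sk_mean M G.
  move=> cG; apply: cvg_fsum => s; apply: cvgM; [exact: cvg_cst | exact: cG].
have csq s : Fn n s ^+ 2 @[n --> \oo] --> F s ^+ 2.
  by apply: cvgM; exact: cF.
have cx (u : nat -> R) (l : R) : u n @[n --> \oo] --> l -> u n * ln (u n) @[n --> \oo] --> l * ln l.
  by move=> ul; exact: (cvg_comp _ _ ul (@continuous_xlnx R l)).
apply: (@ler_cvg_to nat \oo _ R (fun n => sk_ent M (fun s => Fn n s ^+ 2))
  (fun n => c * \sum_(x < N) sk_mean M (fun s => `|Fn n s - Fn n (flip s x)| ^+ 2))).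
- apply: cvgB; first by apply: cmean => s; exact: cx.
  by apply: cx; exact: cmean.
- apply: cvgM; first exact: cvg_cst.
  apply: cvg_fsum => x; apply: cmean => s.
  by apply: cvgM; apply: cvg_norm; apply: cvgB; exact: cF.
- by near=> n; exact: hn.
Unshelve. all: by end_near. Qed.

Lemma rat_approx_neq0 (a : R) (n : nat) :
  exists q : rat, q != 0 /\ `|ratr q - a| < n.+1%:R^-1.
Proof.
have : 0 < n.+1%:R^-1 :> R by rewrite invr_gt0.
move: (n.+1%:R^-1) => e e0; have [a0|a0] := leP 0 a.
  have [|q] := @rat_in_itvoo R a (a + e); first by rewrite ltrDl.
  rewrite in_itv /= => /andP[q1 q2]; exists q; split.
    by rewrite gt_eqF// -(ltr0q R); exact: le_lt_trans q1.
  by rewrite ltr_norml; apply/andP; split; lra.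
have [|q] := @rat_in_itvoo R (a - e) a; first by rewrite gtrBl.
rewrite in_itv /= => /andP[q1 q2]; exists q; split.
  by rewrite lt_eqF// -(ltrq0 R); exact: lt_trans q2 a0.
by rewrite ltr_norml; apply/andP; split; lra.
Qed.

(** Nowhere vanishing F makes the density F^2 positive, as [entropy_bound] requires; rational values
    leave countably many F, which yields measurability of the event. *)
Lemma log_sobolev_rat M c :
  (forall F : {ffun @config N -> rat}, (forall s, F s != 0) ->
    log_sobolev_at M c (fun s => ratr (F s))) -> log_sobolev M c.
Proof.
move=> h F.
have hq (n : nat) s : {q : rat | q != 0 /\ `|ratr q - F s| < n.+1%:R^-1}.
  by apply/cid; exact: rat_approx_neq0.
apply: (@cvg_log_sobolev_at M c (fun n s => ratr (sval (hq n s)))).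
  move=> s; apply/cvgrPdist_lt => e e0.
  near=> n; rewrite distrC; apply: (lt_trans (svalP (hq n s)).2).
  near: n; exact: near_infty_natSinv_lt (PosNum e0).
move=> n; have := h [ffun s => sval (hq n s)] (fun s => _).
rewrite (_ : (fun s => ratr _) = (fun s => ratr (sval (hq n s)))).
  by apply => s; rewrite ffunE; case: (svalP (hq n s)).
by apply/funext => s; rewrite ffunE.
Unshelve. all: by end_near. Qed.

End LogSobolev.

Section DeterministicBound.
Context {R : realType} {N : nat}.

(** The constant c disappears in the normalization, so the SK measure is the tilt at t = 1, h = 0;
    divided by the mass, [entropy_bound] with the product inequality as initial condition is the
    claim. *)
Lemma log_sobolev_at_sum_of_squares (M : 'M[R]_N) (c j : R) (m : nat) (v : 'I_m -> 'rV[R]_N)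
    (F : @config N -> R) :
  0 <= j -> j < 1 ->
  (forall w : 'rV[R]_N, \sum_i vdot (v i) w ^+ 2 <= j * vdot w w) ->
  (forall s, energy v s = c - 2^-1 * \sum_x \sum_y M x y * spin s x * spin s y) ->
  (forall s, F s != 0) -> log_sobolev_at M (2 / (1 - j)) F.
Proof.
move=> j0 j1 vj vM F0.
have G0 s : 0 < F s ^+ 2 by rewrite exprn_even_gt0 ?F0.
pose G s := F s ^+ 2; pose W s := 2 * \sum_x (F s - F (flip s x)) ^+ 2.
have t0E w h : tilt v w 0 h = field_sum h w.
  by apply: eq_bigr => s _; rewrite mul0r add0r.
have H0 h : tent v G 0 h <= tilt v W 0 h.
  by rewrite /tent !t0E; exact: entropy_product_sqr.
have := @entropy_bound R N m v j j0 j1 vj G W G0 H0 1 0.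
rewrite ler01 lexx mulr1 => /(_ isT) H1.
have wE s : sk_weight M s = expR (1 * energy v s + dot 0 s) * expR (- c).
  by rewrite -expRD /sk_weight; congr expR; rewrite mul1r dot0 vM mulNr; ring.
pose q := tilt v (fun=> 1) 1 0.
have q0 : 0 < q by exact: mass_gt0.
have pE : sk_partition M = q * expR (- c).
  by rewrite mulr_suml; apply: eq_bigr => s _; rewrite wE -mulrA [in RHS]mul1r.
have mE g : sk_mean M g = tilt v g 1 0 / q.
  rewrite mulr_suml; apply: eq_bigr => s _; rewrite /sk_measure wE pE.
  have e0 : expR (- c) != 0 by rewrite gt_eqF// expR_gt0.
  by field; rewrite gt_eqF.
have p0 : 0 < tilt v G 1 0 by exact: tilt_gt0.
have eE : sk_ent M (fun s => F s ^+ 2) = tent v G 1 0 / q.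
  rewrite /sk_ent !mE -/G /tent -/q ln_div ?posrE//.
  by field; rewrite gt_eqF.
rewrite /log_sobolev_at eE (eq_bigr (fun x => tilt v (fun s => (F s - F (flip s x)) ^+ 2) 1 0 / q)).
  rewrite -mulr_suml -tilt_sum mulrA ler_pM2r ?invr_gt0//.
  by rewrite mulrAC ler_pdivlMr ?subr_gt0// mulrC -tiltZ.
move=> x _; rewrite mE; congr (_ / _); apply: eq_tilt => s.
by rewrite real_normK ?num_real.
Qed.

Theorem log_sobolev_of_numerical_radius (M : 'M[R]_N) (c : R) :
  0 <= c -> 2 * c < 1 -> M^T = M ->
  (forall u, `|bil M u u| <= c * vdot u u) -> log_sobolev M (2 / (1 - 2 * c)).
Proof.
move=> c0 c1 sM Mc.
pose J := c%:M - M.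
have bJ u : bil J u u = c * vdot u u - bil M u u.
  rewrite /bil /J mulmxBr mulmxBl [LHS]mxE [X in _ + X]mxE mul_mx_scalar -scalemxAl.
  by rewrite [X in X - _]mxE; congr (_ * _ - _); rewrite mxE; apply: eq_bigr => x _; rewrite mxE.
have [|u|vs hvs] := @psd_sum_of_squares R N J.
- by rewrite /J linearB /= tr_scalar_mx sM.
- by rewrite bJ subr_ge0; apply: le_trans (Mc u); exact: ler_norm.
pose v (i : 'I_(size vs)) := vs`_i.
have hv u : \sum_i vdot (v i) u ^+ 2 = bil J u u.
  by rewrite hvs (big_nth 0) big_mkord.
apply: log_sobolev_rat => F F0.
(* The constant is half of s (c I) s = c N; the bound J <= 2 c comes from - M <= c. *)
apply: (@log_sobolev_at_sum_of_squares M (2^-1 * (c * N%:R)) (2 * c) _ v).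
- by rewrite mulr_ge0.
- by [].
- move=> w; rewrite hv bJ; have := Mc w; rewrite ler_norml => /andP[h _]; lra.
- move=> s; pose sv : 'rV[R]_N := \row_x spin s x.
  have dE u : dot u s = vdot u sv by apply: eq_bigr => x _; rewrite mxE.
  rewrite /energy (eq_bigr (fun i => vdot (v i) sv ^+ 2)); last by move=> i _; rewrite dE.
  rewrite hv bJ bilE mulrBr; congr (_ * (_ * _) - _ * _).
    rewrite /vdot (eq_bigr (fun=> 1)) ?sumr_const ?card_ord//.
    by move=> x _; rewrite !mxE spin_sqr.
  by apply: eq_bigr => x _; apply: eq_bigr => y _; rewrite !mxE.
- by move=> s; rewrite fmorph_eq0.
Qed.

End DeterministicBound.

(** * Measurability of the event that the log-Sobolev constant is small *)

Section Measurability.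
Context {R : realType} {N : nat}.
Context (d : measure_display) (T : measurableType d).

Lemma measurable_fsum_real (I : Type) (r : seq I) (f : I -> T -> R) :
  (forall i, measurable_fun setT (f i)) ->
  measurable_fun setT (fun w => \sum_(i <- r) f i w).
Proof. by move=> h; exact: measurable_sum. Qed.

Lemma log_sobolev_le (M : 'M[R]_N) (a b : R) : a <= b ->
  log_sobolev M a -> log_sobolev M b.
Proof.
move=> ab h F; apply: le_trans (h F) _; rewrite ler_wpM2r// sumr_ge0// => x _.
apply: sumr_ge0 => s _; rewrite mulr_ge0 ?exprn_ge0//.
by rewrite divr_ge0 ?expR_ge0// sumr_ge0// => s' _; exact: expR_ge0.
Qed.

(** The strict inequality becomes a countable union over admissible constants c - 1 / (n + 1). *)
Lemma log_sobolev_constant_ltP (M : 'M[R]_N) (c : R) :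
  (log_sobolev_constant M < c%:E)%E <->
  exists n : nat, 0 <= c - n.+1%:R^-1 /\ log_sobolev M (c - n.+1%:R^-1).
Proof.
split.
  move=> /ereal_inf_lt[_ [G [G0 GM] <-]]; rewrite lte_fin => Gc.
  have [n hn] : exists n : nat, n.+1%:R^-1 < c - G.
    near \oo => n; exists n; near: n.
    by apply: (near_infty_natSinv_lt (@PosNum R (c - G) _)); rewrite subr_gt0.
  exists n; move: hn; move: (n.+1%:R^-1) => e hn; split; first by lra.
  by apply: log_sobolev_le GM; lra.
move=> [n [c0 hc]]; apply: (@le_lt_trans _ _ (c - n.+1%:R^-1)%:E).
  by apply: ereal_inf_lbound; exists (c - n.+1%:R^-1).
by rewrite lte_fin gtrBl invr_gt0.
Unshelve. all: by end_near. Qed.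

Lemma measurable_log_sobolev_constant_lt (M : T -> 'M[R]_N) (c : R) :
  (forall x y, measurable_fun setT (fun w => M w x y)) ->
  measurable [set w | (log_sobolev_constant (M w) < c%:E)%E].
Proof.
move=> mM.
have mweight s : measurable_fun setT (fun w => sk_weight (M w) s).
  apply: (measurableT_comp (@measurable_expR R)).
  apply: measurable_funM => //; apply: measurable_fsum_real => x.
  apply: measurable_fsum_real => y.
  by apply: measurable_funM => //; apply: measurable_funM.
have mpart : measurable_fun setT (fun w => sk_partition (M w)).
  exact: measurable_fsum_real.
have mmeas s : measurable_fun setT (fun w => sk_measure (M w) s).
  (* The inverse of the positive partition function is written exp (- ln Z), a composition of
     measurable functions. *)
  rewrite (_ : (fun w => _) = fun w => sk_weight (M w) s * expR (- ln (sk_partition (M w)))).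
    apply: measurable_funM => //; apply: (measurableT_comp (@measurable_expR R)).
    apply: measurable_funN.
    exact: (measurableT_comp (@measurable_ln R)).
  apply/funext => w; rewrite /sk_measure expRN lnK//.
  rewrite posrE /sk_partition (bigD1 [ffun=> false])//= ltr_wpDr ?expR_gt0//.
  by apply: sumr_ge0 => s' _; exact: expR_ge0.
have mmean g : measurable_fun setT (fun w => sk_mean (M w) g).
  by apply: measurable_fsum_real => s; apply: measurable_funM.
have mat (a : R) F : measurable [set w | log_sobolev_at (M w) a F].
  rewrite /log_sobolev_at.
  have -> : [set w | sk_ent (M w) (fun s => F s ^+ 2) <= a *
     \sum_(x < N) sk_mean (M w) (fun s => `|F s - F (flip s x)| ^+ 2)] =
    (fun w => a * \sum_(x < N) sk_mean (M w) (fun s => `|F s - F (flip s x)| ^+ 2) -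
       sk_ent (M w) (fun s => F s ^+ 2)) @^-1` `[0, +oo[%classic.
    by apply/seteqP; split => w /=; rewrite in_itv /= andbT subr_ge0.
  rewrite -[X in measurable X]setTI; apply: measurable_funB => //.
    by apply: measurable_funM => //; apply: measurable_fsum_real.
  apply: measurable_funB => //; apply: measurable_funM => //.
  exact: (measurableT_comp (@measurable_ln R)).
have -> : [set w | (log_sobolev_constant (M w) < c%:E)%E] =
   \bigcup_n \bigcap_(F in [set F : {ffun @config N -> rat} | forall s, F s != 0])
     [set w | 0 <= c - n.+1%:R^-1 /\ log_sobolev_at (M w) (c - n.+1%:R^-1) (fun s => ratr (F s))].
  apply/seteqP; split => w /=.
    move=> /log_sobolev_constant_ltP[n [c0 hn]]; exists n => // F /= F0; split => //.
    exact: hn.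
  move=> [n _ hn]; apply/log_sobolev_constant_ltP; exists n; split.
    (* The constant function 1 shows that the intersection is over a nonempty family, so the sign
       condition can be read off from it. *)
    have h1 : [set F : {ffun @config N -> rat} | forall s, F s != 0] [ffun=> 1].
      by move=> s; rewrite ffunE oner_neq0.
    by case: (hn _ h1).
  by apply: log_sobolev_rat => F F0; case: (hn F F0).
apply: bigcupT_measurable => n; rewrite -[X in measurable X]setCK setC_bigcap.
apply: measurableC; rewrite bigcup_mkcond; apply: countable_bigcupT_measurable => [|F].
  exact: countableP.
case: ifP => // _; apply: measurableC; have [c0|c0] := leP 0 (c - n.+1%:R^-1).
  rewrite (_ : [set w | _] = [set w | log_sobolev_at (M w) (c - n.+1%:R^-1) (fun s => ratr (F s))]).
    exact: mat.
  by apply/seteqP; split => w /=; [case|].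
rewrite (_ : [set w | _] = set0) //.
by apply/seteqP; split => w //= -[].
Qed.

End Measurability.

(** * Gaussian integration by parts and loop equations *)

Section Density.
Context d1 d2 (T : measurableType d1) (U : measurableType d2) (R : realType).
Context (mu : {measure set T -> \bar R}) (nu : {measure set U -> \bar R}).
Context (X : T -> U) (Y : T -> R).
Hypotheses (mX : measurable_fun setT X) (mY : measurable_fun setT Y).
Hypotheses (Y0 : forall x, 0 <= Y x).
Hypothesis nuE : forall B, measurable B -> nu B = (\int[mu]_(x in X @^-1` B) (Y x)%:E)%E.
Local Open Scope ereal_scope.
Import HBNNSimple.

Let mYE : measurable_fun setT (fun x => (Y x)%:E).
Proof. exact/measurable_EFinP. Qed.

Let integral_density_indic (A : set U) : measurable A ->
  \int[nu]_y (\1_A y)%:E = \int[mu]_x ((\1_A (X x))%:E * (Y x)%:E).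
Proof.
move=> mA; rewrite integral_indic// setIT nuE// integral_mkcond; apply: eq_integral => x _.
rewrite patchE indicE; case: ifPn => /= hx.
  by rewrite mem_set ?mul1e//; exact: (set_mem hx).
rewrite memNset ?mul0e// => hx'; move/negP: hx; apply; exact/mem_set.
Qed.

Let integral_density_nnsfun (h : {nnsfun U >-> R}) :
  \int[nu]_y (h y)%:E = \int[mu]_x ((h (X x))%:E * (Y x)%:E).
Proof.
pose s := fset_set (h @` setT).
have s0 (i : 'I_(size s)) : (0 <= s`_i)%R.
  have : s`_i \in fset_set (h @` setT) by exact: mem_nth.
  by rewrite (in_fset_set (fimfunP h)) => /set_mem[y _ <-].
have mA i : measurable (h @^-1` [set s`_i]) by [].
have hE y : (h y)%:E = \sum_(i < size s) (s`_i)%:E * (\1_(h @^-1` [set s`_i]) y)%:E.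
  by rewrite (fimfunEord h) -sumEFin.
under eq_integral do rewrite hE.
rewrite ge0_integral_sum//; last 2 first.
  move=> i; apply: measurable_funeM; apply/measurable_EFinP; exact: measurable_indic.
  by move=> i y _; rewrite mule_ge0// lee_fin.
have i0 i y : 0 <= (\1_(h @^-1` [set s`_i]) y : R)%:E by rewrite lee_fin.
have mi i : measurable_fun setT (fun x => (\1_(h @^-1` [set s`_i]) (X x) : R)%:E).
  by apply/measurable_EFinP; apply: measurableT_comp => //; exact: measurable_indic.
have RE x : (h (X x))%:E * (Y x)%:E =
    \sum_(i < size s) (s`_i)%:E * ((\1_(h @^-1` [set s`_i]) (X x))%:E * (Y x)%:E).
  rewrite hE ge0_sume_distrl; first by apply: eq_bigr => i _; rewrite muleA.
  by move=> i _; rewrite mule_ge0// lee_fin.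
under [RHS]eq_integral do rewrite RE.
rewrite ge0_integral_sum//; last 2 first.
  by move=> i; apply: measurable_funeM; exact: emeasurable_funM.
  by move=> i x _; apply: mule_ge0; [exact: s0 | apply: mule_ge0; [exact: i0 | exact: Y0]].
apply: eq_bigr => i _.
have mi' : measurable_fun setT (fun y => (\1_(h @^-1` [set s`_i]) y : R)%:E).
  by apply/measurable_EFinP; exact: measurable_indic.
have e1 := @ge0_integralZl_EFin _ _ _ nu setT measurableT _ (fun y _ => i0 i y) mi' _ (s0 i).
have m2 := emeasurable_funM (mi i) mYE.
have p2 x : setT x -> 0 <= (\1_(h @^-1` [set s`_i]) (X x))%:E * (Y x)%:E.
  by move=> _; rewrite mule_ge0// lee_fin.
have e2 := @ge0_integralZl_EFin _ _ _ mu setT measurableT _ p2 m2 _ (s0 i).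
by rewrite e1 e2 integral_density_indic.
Qed.

(** Image of a measure with density, by monotone approximation. It is used with X the identity and Y
    the Gaussian density, and with X one entry and Y a product of functions of the others. *)
Lemma integral_density (f : U -> \bar R) : measurable_fun setT f ->
  (forall y, 0 <= f y) -> \int[nu]_y f y = \int[mu]_x (f (X x) * (Y x)%:E).
Proof.
move=> mf f0; pose f_ := nnsfun_approx measurableT mf.
have f_f y : (f_ n y)%:E @[n --> \oo] --> f y by exact: cvg_nnsfun_approx.
transitivity (limn (fun n => \int[nu]_y (f_ n y)%:E)).
  rewrite -monotone_convergence//.
  - by apply: eq_integral => y _; apply/esym/cvg_lim.
  - by move=> n; exact/measurable_EFinP.
  - by move=> n y _; rewrite lee_fin.
  - by move=> y _ m n mn; rewrite lee_fin; exact/lefP/nd_nnsfun_approx.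
under eq_fun do rewrite integral_density_nnsfun.
rewrite -monotone_convergence//.
- apply: eq_integral => x _; apply/cvg_lim => //.
  by apply: cvgeZr => //; exact: f_f.
- move=> n; apply: emeasurable_funM => //; apply/measurable_EFinP.
  exact: measurableT_comp.
- by move=> n x _; rewrite mule_ge0// lee_fin.
- move=> x _ m n mn; apply: lee_wpmul2r; first by rewrite lee_fin.
  by rewrite lee_fin; exact/lefP/nd_nnsfun_approx.
Qed.

End Density.

Section GaussianMoments.
Context {R : realType} (sigma : R).
Hypothesis sigma_gt0 : 0 < sigma.
Local Notation mu := (@lebesgue_measure R).
Local Notation pdf := (normal_pdf 0 sigma).

Let sigma_neq0 : sigma != 0. Proof. by rewrite gt_eqF. Qed.

Lemma expr_le_expR (n : nat) (y : R) : 0 <= y -> y ^+ n <= n%:R ^+ n * expR y.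
Proof.
move=> y0; case: n => [|n]; first by rewrite !expr0 mul1r -expR0 ler_expR.
have n0 : 0 < n.+1%:R :> R by [].
have -> : expR y = expR (y / n.+1%:R) ^+ n.+1.
  by rewrite -expRM_natl mulrC divfK// gt_eqF.
rewrite -exprMn; apply: lerXn2r; rewrite ?nnegrE ?mulr_ge0 ?expR_ge0//.
rewrite mulrC -ler_pdivrMr//; apply: le_trans (expR_ge1Dx _); by rewrite lerDr.
Qed.

Lemma normal_pdf0E (s x : R) : s != 0 ->
  normal_pdf 0 s x = normal_peak s * expR (- (x ^+ 2 / (s ^+ 2 *+ 2))).
Proof.
by move=> s0; rewrite normal_pdfE//= /normal_fun subr0 mulNr.
Qed.

Lemma pow_normal_pdf_bound n : exists2 C : R, 0 <= C &
  forall x, `|x ^+ n * pdf x| <= C * normal_pdf 0 (2 * sigma) x.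
Proof.
have s2 : 2 * sigma != 0 by rewrite mulf_neq0.
(* 1 / a = 1 / (2 sigma^2) - 1 / (8 sigma^2), so exp (x^2 / a) is the ratio of the exponentials of
   the wider and the given Gaussian. *)
pose a := 8 * sigma ^+ 2 / 3.
have a0 : 0 < a by rewrite divr_gt0// mulr_gt0// exprn_gt0.
pose C1 := 1 + a ^+ n * n%:R ^+ n.
have C10 : 0 <= C1 by rewrite addr_ge0// mulr_ge0// exprn_ge0// ltW.
have p0 s : 0 <= normal_peak s := @normal_peak_ge0 R s.
have p20 : 0 < normal_peak (2 * sigma) by rewrite normal_peak_gt0.
exists (C1 * normal_peak sigma / normal_peak (2 * sigma)).
  by rewrite divr_ge0// mulr_ge0.
move=> x; rewrite normrM [ `|pdf x|]ger0_norm ?normal_pdf_ge0//.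
rewrite !normal_pdf0E// [leRHS](_ : _ = C1 * (normal_peak sigma * expR (- (x ^+ 2 / ((2 * sigma) ^+ 2 *+ 2))))); last first.
  by field; rewrite gt_eqF.
pose y := x ^+ 2 / a.
have y0 : 0 <= y by rewrite divr_ge0 ?sqr_ge0// ltW.
have -> : expR (- (x ^+ 2 / ((2 * sigma) ^+ 2 *+ 2))) =
    expR y * expR (- (x ^+ 2 / (sigma ^+ 2 *+ 2))).
  rewrite -expRD; congr expR; rewrite /y /a; field.
  by rewrite sigma_neq0.
rewrite mulrCA [leRHS]mulrCA ler_wpM2l// mulrA ler_wpM2r ?expR_ge0//.
have h1 : `|x ^+ n| <= 1 + (x ^+ 2) ^+ n.
  rewrite -exprM mulnC exprM -[(x ^+ n) ^+ 2]real_normK ?num_real//.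
  have := sqr_ge0 (`|x ^+ n| - 2^-1); have := normr_ge0 (x ^+ n); lra.
apply: (le_trans h1); rewrite mulrDl mul1r; apply: lerD.
  by rewrite -expR0 ler_expR.
have -> : (x ^+ 2) ^+ n = a ^+ n * y ^+ n.
  by rewrite -exprMn mulrC divfK// gt_eqF.
by rewrite -mulrA ler_wpM2l ?expr_le_expR// exprn_ge0// ltW.
Qed.

Lemma measurable_pow_normal_pdf n : measurable_fun setT (fun x : R => x ^+ n * pdf x).
Proof. by apply: measurable_funM; [exact: measurable_funX | exact: measurable_normal_pdf]. Qed.

Lemma integrable_pow_normal_pdf n :
  mu.-integrable setT (fun x => (x ^+ n * pdf x)%:E).
Proof.
have [C C0 hC] := pow_normal_pdf_bound n.
apply: (@le_integrable _ _ _ mu setT measurableT _ (fun x => C%:E * (normal_pdf 0 (2 * sigma) x)%:E)%E).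
- by apply/measurable_EFinP; exact: measurable_pow_normal_pdf.
- move=> x _ /=; rewrite lee_fin; apply: (le_trans (hC x)).
  exact: ler_norm.
- by apply: integrableZl => //; exact: integrable_normal_pdf.
Qed.

(** The explicit antiderivative behind integration by parts: it tends to 0 at both ends, so the
    integral of its derivative vanishes. *)
Let deriv_pow_normal n (x : R) : is_derive x (1 : R) (fun x => - sigma ^+ 2 * (x ^+ n * pdf x))
  (x ^+ n.+1 * pdf x - sigma ^+ 2 * n%:R * (x ^+ n.-1 * pdf x)).
Proof.
have dp : is_derive x (1 : R) pdf (- (x / sigma ^+ 2) * pdf x).
  have -> : pdf = fun x => normal_peak sigma * expR ((- (sigma ^+ 2 *+ 2)^-1) * (x * x)).
    apply/funext => z; rewrite normal_pdf0E//; congr (_ * expR _); by field.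
  have h := is_derive_fM (is_derive_fcst (normal_peak sigma) x)
    (is_derive_fcomp (is_derive_fM (is_derive_fcst (- (sigma ^+ 2 *+ 2)^-1) x)
      (is_derive_fM (is_derive_id x (1 : R)) (is_derive_id x (1 : R)))) (is_derive_expR _)).
  by apply: (is_derive_eq h); field.
have dx : is_derive x (1 : R) (fun x : R => x ^+ n) (n%:R * x ^+ n.-1).
  have -> : (fun x : R => x ^+ n) = (id : R -> R) ^+ n.
    by apply/funext => y; rewrite exprfctE.
  apply: (is_derive_eq (is_deriveX n (is_derive_id x (1 : R)))).
  by rewrite /GRing.scale /= mulr1.
have h := is_derive_fM (is_derive_fcst (- sigma ^+ 2) x) (is_derive_fM dx dp).
by apply: (is_derive_eq h); rewrite [x ^+ n.+1]exprS; field.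
Qed.

Let g n (x : R) := x ^+ n.+1 * pdf x - sigma ^+ 2 * n%:R * (x ^+ n.-1 * pdf x).

Let continuous_g n : continuous (g n).
Proof.
have cp : continuous pdf by apply: continuous_normal_pdf.
have cx k : continuous (fun x : R => x ^+ k) by exact: exprn_continuous.
move=> x; apply: cvgB; first by apply: cvgM; [exact: cx | exact: cp].
by apply: cvgM; [exact: cvg_cst | apply: cvgM; [exact: cx | exact: cp]].
Qed.

Let integrable_g n : mu.-integrable setT (EFin \o g n).
Proof.
have -> : EFin \o g n = (fun x => (x ^+ n.+1 * pdf x)%:E -
    (sigma ^+ 2 * n%:R)%:E * (x ^+ n.-1 * pdf x)%:E)%E by apply/funext => x.
apply: integrableB => //; first exact: integrable_pow_normal_pdf.
by apply: integrableZl => //; exact: integrable_pow_normal_pdf.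
Qed.

Let F n (x : R) := - sigma ^+ 2 * (x ^+ n * pdf x).

Let integral_g_itv n (k : nat) : (\int[mu]_(x in `[(- k.+1%:R)%R, k.+1%:R%R]) (g n x)%:E)%E =
  (F n k.+1%:R - F n (- k.+1%:R))%:E.
Proof.
have cF : continuous (F n).
  move=> x; apply: differentiable_continuous; apply/derivable1_diffP.
  by case: (deriv_pow_normal n x).
rewrite (@continuous_FTC2 _ _ (F n))//.
- by rewrite gtrN// ltr0n.
- exact: continuous_subspaceT.
- split.
  + by move=> x _; case: (deriv_pow_normal n x).
  + by apply: cvg_at_right_filter; exact: cF.
  + by apply: cvg_at_left_filter; exact: cF.
- by move=> x _; rewrite derive1E; case: (deriv_pow_normal n x) => _ ->.
Qed.

Let cvg_F n : F n k.+1%:R - F n (- k.+1%:R) @[k --> \oo] --> (0 : R).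
Proof.
(* One power of x more than in F gives the boundary terms a decay of order 1 / |x|. *)
have [C C0 hC] := pow_normal_pdf_bound n.+1.
pose D := sigma ^+ 2 * (C * normal_peak (2 * sigma)).
have FD (x : R) k : `|x| = k.+1%:R -> `|F n x| <= D / k.+1%:R.
  move=> xk; rewrite ler_pdivlMr// -xk /F normrM normrN [ `|sigma ^+ 2|]ger0_norm ?sqr_ge0//.
  rewrite -mulrA ler_wpM2l ?sqr_ge0//.
  rewrite -normrM mulrAC -exprSr; apply: (le_trans (hC x)).
  by rewrite ler_wpM2l// normal_pdf_ub// mulf_neq0.
apply/norm_cvg0P; apply: (@squeeze_cvgr _ _ _ R (fun=> 0) (fun k => 2 * D * k.+1%:R^-1)).
- near=> k; rewrite normr_ge0 /=; apply: (le_trans (ler_normB _ _)).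
  have h1 := FD k.+1%:R k (ger0_norm (ler0n _ _)).
  have h2 : `|F n (- k.+1%:R)| <= D / k.+1%:R by apply: FD; rewrite normrN ger0_norm.
  by have := lerD h1 h2; rewrite -mulrDl [_ + _ in X in _ <= X -> _](_ : _ = 2 * D)//; ring.
- exact: cvg_cst.
- rewrite -(mulr0 (2 * D)); apply: cvgM; first exact: cvg_cst.
  exact: cvg_harmonic.
Unshelve. all: by end_near. Qed.

Let integral_g n : (\int[mu]_x (g n x)%:E = 0)%E.
Proof.
pose I (k : nat) := `[- k.+1%:R, k.+1%:R : R]%classic.
pose f_ (k : nat) x : \bar R := ((EFin \o g n) \_ (I k)) x.
have mg : measurable_fun setT (EFin \o g n) by case/integrableP: (integrable_g n).
have [] := @dominated_convergence _ _ R mu setT measurableT f_ (EFin \o g n) (fun x => `|(g n x)%:E|%E).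
- move=> k; apply/(measurable_restrictT _ _).1; [exact: measurable_itv | exact: measurable_funTS].
- by [].
- apply: aeW => x _; apply: cvg_near_cst; near=> k.
  rewrite /f_ patchE mem_set// /I /= in_itv /= -ler_norml.
  have h : `|x| <= k%:R by near: k; exact: nbhs_infty_ger.
  by apply: (le_trans h); rewrite ler_nat.
- by apply: integrable_abse; exact: integrable_g.
- apply: aeW => x k _; rewrite /f_ patchE; case: ifP => _ //=.
  by rewrite normr0 lee_fin.
move=> _ _ h.
have h0 : (\int[mu]_x f_ k x)%E @[k --> \oo] --> 0%E.
  rewrite (_ : (fun k => _) = (fun k => (F n k.+1%:R - F n (- k.+1%:R))%:E)).
    by apply/fine_cvgP; split; [near=> k | exact: cvg_F].
  apply/funext => k; by rewrite -integral_g_itv [RHS]integral_mkcond.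
by rewrite (cvg_unique _ h h0).
Unshelve. all: by end_near. Qed.

(** For n = 0 the truncated [n.-1] is harmless, its coefficient being 0, and the identity says that
    the mean vanishes. *)
Lemma normal_moment n : (\int[mu]_x (x ^+ n.+1 * pdf x)%:E =
  (sigma ^+ 2 * n%:R)%:E * \int[mu]_x (x ^+ n.-1 * pdf x)%:E)%E.
Proof.
have i1 := integrable_pow_normal_pdf n.+1; have i2 := integrable_pow_normal_pdf n.-1.
have := integral_g n.
have -> : (fun x => (g n x)%:E) = (fun x => (x ^+ n.+1 * pdf x)%:E -
    (sigma ^+ 2 * n%:R)%:E * (x ^+ n.-1 * pdf x)%:E)%E by apply/funext => x.
rewrite integralB//; last exact: integrableZl.
rewrite integralZl//.
rewrite -(fineK (integrable_fin_num measurableT i1)) -(fineK (integrable_fin_num measurableT i2)).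
rewrite -!EFinM -EFinB => -[h]; congr EFin; exact/subr0_eq.
Qed.

End GaussianMoments.

(** * Expectations of products of functions of independent variables *)

Section Independence.
Context d (T : measurableType d) (R : realType) (P : probability T R).
Context (I : finType) (X : I -> {RV P >-> R}).
Hypothesis indepX : mutually_independent X.

Let prob i (B : set R) : R := fine (P (X i @^-1` B)).

Let probE i B : measurable B -> P (X i @^-1` B) = (prob i B)%:E.
Proof.
move=> mB; rewrite /prob fineK//; apply: fin_num_measure.
by rewrite -[X in measurable X]setTI; exact: measurable_funP.
Qed.

Let prob_ge0 i B : 0 <= prob i B.
Proof. by rewrite /prob fine_ge0. Qed.

Let measurable_indicX i (B : set R) : measurable B ->
  measurable_fun setT (fun w => \1_B (X i w) : R).
Proof.
move=> mB; apply: measurableT_comp => //; exact: measurable_indic.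
Qed.

Let measurable_prod (l : seq I) (f : I -> T -> R) :
  (forall i, measurable_fun setT (f i)) ->
  measurable_fun setT (fun w => \prod_(i <- l) f i w).
Proof.
move=> mf; elim: l => [|i l ih].
  by under eq_fun do rewrite big_nil; exact: measurable_cst.
by under eq_fun do rewrite big_cons; exact: measurable_funM.
Qed.

Let integral_prod_indic (l : seq I) (B : I -> set R) : uniq l ->
  (forall i, measurable (B i)) ->
  (\int[P]_w (\prod_(i <- l) \1_(B i) (X i w))%:E = (\prod_(i <- l) prob i (B i))%:E)%E.
Proof.
move=> ul mB; pose J : {set I} := [set i in l]%SET.
have -> : (fun w => (\prod_(i <- l) \1_(B i) (X i w))%:E) =
    (fun w => (\1_(\bigcap_(i in [set` J]) (X i @^-1` B i)) w : R)%:E).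
  apply/funext => w; congr EFin; rewrite [RHS]indicE.
  case: (boolP (w \in _)) => [/set_mem h|/negP h].
    rewrite big_seq big1// => i il; rewrite indicE mem_set//.
    by apply: (h i); rewrite /= inE.
  have [i [il hi]] : exists i, i \in l /\ ~ (B i (X i w)).
    apply: contrapT => h'; apply: h; apply/mem_set => i /= iJ.
    by apply: contrapT => h''; apply: h'; exists i; split => //; rewrite inE in iJ.
  by rewrite (perm_big _ (perm_to_rem il)) big_cons /= indicE memNset// mul0r.
have mJ : measurable (\bigcap_(i in [set` J]) (X i @^-1` B i)).
  apply: fin_bigcap_measurable; first exact: finite_finset.
  by move=> i _; rewrite -[X in measurable X]setTI; exact: measurable_funP.
transitivity (P (\bigcap_(i in [set` J]) (X i @^-1` B i))).
  by rewrite integral_indic// setIT.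
transitivity (\prod_(i in J) P (X i @^-1` B i))%E; first exact: indepX.
rewrite (eq_bigr (fun i => (prob i (B i))%:E)); last by move=> i _; rewrite probE.
rewrite prodEFin; congr EFin; rewrite [RHS]big_uniq //.
by apply: eq_bigl => i; rewrite inE.
Qed.

Section NonNegative.
Variable f : I -> R -> R.
Hypotheses (mf : forall i, measurable_fun setT (f i)) (f0 : forall i x, 0 <= f i x).
Hypothesis intf : forall i, P.-integrable setT (fun w => (f i (X i w))%:E).

Let m i : R := fine (\int[P]_w (f i (X i w))%:E)%E.

Let mE i : (\int[P]_w (f i (X i w))%:E)%E = (m i)%:E.
Proof. by rewrite /m fineK// integrable_fin_num. Qed.

Let m0 i : 0 <= m i.
Proof. by rewrite /m fine_ge0// integral_ge0// => w _; rewrite lee_fin. Qed.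

(** Indicators are replaced by nonnegative functions one index at a time; with indicators only, the
    identity is the definition of independence. *)
Let integral_prod_mixed (l1 l2 : seq I) (B : I -> set R) : uniq (l1 ++ l2) ->
  (forall i, measurable (B i)) ->
  (\int[P]_w (\prod_(i <- l1) f i (X i w) * \prod_(i <- l2) \1_(B i) (X i w))%:E =
   (\prod_(i <- l1) m i * \prod_(i <- l2) prob i (B i))%:E)%E.
Proof.
elim: l1 l2 B => [|k l1 ih] l2 B ul mB.
  under eq_integral do rewrite big_nil mul1r.
  by rewrite big_nil mul1r integral_prod_indic.
rewrite /= mem_cat negb_or in ul; move/andP: ul => [/andP[kl1 kl2] ul].
pose Y w : R := \prod_(i <- l1) f i (X i w) * \prod_(i <- l2) \1_(B i) (X i w).
pose c : R := \prod_(i <- l1) m i * \prod_(i <- l2) prob i (B i).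
have c0 : 0 <= c by apply: mulr_ge0; apply: prodr_ge0 => i _.
have Y0 w : 0 <= Y w.
  by apply: mulr_ge0; apply: prodr_ge0 => i _; rewrite ?indicE.
have mY : measurable_fun setT Y.
  apply: measurable_funM; apply: measurable_prod => i; last exact: measurable_indicX.
  exact: measurableT_comp.
(* The induction hypothesis, with an indicator put at index k, says that this is the image under X k
   of the measure with density Y. *)
pose nu := mscale (NngNum c0) (distribution P (X k)).
have nuE B' : measurable B' -> nu B' = (\int[P]_(w in X k @^-1` B') (Y w)%:E)%E.
  move=> mB'; have -> : nu B' = (c * prob k B')%:E by rewrite EFinM -(probE k mB').
  pose B2 i := if i == k then B' else B i.
  have mB2 i : measurable (B2 i) by rewrite /B2; case: ifP.
  have u2 : uniq (l1 ++ k :: l2) by rewrite -(cat1s k) uniq_catCA /= mem_cat negb_or kl1 kl2.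
  have B2k : B2 k = B' by rewrite /B2 eqxx.
  have B2l i : i \in l2 -> B2 i = B i.
    by move=> il; rewrite /B2; case: eqP => // ik; rewrite -ik il in kl2.
  have e1 : \prod_(i <- l2) prob i (B2 i) = \prod_(i <- l2) prob i (B i).
    by apply: eq_big_seq => i il; rewrite B2l.
  have e2 w : \prod_(i <- l2) \1_(B2 i) (X i w) = \prod_(i <- l2) \1_(B i) (X i w) :> R.
    by apply: eq_big_seq => i il; rewrite B2l.
  have := ih (k :: l2) B2 u2 mB2; rewrite big_cons e1 B2k => h.
  rewrite /c -mulrA [X in _ * X]mulrC -h [RHS]integral_mkcond; apply: eq_integral => w _.
  rewrite patchE big_cons e2 B2k; case: ifPn => [/set_mem hw|/negP hw].
    by rewrite [X in _ * (X * _)]indicE mem_set// mul1r.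
  rewrite [X in _ * (X * _)]indicE memNset ?mul0r ?mulr0//.
  by move=> hw'; apply: hw; exact: mem_set.
have mfk : measurable_fun setT (fun x => (f k x)%:E) by exact/measurable_EFinP.
have := @integral_density _ _ _ _ _ P nu (X k) Y _ mY Y0 nuE (fun x => (f k x)%:E) mfk (fun x => f0 k x).
rewrite ge0_integral_mscale//; last by move=> x _; rewrite lee_fin.
rewrite ge0_integral_distribution//; last by move=> x; rewrite lee_fin.
rewrite [X in (_ * X)%E](mE k) -EFinM => h.
under eq_integral do rewrite big_cons -mulrA EFinM.
by rewrite -h // big_cons /=; congr EFin; rewrite /c; ring.
Qed.

Lemma integral_prod_ge0 (l : seq I) : uniq l ->
  (\int[P]_w (\prod_(i <- l) f i (X i w))%:E = (\prod_(i <- l) fine (\int[P]_w (f i (X i w))%:E))%:E)%E.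
Proof.
move=> ul; have := integral_prod_mixed (l1 := l) (l2 := [::]) (B := fun=> setT).
rewrite cats0 big_nil mulr1 => <- //.
by apply: eq_integral => w _; rewrite big_nil mulr1.
Qed.

End NonNegative.

(** Signed factors are removed one at a time: the head is split into positive and negative part,
    each joins the nonnegative list, and the two products are subtracted. *)
Lemma integral_prod_mixed_sign (g : I -> R -> R) (l1 l2 : seq I) (f : I -> R -> R) :
  (forall i, measurable_fun setT (g i)) ->
  (forall i, P.-integrable setT (fun w => (g i (X i w))%:E)) ->
  (forall i, measurable_fun setT (f i)) -> (forall i x, 0 <= f i x) ->
  (forall i, P.-integrable setT (fun w => (f i (X i w))%:E)) ->
  uniq (l1 ++ l2) ->
  P.-integrable setT (fun w => (\prod_(i <- l1) g i (X i w) * \prod_(i <- l2) f i (X i w))%:E) /\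
  (\int[P]_w (\prod_(i <- l1) g i (X i w) * \prod_(i <- l2) f i (X i w))%:E =
   (\prod_(i <- l1) fine (\int[P]_w (g i (X i w))%:E) *
    \prod_(i <- l2) fine (\int[P]_w (f i (X i w))%:E))%:E)%E.
Proof.
move=> mg ig; elim: l1 l2 f => [|k l1 ih] l2 f mf f0 jf ul.
  have e : (\int[P]_w (\prod_(i <- [::]) g i (X i w) * \prod_(i <- l2) f i (X i w))%:E =
     (\prod_(i <- [::]) fine (\int[P]_w (g i (X i w))%:E) * \prod_(i <- l2) fine (\int[P]_w (f i (X i w))%:E))%:E)%E.
    rewrite big_nil mul1r -(integral_prod_ge0 mf f0 jf ul).
    by apply: eq_integral => w _; rewrite big_nil mul1r.
  split=> //; apply/integrableP; split.
    apply/measurable_EFinP; apply: measurable_funM; apply: measurable_prod => i; exact: measurableT_comp.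
  rewrite (eq_integral (fun w => (\prod_(i <- [::]) g i (X i w) * \prod_(i <- l2) f i (X i w))%:E)).
    by rewrite e ltry.
  by move=> w _; rewrite gee0_abs// lee_fin big_nil mul1r prodr_ge0.
have u2 : uniq (l1 ++ k :: l2) by rewrite -(cat1s k) uniq_catCA.
have kl2 : k \notin l2 by move: ul; rewrite /= mem_cat negb_or => /andP[/andP[]].
pose fp i x : R := if i == k then Num.max (g k x) 0 else f i x.
pose fn i x : R := if i == k then Num.max (- g k x) 0 else f i x.
have mpos (u : R -> R) : measurable_fun setT u -> measurable_fun setT (fun x => Num.max (u x) 0).
  by move=> mu; exact: measurable_maxr.
have ipos (u : T -> R) : P.-integrable setT (fun w => (u w)%:E) -> P.-integrable setT (fun w => (Num.max (u w) 0)%:E).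
  move=> iu; apply: (le_integrable measurableT _ _ iu).
    apply/measurable_EFinP; apply: measurable_maxr => //.
    by case/integrableP: iu => /measurable_EFinP.
  move=> w _ /=; rewrite lee_fin ger0_norm ?le_max ?lexx ?orbT//.
  by rewrite ge_max ler_norm normr_ge0.
have igN : P.-integrable setT (fun w => (- g k (X k w))%:E).
  by under eq_fun do rewrite EFinN; exact: integrableN.
have [ip ep] : P.-integrable setT (fun w => (\prod_(i <- l1) g i (X i w) * \prod_(i <- k :: l2) fp i (X i w))%:E) /\
  (\int[P]_w (\prod_(i <- l1) g i (X i w) * \prod_(i <- k :: l2) fp i (X i w))%:E =
   (\prod_(i <- l1) fine (\int[P]_w (g i (X i w))%:E) *
    \prod_(i <- k :: l2) fine (\int[P]_w (fp i (X i w))%:E))%:E)%E.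
  apply: ih u2 => i; rewrite /fp; case: eqP => [ik|_] //; first exact: mpos.
    by move=> x; rewrite le_max lexx orbT.
  by rewrite ik; exact: ipos.
have [ine en] : P.-integrable setT (fun w => (\prod_(i <- l1) g i (X i w) * \prod_(i <- k :: l2) fn i (X i w))%:E) /\
  (\int[P]_w (\prod_(i <- l1) g i (X i w) * \prod_(i <- k :: l2) fn i (X i w))%:E =
   (\prod_(i <- l1) fine (\int[P]_w (g i (X i w))%:E) *
    \prod_(i <- k :: l2) fine (\int[P]_w (fn i (X i w))%:E))%:E)%E.
  apply: ih u2 => i; rewrite /fn; case: eqP => [ik|_] //; first by apply: mpos; exact: measurable_funN.
    by move=> x; rewrite le_max lexx orbT.
  by rewrite ik; exact: ipos.
have pos_neg (x : R) : x = Num.max x 0 - Num.max (- x) 0.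
  by have [x0|x0] := leP x 0; [rewrite (max_idPl _) ?oppr_ge0// sub0r opprK | rewrite (max_idPr _) ?oppr_le0 ?ltW// subr0].
have E w : \prod_(i <- k :: l1) g i (X i w) * \prod_(i <- l2) f i (X i w) =
    \prod_(i <- l1) g i (X i w) * \prod_(i <- k :: l2) fp i (X i w) -
    \prod_(i <- l1) g i (X i w) * \prod_(i <- k :: l2) fn i (X i w).
  rewrite !big_cons /fp /fn eqxx.
  rewrite [X in _ - _ * (_ * X)](eq_big_seq (fun i => f i (X i w))); last first.
    by move=> i il; case: eqP => // ik; rewrite -ik il in kl2.
  rewrite [X in _ * (_ * X) - _](eq_big_seq (fun i => f i (X i w))); last first.
    by move=> i il; case: eqP => // ik; rewrite -ik il in kl2.
  by rewrite [in LHS](pos_neg (g k (X k w))); ring.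
have EI : (fun w => (\prod_(i <- k :: l1) g i (X i w) * \prod_(i <- l2) f i (X i w))%:E) =
   (fun w => (\prod_(i <- l1) g i (X i w) * \prod_(i <- k :: l2) fp i (X i w))%:E -
    (\prod_(i <- l1) g i (X i w) * \prod_(i <- k :: l2) fn i (X i w))%:E)%E.
  by apply/funext => w; rewrite E EFinB.
rewrite EI; split; first exact: integrableB.
rewrite integralB// ep en -EFinB; congr EFin; rewrite !big_cons.
rewrite [X in _ - _ * (_ * X)](eq_big_seq (fun i => fine (\int[P]_w (f i (X i w))%:E)%E)); last first.
  by move=> i il; rewrite /fn; case: eqP => // ik; rewrite -ik il in kl2.
rewrite [X in _ * (_ * X) - _](eq_big_seq (fun i => fine (\int[P]_w (f i (X i w))%:E)%E)); last first.
  by move=> i il; rewrite /fp; case: eqP => // ik; rewrite -ik il in kl2.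
have -> : fine (\int[P]_w (g k (X k w))%:E)%E =
    fine (\int[P]_w (fp k (X k w))%:E)%E - fine (\int[P]_w (fn k (X k w))%:E)%E.
  have i1 : P.-integrable setT (fun w => (fp k (X k w))%:E) by rewrite /fp eqxx; exact: ipos.
  have i2 : P.-integrable setT (fun w => (fn k (X k w))%:E) by rewrite /fn eqxx; exact: ipos.
  rewrite -fineB ?integrable_fin_num// -integralB//; congr fine.
  by apply: eq_integral => w _; rewrite -EFinB /fp /fn eqxx -pos_neg.
by ring.
Qed.

Lemma integral_prod_independent (g : I -> R -> R) :
  (forall i, measurable_fun setT (g i)) ->
  (forall i, P.-integrable setT (fun w => (g i (X i w))%:E)) ->
  P.-integrable setT (fun w => (\prod_i g i (X i w))%:E) /\
  fine (\int[P]_w (\prod_i g i (X i w))%:E)%E = \prod_i fine (\int[P]_w (g i (X i w))%:E)%E.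
Proof.
move=> mg ig.
have ul : uniq (index_enum I ++ [::]) by rewrite cats0 index_enum_uniq.
have [] := @integral_prod_mixed_sign g (index_enum I) [::] (fun _ _ => 0) mg ig
  (fun _ => measurable_cst _) (fun _ _ => lexx 0) (fun _ => integrable0 _ _) ul.
under eq_fun do rewrite big_nil mulr1.
move=> h1; rewrite big_nil mulr1.
by move=> ->.
Qed.

End Independence.

Section NormalVariable.
Context d (T : measurableType d) (R : realType) (P : probability T R).
Context (X : {RV P >-> R}) (v : R).
Hypotheses (v_gt0 : 0 < v) (gX : centred_gaussian v X).

Let sigma := Num.sqrt v.
Let sigma_gt0 : 0 < sigma. Proof. by rewrite sqrtr_gt0. Qed.
Local Notation pdf := (normal_pdf 0 sigma).
Local Notation mu := (@lebesgue_measure R).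

Let ge0_integral_gaussian (f : R -> \bar R) : measurable_fun setT f ->
  (forall x, (0 <= f x)%E) ->
  (\int[distribution P X]_x f x = \int[mu]_x (f x * (pdf x)%:E))%E.
Proof.
move=> mf f0; apply: (@integral_density _ _ _ _ _ mu (distribution P X) id).
- by [].
- exact: measurable_normal_pdf.
- by move=> x; exact: normal_pdf_ge0.
- by move=> B mB; exact: gX mB.
- by [].
- by [].
Qed.

Lemma integrable_gaussian_pow k : P.-integrable setT (fun w => (X w ^+ k)%:E).
Proof.
apply/integrableP; split.
  by apply/measurable_EFinP; apply: measurable_funX; exact: measurable_funP.
have mf : measurable_fun setT (fun x : R => (`|x ^+ k|)%:E).
  by apply/measurable_EFinP; exact: measurableT_comp.
have h := @ge0_integral_distribution _ _ _ _ _ P X (fun x => (`|x ^+ k|)%:E) mf (fun y => normr_ge0 _).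
rewrite /comp /= in h; rewrite /= -h ge0_integral_gaussian//.
have /integrableP[_] := integrable_pow_normal_pdf sigma_gt0 k.
by under eq_integral do rewrite /= normrM [ `|pdf _|]ger0_norm ?normal_pdf_ge0// EFinM.
Qed.

Lemma integral_gaussian_pow k :
  (\int[P]_w (X w ^+ k)%:E = \int[mu]_x (x ^+ k * pdf x)%:E)%E.
Proof.
have mf : measurable_fun setT (fun x : R => (x ^+ k)%:E) by exact/measurable_EFinP.
have h := @integral_distribution _ _ _ _ _ P X (fun x => (x ^+ k)%:E) mf (integrable_gaussian_pow k).
rewrite /comp /= in h; rewrite -h.
rewrite integralE [RHS]integralE; congr (_ - _)%E.
  rewrite ge0_integral_gaussian//; last exact: measurable_funepos.
  apply: eq_integral => x _; rewrite !funeposE -!EFin_max -EFinM; congr EFin.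
  by rewrite maxr_pMl ?normal_pdf_ge0// mul0r.
rewrite ge0_integral_gaussian//; last exact: measurable_funeneg.
apply: eq_integral => x _; rewrite !funenegE -!EFinN -!EFin_max -EFinM; congr EFin.
by rewrite maxr_pMl ?normal_pdf_ge0// mul0r mulNr.
Qed.

Definition moment k : R := fine (\int[P]_w (X w ^+ k)%:E)%E.

Lemma moment_rec k : moment k.+1 = v * k%:R * moment k.-1.
Proof.
rewrite /moment !integral_gaussian_pow normal_moment// fineM//; last first.
  by apply: integrable_fin_num => //; exact: integrable_pow_normal_pdf.
by rewrite /= /sigma sqr_sqrtr// ltW.
Qed.

End NormalVariable.

(** * Gaussian integration by parts for monomials in the matrix entries *)

Section Wick.
Context d (T : measurableType d) (R : realType) (P : probability T R) (n : nat).
Local Notation N := n.+1.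
Context (H : 'I_N -> 'I_N -> {RV P >-> R}).
Hypothesis goeH : is_GOE H.

Let Ip := {p : 'I_N * 'I_N | (p.1 <= p.2)%N}.
Let X (p : Ip) := H (val p).1 (val p).2.
Let v (p : Ip) : R := (if (val p).1 == (val p).2 then 2 else 1) / N%:R.

Let ordp_proof (x y : 'I_N) : (((if (x <= y)%N then (x, y) else (y, x)).1 <=
  (if (x <= y)%N then (x, y) else (y, x)).2)%N).
Proof. by case: ifP => //=; case: ltngtP. Qed.

Let ordp x y : Ip := @exist _ (fun p : 'I_N * 'I_N => is_true (p.1 <= p.2)%N) _ (ordp_proof x y).

Let XE x y w : H x y w = X (ordp x y) w.
Proof.
case: goeH => sH _ _; rewrite /X /=; case: ifP => //= _; exact: sH.
Qed.

Let v_gt0 p : 0 < v p.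
Proof. by rewrite divr_gt0//; case: ifP. Qed.

Let gX p : centred_gaussian (v p) (X p).
Proof. by case: goeH => _ gH _; exact: gH. Qed.

Let M p k := moment (X p) k.

Definition expect (f : T -> R) : R := fine (\int[P]_w (f w)%:E)%E.

Let monX (l : seq Ip) w := \prod_(p <- l) X p w.

Let monX_cons p l w : monX (p :: l) w = X p w * monX l w.
Proof. by rewrite /monX big_cons. Qed.

Let monX_count l w : monX l w = \prod_p X p w ^+ count_mem p l.
Proof.
rewrite /monX; elim: l => [|q l ih].
  by rewrite big_nil big1.
rewrite big_cons ih (bigD1 q)//= [RHS](bigD1 q)//= eqxx add1n exprS mulrA.
congr (_ * _); apply: eq_bigr => p pq; by rewrite eq_sym (negPf pq).
Qed.

Let monX_perm l1 l2 w : perm_eq l1 l2 -> monX l1 w = monX l2 w.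
Proof.
by move=> /permP h; rewrite !monX_count; apply: eq_bigr => p _; rewrite h.
Qed.

Let monX_rem p l w : p \in l -> monX l w = X p w * monX (rem p l) w.
Proof. by move=> pl; rewrite -monX_cons; apply: monX_perm; exact: perm_to_rem. Qed.

Let monX_integral l : P.-integrable setT (fun w => (monX l w)%:E) /\
  expect (monX l) = \prod_p M p (count_mem p l).
Proof.
case: goeH => _ _ iH.
have [] := @integral_prod_independent _ T R P Ip X iH (fun p x => x ^+ count_mem p l).
- by move=> p; exact: measurable_funX.
- by move=> p; exact: (integrable_gaussian_pow (v_gt0 p) (gX p)).
move=> h1 h2; rewrite /expect.
have e : (fun w => (monX l w)%:E) = (fun w => (\prod_p X p w ^+ count_mem p l)%:E).
  by apply/funext => w; rewrite monX_count.
by rewrite e; split.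
Qed.

(** Collecting equal entries reduces the claim to the moment recursion of one Gaussian variable. *)
Let monX_ibp q l : expect (monX (q :: l)) =
  v q * (count_mem q l)%:R * expect (monX (rem q l)).
Proof.
rewrite !(monX_integral _).2 (bigD1 q)//= [in RHS](bigD1 q)//= eqxx add1n.
set A := \prod_(i | i != q) _; set B := \prod_(i | i != q) _.
have -> : A = B.
  apply: eq_bigr => p pq.
  by rewrite count_mem_rem [q == p]eq_sym (negPf pq) add0n subn0.
by rewrite /M (moment_rec (v_gt0 q) (gX q)) count_mem_rem eqxx subn1; ring.
Qed.

Definition mon (L : seq ('I_N * 'I_N)) w : R := \prod_(e <- L) H e.1 e.2 w.

(* N times the covariance of H x y and H e.1 e.2. *)
Definition cov2 x y (e : 'I_N * 'I_N) : R :=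
  ((x == e.1) && (y == e.2))%:R + ((x == e.2) && (y == e.1))%:R.

(** The Leibniz rule along a list: each factor in turn is replaced by N times its covariance with H
    x y. *)
Fixpoint dmon x y L w : R :=
  if L is e :: L' then cov2 x y e * mon L' w + H e.1 e.2 w * dmon x y L' w else 0.

Let ords (L : seq ('I_N * 'I_N)) := [seq ordp e.1 e.2 | e <- L].

Let monE L w : mon L w = monX (ords L) w.
Proof. by rewrite /mon /monX big_map; apply: eq_bigr => e _; exact: XE. Qed.

Lemma mon_integrable L : P.-integrable setT (fun w => (mon L w)%:E).
Proof.
have -> : (fun w => (mon L w)%:E) = (fun w => (monX (ords L) w)%:E).
  by apply/funext => w; rewrite monE.
exact: (monX_integral _).1.
Qed.

(** Off the diagonal at most one of the two terms of [cov2] is 1; on it they coincide, and their sum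
    2 is the doubled diagonal variance. *)
Let cov2E x y e : N%:R^-1 * cov2 x y e = (ordp x y == ordp e.1 e.2)%:R * v (ordp x y).
Proof.
case: e => z u; rewrite /cov2 /v /=.
have xyE : ((if (x <= y)%N then (x, y) else (y, x)) == (if (z <= u)%N then (z, u) else (u, z))) =
  ((x == z) && (y == u)) || ((x == u) && (y == z)).
  case: (leqP x y) => xy; case: (leqP z u) => zu; rewrite xpair_eqE.
  - case: (boolP ((x == u) && (y == z))) => [/andP[/eqP xu /eqP yz]|]; last by rewrite orbF.
    have xy' : x = y.
      by apply/val_inj/eqP; rewrite eqn_leq xy /= xu yz.
    by rewrite -yz -xu xy' eqxx.
  - case: (boolP ((x == z) && (y == u))) => [/andP[/eqP xz /eqP yu]|] //=.
    by move: zu; rewrite -xz -yu ltnNge xy.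
  - case: (boolP ((x == z) && (y == u))) => [/andP[/eqP xz /eqP yu]|] /=; last by move=> _; rewrite andbC.
    by move: xy; rewrite xz yu ltnNge zu.
  - rewrite andbC; case: (boolP ((x == u) && (y == z))) => [/andP[/eqP xu /eqP yz]|]; last by rewrite orbF.
    by move: xy; rewrite xu yz ltnNge ltnW.
have -> : (ordp x y == ordp z u) = ((x == z) && (y == u)) || ((x == u) && (y == z)).
  by rewrite -xyE -val_eqE.
have vE : (if (if (x <= y)%N then (x, y) else (y, x)).1 == (if (x <= y)%N then (x, y) else (y, x)).2
    then 2 else 1 : R) = 1 + (x == y)%:R.
  case: (x <= y)%N => /=; rewrite ?[y == x]eq_sym; case: (x == y); by rewrite /= ?addr0 ?mulr2n.
rewrite vE; have [->|xy] := eqVneq x y.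
  rewrite [(y == u) && _]andbC orbb; case: (_ && _); rewrite /=.
    by rewrite mul1r mulrC.
  by rewrite addr0 mulr0 mul0r.
have nn : ~~ (((x == z) && (y == u)) && ((x == u) && (y == z))).
  apply/negP => /andP[/andP[/eqP xz _] /andP[_ /eqP yz]].
  by move: xy; rewrite xz yz eqxx.
move: nn; case: ((x == z) && (y == u)); case: ((x == u) && (y == z)) => //= _;
  by rewrite ?addr0 ?add0r ?mul0r ?mulr0 ?mulr1 ?mul1r.
Qed.

Let dmonE x y L w : N%:R^-1 * dmon x y L w =
  v (ordp x y) * (count_mem (ordp x y) (ords L))%:R * monX (rem (ordp x y) (ords L)) w.
Proof.
set q := ordp x y; elim: L => [|e L ih]; first by rewrite /= !mulr0 mul0r.
rewrite [dmon _ _ _ _]/= mulrDr mulrA cov2E [N%:R^-1 * (H _ _ _ * _)]mulrCA ih XE monE -/q.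
set p := ordp e.1 e.2; rewrite [ords (e :: L)]/= -/p -/(ords L).
have [qp|qp] := eqVneq q p.
  rewrite /= qp !eqxx mul1r.
  have -> : X p w * (v p * (count_mem p (ords L))%:R * monX (rem p (ords L)) w) =
     v p * (count_mem p (ords L))%:R * monX (ords L) w.
    have [pL|pL] := boolP (p \in ords L); last first.
      by rewrite (count_memPn pL) mulr0 !mul0r mulr0.
    by rewrite (monX_rem w pL) [LHS]mulrCA.
  by rewrite natrD mulrDr mulr1 mulrDl.
rewrite /= [p == q]eq_sym (negPf qp) mulr0n !mul0r !add0r.
by rewrite monX_cons [LHS]mulrCA.
Qed.

(* Df x y is N sum_e Cov (H x y, H e) (df / dH e), computed on a representation
   of f as a polynomial in the entries, so that E [H x y * f] = E [Df x y] / N. *)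
Definition polyd (f : T -> R) (Df : 'I_N -> 'I_N -> T -> R) : Prop :=
  exists p : seq (R * seq ('I_N * 'I_N)),
    (forall w, f w = \sum_(c <- p) c.1 * mon c.2 w) /\
    (forall x y w, Df x y w = \sum_(c <- p) c.1 * dmon x y c.2 w).

Lemma mon_ibp x y L : expect (fun w => H x y w * mon L w) = N%:R^-1 * expect (dmon x y L).
Proof.
have e0 (w : T) : dmon x y L w = N%:R * (v (ordp x y) *
    (count_mem (ordp x y) (ords L))%:R) * monX (rem (ordp x y) (ords L)) w.
  by rewrite -[RHS]mulrA -dmonE mulVKf.
have -> : dmon x y L = fun w => N%:R * (v (ordp x y) *
    (count_mem (ordp x y) (ords L))%:R) * monX (rem (ordp x y) (ords L)) w.
  exact/funext.
have -> : (fun w => H x y w * mon L w) = monX (ordp x y :: ords L).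
  by apply/funext => w; rewrite monX_cons XE monE.
rewrite monX_ibp /expect.
under [in RHS]eq_integral do rewrite EFinM.
rewrite integralZl//; last exact: (monX_integral _).1.
rewrite fineM//; last by apply: integrable_fin_num => //; exact: (monX_integral _).1.
by rewrite /= !mulrA mulVf ?mul1r.
Qed.

End Wick.

Definition del (A : Type) (i : nat) (s : seq A) := take i s ++ drop i.+1 s.

(** * Loop equations for normalized traces of powers *)

Section LoopEquation.
Context d (T : measurableType d) (R : realType) (P : probability T R) (n : nat).
Local Notation N := n.+1.
Context (H : 'I_N -> 'I_N -> {RV P >-> R}).
Hypothesis goeH : is_GOE H.

Let mon_cat L1 L2 w : mon H (L1 ++ L2) w = mon H L1 w * mon H L2 w.
Proof. by rewrite /mon big_cat. Qed.

Let dmon_cat x y L1 L2 w : dmon H x y (L1 ++ L2) w =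
  dmon H x y L1 w * mon H L2 w + mon H L1 w * dmon H x y L2 w.
Proof.
elim: L1 => [|e L1 ih] /=; first by rewrite mul0r add0r /mon big_nil mul1r.
by rewrite ih mon_cat /mon big_cons -/(mon H L1 w); ring.
Qed.

Lemma polyd_cst (a : R) : polyd H (fun=> a) (fun _ _ _ => 0).
Proof.
exists [:: (a, [::])]; split=> *; rewrite big_seq1 /=; last by rewrite mulr0.
by rewrite /mon big_nil mulr1.
Qed.

Lemma polyd_entry z u : polyd H (H z u) (fun x y _ => cov2 R x y (z, u)).
Proof.
exists [:: (1, [:: (z, u)])]; split=> *; rewrite big_seq1 /=.
  by rewrite /mon big_seq1 mul1r.
by rewrite /mon big_nil mulr0 addr0 mulr1 mul1r.
Qed.

Lemma polydD f g Df Dg : polyd H f Df -> polyd H g Dg ->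
  polyd H (fun w => f w + g w) (fun x y w => Df x y w + Dg x y w).
Proof.
move=> [p [fp dp]] [q [gq dq]]; exists (p ++ q); split=> *; rewrite big_cat.
  by rewrite fp gq.
by rewrite dp dq.
Qed.

Lemma polydM f g Df Dg : polyd H f Df -> polyd H g Dg ->
  polyd H (fun w => f w * g w) (fun x y w => Df x y w * g w + f w * Dg x y w).
Proof.
move=> [p [fp dp]] [q [gq dq]].
exists [seq (c.1 * e.1, c.2 ++ e.2) | c <- p, e <- q]; split=> *; rewrite big_allpairs_dep.
  rewrite fp gq mulr_suml; apply: eq_bigr => c _; rewrite mulr_sumr; apply: eq_bigr => e _.
  by rewrite /= mon_cat; ring.
rewrite dp dq fp gq !mulr_suml -big_split; apply: eq_bigr => c _ /=.
rewrite !mulr_sumr -big_split; apply: eq_bigr => e _ /=.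
by rewrite dmon_cat; ring.
Qed.

Lemma polyd_ext f g Df Dg : polyd H f Df -> (forall w, f w = g w) ->
  (forall x y w, Df x y w = Dg x y w) -> polyd H g Dg.
Proof.
move=> [p [fp dp]] fg dfg; exists p; split=> *; first by rewrite -fg.
by rewrite -dfg.
Qed.

Lemma polyd_sum (I : Type) (r : seq I) (f : I -> T -> R) Df :
  (forall i, polyd H (f i) (Df i)) ->
  polyd H (fun w => \sum_(i <- r) f i w) (fun x y w => \sum_(i <- r) Df i x y w).
Proof.
move=> h; elim: r => [|i r ih].
  by apply: polyd_ext (polyd_cst 0) _ _ => *; rewrite big_nil.
by apply: polyd_ext (polydD (h i) ih) _ _ => *; rewrite big_cons.
Qed.

Definition ispoly (f : T -> R) := exists D, polyd H f D.

Lemma ispoly_mon L : ispoly (mon H L).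
Proof.
exists (fun x y w => dmon H x y L w); exists [:: (1, L)].
by split=> *; rewrite big_seq1 mul1r.
Qed.

Lemma ispoly_cst a : ispoly (fun=> a).
Proof. by eexists; exact: polyd_cst. Qed.

Lemma ispoly_entry z u : ispoly (H z u).
Proof. by eexists; exact: polyd_entry. Qed.

Lemma ispolyD f g : ispoly f -> ispoly g -> ispoly (fun w => f w + g w).
Proof. by move=> [D1 h1] [D2 h2]; eexists; exact: (polydD h1 h2). Qed.

Lemma ispolyM f g : ispoly f -> ispoly g -> ispoly (fun w => f w * g w).
Proof. by move=> [D1 h1] [D2 h2]; eexists; exact: (polydM h1 h2). Qed.

Lemma ispoly_ext f g : ispoly f -> (forall w, f w = g w) -> ispoly g.
Proof. by move=> [D h] e; exists D; exact: (polyd_ext h e). Qed.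

Lemma ispoly_sum (I : Type) (r : seq I) (f : I -> T -> R) :
  (forall i, ispoly (f i)) -> ispoly (fun w => \sum_(i <- r) f i w).
Proof.
move=> h; elim: r => [|i r ih].
  by apply: ispoly_ext (ispoly_cst 0) _ => *; rewrite big_nil.
by apply: ispoly_ext (ispolyD (h i) ih) _ => *; rewrite big_cons.
Qed.

Lemma ispoly_dmon x y L : ispoly (dmon H x y L).
Proof.
elim: L => [|e L ih] /=; first exact: ispoly_cst.
apply: ispolyD; apply: ispolyM => //; [exact: ispoly_cst | exact: ispoly_mon | exact: ispoly_entry].
Qed.

Lemma ispoly_integrable f : ispoly f -> P.-integrable setT (fun w => (f w)%:E).
Proof.
move=> [D [p [fp _]]].
have -> : (fun w => (f w)%:E) = (fun w => \sum_(c <- p) (c.1%:E * (mon H c.2 w)%:E))%E.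
  by apply/funext => w; rewrite fp -sumEFin.
apply: integrable_sum => // c _; apply: integrableZl => //.
exact: mon_integrable.
Qed.

Lemma expectD f g : ispoly f -> ispoly g ->
  expect P (fun w => f w + g w) = expect P f + expect P g.
Proof.
move=> /ispoly_integrable hf /ispoly_integrable hg; rewrite /expect.
under eq_integral do rewrite EFinD.
by rewrite integralD// fineD// integrable_fin_num.
Qed.

Lemma expectZ (a : R) f : ispoly f -> expect P (fun w => a * f w) = a * expect P f.
Proof.
move=> /ispoly_integrable hf; rewrite /expect.
under eq_integral do rewrite EFinM.
by rewrite integralZl// fineM// integrable_fin_num.
Qed.

Lemma eq_expect f g : (forall w, f w = g w) -> expect P f = expect P g.
Proof. by move=> e; congr (expect P _); exact/funext. Qed.

Lemma expect_cst a : expect P (fun=> a) = a.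
Proof.
rewrite /expect; have -> : (\int[P]_w (cst a w)%:E = a%:E)%E; last by [].
by have := expectation_cst P a; rewrite unlock.
Qed.

Lemma expect_sum (I : Type) (r : seq I) (f : I -> T -> R) : (forall i, ispoly (f i)) ->
  expect P (fun w => \sum_(i <- r) f i w) = \sum_(i <- r) expect P (f i).
Proof.
move=> h; elim: r => [|i r ih].
  by rewrite big_nil -[RHS](expect_cst 0); apply: eq_expect => w; rewrite big_nil.
rewrite big_cons -ih -expectD//; last exact: ispoly_sum.
by apply: eq_expect => w; rewrite big_cons.
Qed.

Lemma polyd_ibp x y f Df : polyd H f Df ->
  expect P (fun w => H x y w * f w) = N%:R^-1 * expect P (Df x y).
Proof.
move=> [p [fp dp]].
rewrite (eq_expect (g := fun w => \sum_(c <- p) c.1 * (H x y w * mon H c.2 w))); last first.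
  by move=> w; rewrite fp mulr_sumr; apply: eq_bigr => c _; rewrite mulrCA.
rewrite (eq_expect (f := Df x y) (dp x y)).
have i1 c : ispoly (fun w => H x y w * mon H c.2 w).
  by apply: ispolyM; [exact: ispoly_entry | exact: ispoly_mon].
rewrite !expect_sum; last 2 first.
- by move=> c; apply: ispolyM; [exact: ispoly_cst | exact: ispoly_dmon].
- by move=> c; apply: ispolyM; [exact: ispoly_cst | exact: i1].
rewrite mulr_sumr; apply: eq_bigr => c _; rewrite !expectZ ?mon_ibp//; first by rewrite mulrCA.
exact: ispoly_dmon.
Qed.

Let Hp a i j w : R := (random_matrix H w ^+ a) i j.

Let Hp0 i j w : Hp 0 i j w = (i == j)%:R.
Proof. by rewrite /Hp expr0 mxE. Qed.

Let HpS a i j w : Hp a.+1 i j w = \sum_k H i k w * Hp a k j w.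
Proof. by rewrite /Hp exprS mxE; apply: eq_bigr => k _; rewrite mxE. Qed.

Let HpD a b i j w : \sum_k Hp a i k w * Hp b k j w = Hp (a + b) i j w.
Proof. by rewrite /Hp exprD [RHS]mxE. Qed.

Let HpC a i j w : Hp a i j w = Hp a j i w.
Proof.
case: goeH => sH _ _.
have sT : (random_matrix H w)^T = random_matrix H w by apply/matrixP => x y; rewrite !mxE sH.
have : (random_matrix H w ^+ a)^T = random_matrix H w ^+ a.
  elim: a => [|a ih]; first by rewrite expr0 trmx1.
  have e : random_matrix H w ^+ a.+1 = random_matrix H w *m random_matrix H w ^+ a.
    by rewrite exprS.
  by rewrite {1}e trmx_mul ih sT exprSr.
by move=> e; rewrite /Hp -[in LHS]e mxE.
Qed.

Let dHp a i j x y w : R := \sum_(k < a)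
  (Hp k i x w * Hp (a.-1 - k) y j w + Hp k i y w * Hp (a.-1 - k) x j w).

(** Leibniz rule over the position k of the differentiated factor; there are two terms because H x y
    and H y x are the same variable. *)
Lemma polyd_pow a i j : polyd H (Hp a i j) (dHp a i j).
Proof.
elim: a i j => [|a ih] i j.
  apply: polyd_ext (polyd_cst (i == j)%:R) _ _ => *; first by rewrite Hp0.
  by rewrite /dHp big_ord0.
apply: polyd_ext (polyd_sum (index_enum _) (fun k => polydM (polyd_entry i k) (ih k j))) _ _.
  by move=> w; rewrite HpS.
move=> x y w; rewrite big_split /= /dHp [RHS]big_ord_recl /= !subn0 !Hp0; congr (_ + _).
  rewrite /cov2 /=; under eq_bigr do rewrite mulrDl.
  rewrite big_split /=; congr (_ + _).
    rewrite (bigD1 y)//= eqxx andbT [x == i]eq_sym big1 ?addr0// => k ky.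
    by rewrite [y == k]eq_sym (negPf ky) andbF mul0r.
  rewrite (bigD1 x)//= eqxx [y == i]eq_sym big1 ?addr0// => k kx.
  by rewrite [x == k]eq_sym (negPf kx) mul0r.
under eq_bigr do rewrite mulr_sumr.
rewrite exchange_big; apply: eq_bigr => l _ /=.
under eq_bigr do rewrite mulrDr !mulrA.
rewrite big_split /= -!mulr_suml -!HpS /bump /= add1n.
by rewrite (_ : (a - l.+1 = a.-1 - l)%N)// subnS predn_sub.
Qed.

Definition ntr a w : R := N%:R^-1 * \tr (random_matrix H w ^+ a).

Let ntrE a w : N%:R * ntr a w = \sum_i Hp a i i w.
Proof. by rewrite /ntr mulVKf. Qed.

(** Summing over the diagonal, all a positions and both orientations contribute the same entry of
    the power a - 1. *)
Lemma polyd_ntr a : polyd H (ntr a)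
  (fun x y w => 2 * a%:R * N%:R^-1 * Hp a.-1 x y w).
Proof.
have h := polyd_sum (index_enum _) (fun i => polyd_pow a i i).
apply: polyd_ext (polydM (polyd_cst N%:R^-1) h) _ _ => // x y w.
rewrite mul0r add0r /dHp exchange_big /=.
rewrite (eq_bigr (fun=> 2 * Hp a.-1 x y w)).
  by rewrite sumr_const card_ord -mulr_natr; ring.
move=> k _; rewrite big_split /=.
rewrite (eq_bigr (fun i => Hp (a.-1 - k) y i w * Hp k i x w)); last by move=> i _; rewrite mulrC.
rewrite [X in _ + X](eq_bigr (fun i => Hp (a.-1 - k) x i w * Hp k i y w)); last by move=> i _; rewrite mulrC.
rewrite !HpD subnK; last by rewrite -ltnS prednK// (leq_ltn_trans _ (ltn_ord k)).
by rewrite (HpC _ y x); ring.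
Qed.

Lemma polyd_prod_ntr (bs : seq nat) : polyd H (fun w => \prod_(b <- bs) ntr b w)
  (fun x y w => \sum_(i < size bs) 2 * (nth 0%N bs i)%:R * N%:R^-1 *
     Hp (nth 0%N bs i).-1 x y w * \prod_(b <- del i bs) ntr b w).
Proof.
elim: bs => [|b bs ih].
  apply: (polyd_ext (polyd_cst 1)) => *; first by rewrite big_nil.
  by rewrite big_ord0.
apply: (polyd_ext (polydM (polyd_ntr b) ih)) => [w|x y w]; first by rewrite big_cons.
rewrite [size _]/= big_ord_recl [del _ _]/= /del /= drop0; congr (_ + _).
rewrite mulr_sumr; apply: eq_bigr => i _ /=.
by rewrite big_cons; ring.
Qed.

Lemma ispoly_Hp a i j : ispoly (Hp a i j).
Proof. by eexists; exact: (polyd_pow a i j). Qed.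

Lemma ispoly_ntr a : ispoly (ntr a).
Proof. by eexists; exact: (polyd_ntr a). Qed.

Lemma ispoly_prod_ntr bs : ispoly (fun w => \prod_(b <- bs) ntr b w).
Proof. by eexists; exact: (polyd_prod_ntr bs). Qed.

Definition ntr_moment (bs : seq nat) : R := expect P (fun w => \prod_(b <- bs) ntr b w).

(** One orientation closes up into a single trace, the other splits the cycle into two traces and so
    gains a factor N. *)
Let sum_dHp a w : \sum_x \sum_y dHp a y x x y w =
  \sum_(k < a) (N%:R * ntr a.-1 w + N%:R ^+ 2 * (ntr k w * ntr (a.-1 - k) w)).
Proof.
under eq_bigr do rewrite exchange_big /=.
rewrite exchange_big; apply: eq_bigr => k _ /=.
under eq_bigr do rewrite big_split /=.
rewrite big_split /=; congr (_ + _).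
  rewrite ntrE (eq_bigr (fun x => Hp a.-1 x x w))// => x _.
  rewrite -[in RHS](@subnK k a.-1); last by rewrite -ltnS prednK// (leq_ltn_trans _ (ltn_ord k)).
  rewrite addnC -HpD; apply: eq_bigr => y _; by rewrite (HpC _ y x).
rewrite (_ : N%:R ^+ 2 * _ = (N%:R * ntr k w) * (N%:R * ntr (a.-1 - k) w)); last by ring.
rewrite !ntrE mulr_suml exchange_big; apply: eq_bigr => y _ /=.
by rewrite mulr_sumr.
Qed.

(** Integrate by parts in the first factor of the first trace. Differentiating the rest of that
    trace splits it or, at relative order 1 / N, reconnects it; differentiating another trace merges
    the two at order 1 / N^2. *)
Lemma loop_equation a bs : ntr_moment (a.+1 :: bs) =
  \sum_(k < a) ntr_moment [:: k : nat, (a.-1 - k)%N & bs]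
  + a%:R / N%:R * ntr_moment (a.-1 :: bs)
  + 2 / N%:R ^+ 2 * \sum_(i < size bs) (nth 0%N bs i)%:R *
      ntr_moment ((a + (nth 0%N bs i).-1)%N :: del i bs).
Proof.
pose Phi w := \prod_(b <- bs) ntr b w.
pose DPhi x y w := \sum_(i < size bs) 2 * (nth 0%N bs i)%:R * N%:R^-1 *
     Hp (nth 0%N bs i).-1 x y w * \prod_(b <- del i bs) ntr b w.
have dPhi : polyd H Phi DPhi by exact: polyd_prod_ntr.
have pPhi : ispoly Phi by exact: ispoly_prod_ntr.
have pDPhi x y : ispoly (DPhi x y).
  apply: ispoly_sum => i; apply: ispolyM; last exact: ispoly_prod_ntr.
  by apply: ispolyM; [exact: ispoly_cst | exact: ispoly_Hp].
pose F x y w := Hp a y x w * Phi w.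
have dF x y : polyd H (F x y) (fun z u w => dHp a y x z u w * Phi w + Hp a y x w * DPhi z u w).
  by apply: polydM => //; exact: polyd_pow.
have pF x y : ispoly (F x y) by eexists; exact: (dF x y).
have pHF x y : ispoly (fun w => H x y w * F x y w) by apply: ispolyM => //; exact: ispoly_entry.
have pdHp x y z u : ispoly (dHp a y x z u).
  by apply: ispoly_sum => k; apply: ispolyD; apply: ispolyM; exact: ispoly_Hp.
have pD x y : ispoly (fun w => dHp a y x x y w * Phi w + Hp a y x w * DPhi x y w).
  by apply: ispolyD; apply: ispolyM => //; exact: ispoly_Hp.
have e1 : ntr_moment (a.+1 :: bs) = N%:R^-1 * \sum_x \sum_y expect P (fun w => H x y w * F x y w).
  rewrite (eq_bigr (fun x => expect P (fun w => \sum_y H x y w * F x y w))); last first.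
    by move=> x _; rewrite expect_sum.
  rewrite -expect_sum; last by move=> x; exact: ispoly_sum.
  rewrite -expectZ; last by apply: ispoly_sum => x; exact: ispoly_sum.
  apply: eq_expect => w; rewrite big_cons -/(Phi w) /ntr -mulrA; congr (_ * _).
  rewrite /mxtrace mulr_suml; apply: eq_bigr => x _.
  by rewrite -/(Hp a.+1 x x w) HpS mulr_suml; apply: eq_bigr => y _; rewrite /F mulrA.
rewrite e1.
under eq_bigr do under eq_bigr do rewrite (polyd_ibp _ _ (dF _ _)).
under eq_bigr do rewrite -mulr_sumr.
rewrite -mulr_sumr mulrA.
have e2 : \sum_x \sum_y expect P (fun w => dHp a y x x y w * Phi w + Hp a y x w * DPhi x y w) =
  expect P (fun w => \sum_(k < a) (N%:R ^+ 2 * \prod_(b <- [:: k : nat, (a.-1 - k)%N & bs]) ntr b w)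
    + N%:R * a%:R * \prod_(b <- a.-1 :: bs) ntr b w +
    \sum_(i < size bs) 2 * (nth 0%N bs i)%:R * \prod_(b <- (a + (nth 0%N bs i).-1)%N :: del i bs) ntr b w).
  rewrite (eq_bigr (fun x => expect P (fun w => \sum_y (dHp a y x x y w * Phi w + Hp a y x w * DPhi x y w)))); last first.
    by move=> x _; rewrite expect_sum.
  rewrite -expect_sum; last by move=> x; exact: ispoly_sum.
  apply: eq_expect => w.
  rewrite /=; under eq_bigr => x _ do rewrite big_split /= -mulr_suml.
  rewrite big_split -mulr_suml /= sum_dHp; congr (_ + _).
    rewrite big_split /= sumr_const card_ord mulrDl addrC; congr (_ + _).
      rewrite mulr_suml; apply: eq_bigr => k _; rewrite !big_cons -/(Phi w); ring.
    by rewrite big_cons -/(Phi w) -mulr_natr; ring.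
  under eq_bigr do under eq_bigr do rewrite mulr_sumr.
  under eq_bigr do rewrite exchange_big.
  rewrite exchange_big; apply: eq_bigr => i _ /=.
  set b := nth 0%N bs i; set Pi := \prod_(b <- _) _.
  rewrite big_cons -/Pi.
  have -> : ntr (a + b.-1) w = N%:R^-1 * \sum_x \sum_y Hp a y x w * Hp b.-1 x y w.
    rewrite /ntr; congr (_ * _); rewrite exchange_big; apply: eq_bigr => x _ /=.
    by rewrite HpD.
  rewrite mulrA [2 * b%:R * (N%:R^-1 * _)]mulrA -/(2 * b%:R / N%:R) mulr_sumr mulr_suml.
  apply: eq_bigr => x _; rewrite mulr_sumr mulr_suml; apply: eq_bigr => y _; ring.
rewrite e2.
have pm bs' : ispoly (fun w => \prod_(b <- bs') ntr b w) := ispoly_prod_ntr bs'.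
have pc (c : R) bs' : ispoly (fun w => c * \prod_(b <- bs') ntr b w).
  by apply: ispolyM => //; exact: ispoly_cst.
rewrite expectD; last 2 first.
- by apply: ispolyD => //; exact: ispoly_sum.
- exact: ispoly_sum.
rewrite expectD//; last exact: ispoly_sum.
rewrite !expect_sum// expectZ//.
under eq_bigr do rewrite expectZ//.
under [X in _ + X]eq_bigr do rewrite expectZ//.
rewrite -mulr_sumr -/(ntr_moment _) !mulrDr mulrA; congr (_ + _ + _).
- by rewrite -invfM mulVf ?mul1r// mulf_neq0.
- by rewrite !mulrA; congr (_ * _); field; rewrite nat1r.
- rewrite !mulr_sumr; apply: eq_bigr => i _; rewrite -/(ntr_moment _).
  by field; rewrite nat1r.
Qed.

Lemma ntr_moment_nil : ntr_moment [::] = 1.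
Proof.
by rewrite -[RHS]expect_cst; apply: eq_expect => w; rewrite big_nil.
Qed.

Lemma ntr_moment0 bs : ntr_moment (0%N :: bs) = ntr_moment bs.
Proof.
apply: eq_expect => w; rewrite big_cons /ntr expr0 mxtrace1.
by rewrite mulVf ?mul1r.
Qed.

End LoopEquation.

(** * Moments and numerical radius of the GOE *)

Section Catalan.
Context {R : realType}.

(** Defined by the quotient recursion, from which the comparisons with 4^k are immediate; the
    convolution identity needed for the loop equations is then derived. *)
Fixpoint catalan (k : nat) : R :=
  if k is k'.+1 then (4 * k'%:R + 2) / (k'%:R + 2) * catalan k' else 1.

Lemma catalan_gt0 k : 0 < catalan k.
Proof. by elim: k => //= k ih; rewrite mulr_gt0// divr_gt0// ltr_wpDl// mulr_ge0. Qed.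

Lemma catalanS k : (k%:R + 2) * catalan k.+1 = (4 * k%:R + 2) * catalan k.
Proof. by rewrite /=; field; rewrite gt_eqF// ltr_wpDl. Qed.

Lemma catalan_le k : catalan k <= 4 ^+ k.
Proof.
elim: k => [|k ih]; first by rewrite expr0.
have h : 0 <= k%:R :> R by [].
rewrite exprS /=; apply: ler_pM.
- by rewrite divr_ge0// ?addr_ge0// mulr_ge0.
- exact: ltW (catalan_gt0 k).
- rewrite ler_pdivrMr ?ltr_wpDl//; lra.
- exact: ih.
Qed.

Lemma catalan_nondecr k : catalan k <= catalan k.+1.
Proof.
have h : 0 <= k%:R :> R by [].
rewrite -(@ler_pM2l _ (k%:R + 2)) ?ltr_wpDl// catalanS ler_pM2r ?catalan_gt0//; lra.
Qed.

Lemma catalan_ge k : 4 ^+ k <= k.+1%:R ^+ 2 * catalan k.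
Proof.
elim: k => [|k ih]; first by rewrite expr0 expr1n mul1r.
have h : 0 <= k%:R :> R by [].
have k2 : 0 < k%:R + 2 :> R by rewrite ltr_wpDl.
rewrite exprS -(@ler_pM2l _ (k%:R + 2))// mulrCA [X in _ <= X]mulrCA catalanS.
apply: (@le_trans _ _ (4 * ((k%:R + 2) * (k.+1%:R ^+ 2 * catalan k)))).
  by rewrite ler_pM2l// ler_pM2l.
have c0 := catalan_gt0 k.
rewrite !mulrA ler_pM2r// -[k.+2%:R]natr1 -[k.+1%:R]natr1.
move: k%:R h k2 => x x0 x2.
rewrite -subr_ge0 (_ : _ - _ = (x + 2) * (x * 2)); first by rewrite !mulr_ge0// ltW.
by ring.
Qed.

Let conv n : R := \sum_(i < n.+1) catalan i * catalan (n - i).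

Let conv_weighted n : \sum_(i < n.+1) (i%:R + 1) * (catalan i * catalan (n - i)) =
  (n%:R + 2) / 2 * conv n.
Proof.
set S := LHS.
have S2 : S = \sum_(i < n.+1) ((n - i)%:R + 1) * (catalan i * catalan (n - i)).
  rewrite /S (reindex_inj rev_ord_inj) /=; apply: eq_bigr => i _.
  by rewrite subSS subKn 1?mulrC 1?[catalan _ * _]mulrC 1?mulrC// -ltnS.
suff : S + S = (n%:R + 2) * conv n by lra.
rewrite {2}S2 -big_split mulr_sumr; apply: eq_bigr => i _ /=.
rewrite natrB; last by rewrite -ltnS.
by ring.
Qed.

(** The sum weighted by i + 1 is computed twice: by the symmetry of i and n - i, and by the quotient
    recursion, which lowers the first index and leads back to the previous convolution. *)
Lemma catalan_convolution n : \sum_(i < n.+1) catalan i * catalan (n - i) = catalan n.+1.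
Proof.
rewrite -/(conv n); elim: n => [|n ih].
  by rewrite /conv big_ord1 /=; field.
have n3 : n%:R + 3 != 0 :> R by rewrite gt_eqF// ltr_wpDl.
have h1 := conv_weighted n.+1.
have h2 : \sum_(i < n.+2) (i%:R + 1) * (catalan i * catalan (n.+1 - i)) = (2 * n%:R + 3) * catalan n.+1.
  rewrite big_ord_recl subn0 mul1r add0r mul1r.
  rewrite (eq_bigr (fun i : 'I_n.+1 => 4 * ((i%:R + 1) * (catalan i * catalan (n - i)))
     - 2 * (catalan i * catalan (n - i)))); last first.
    move=> i _; rewrite !lift0 subSS.
    have e := catalanS i; rewrite -[i.+1%:R]natr1.
    rewrite (_ : (i%:R + 1 + 1) * _ = ((i%:R + 2) * catalan i.+1) * catalan (n - i)); last first.
      by ring.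
    by rewrite e; ring.
  rewrite sumrB -!mulr_sumr conv_weighted -/(conv n) ih; lra.
have := catalanS n.+1; rewrite h2 in h1; rewrite -[n.+1%:R]natr1 in h1 *; move=> h3.
have h4 : (n%:R + 1 + 2) * conv n.+1 = (n%:R + 1 + 2) * catalan n.+2 by rewrite h3; lra.
by apply: (mulfI _ h4); rewrite -addrA; rewrite (_ : 1 + 2 = 3) //; ring.
Qed.

End Catalan.

(** * A supersolution of the loop equations *)

Section Majorant.
Context {R : realType} (r delta : R).
Hypotheses (r_ge1 : 1 <= r) (delta_gt0 : 0 < delta) (delta_le1 : delta <= 1).

Local Notation cat := (@catalan R).
Arguments catalan : simpl never.

(* Odd traces are uncorrelated with constants but not with each other, so the
   majorant must be positive, though small, at odd indices. *)
Definition majorant (a : nat) : R :=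
  (if odd a then delta * (a./2.+1)%:R else 1) * cat a./2 * r ^+ a./2.

Lemma majorant_even k : majorant k.*2 = cat k * r ^+ k.
Proof. by rewrite /majorant odd_double doubleK mul1r. Qed.

Lemma majorant_odd k : majorant k.*2.+1 = delta * k.+1%:R * cat k * r ^+ k.
Proof. by rewrite /majorant /= odd_double /= uphalf_double. Qed.

Let r0 : 0 < r. Proof. exact: lt_le_trans r_ge1. Qed.

Lemma majorant_gt0 a : 0 < majorant a.
Proof.
rewrite /majorant mulr_gt0 ?exprn_gt0// mulr_gt0 ?catalan_gt0//.
by case: ifP => // _; rewrite mulr_gt0.
Qed.

Lemma majorant_le n a : (a < n)%N -> majorant a <= n%:R * (4 * r) ^+ a./2.
Proof.
move=> an; rewrite /majorant exprMn mulrA ler_pM2r ?exprn_gt0//.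
apply: ler_pM; rewrite ?(ltW (catalan_gt0 _)) ?catalan_le//.
  by case: ifP => // _; rewrite mulr_ge0// ltW.
case: ifP => _; last by rewrite ler1n (leq_ltn_trans _ an).
apply: (@le_trans _ _ (1 * a./2.+1%:R)); first by rewrite ler_pM2r.
by rewrite mul1r ler_nat; lia.
Qed.

Lemma majorant_ge n a : (a < n)%N -> delta * (4 * r) ^+ a./2 <= n%:R ^+ 2 * majorant a.
Proof.
move=> an; have h := catalan_ge (R := R) a./2.
have an2 : (a./2.+1%:R : R) ^+ 2 <= n%:R ^+ 2.
  by apply: lerXn2r; rewrite ?nnegrE// ler_nat; lia.
rewrite /majorant exprMn !mulrA ler_pM2r ?exprn_gt0// [n%:R ^+ 2 * _]mulrC -[leRHS]mulrA; apply: ler_pM; rewrite ?(ltW delta_gt0) ?exprn_ge0//.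
  case: ifP => _ //; rewrite -[leLHS]mulr1 ler_pM2l// ler1n//.
apply: (le_trans h); rewrite ler_pM2r ?catalan_gt0//.
Qed.

(** Up to powers of n and delta the majorant is geometric, (4 r)^(a / 2), so merging two traces
    loses a polynomial factor only, which the 1 / N^2 of the loop equation can pay. *)
Lemma majorant_submul n a b : (a < n)%N -> (b < n)%N -> (0 < a)%N -> (0 < b)%N ->
  (a.-1 + b.-1 < n)%N ->
  majorant (a.-1 + b.-1) <= n%:R ^+ 5 / delta ^+ 2 * (majorant a * majorant b).
Proof.
move=> an bn a0 b0 abn; have h := majorant_le abn.
have h1 := majorant_ge an; have h2 := majorant_ge bn.
apply: (le_trans h).
have x1 : 1 <= 4 * r by move: r_ge1; lra.
have h3 : (4 * r) ^+ (a.-1 + b.-1)./2 <= (4 * r) ^+ a./2 * (4 * r) ^+ b./2.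
  rewrite -exprD; apply: ler_weXn2l => //; clear; lia.
have x0 : 0 < 4 * r by move: r_ge1; lra.
have h4 : (delta * (4 * r) ^+ a./2) * (delta * (4 * r) ^+ b./2) <=
    (n%:R ^+ 2 * majorant a) * (n%:R ^+ 2 * majorant b).
  by apply: ler_pM => //; rewrite mulr_ge0 ?(ltW delta_gt0)// exprn_ge0// ltW.
have n0 : 0 <= n%:R :> R by [].
apply: (le_trans (ler_wpM2l n0 h3)).
rewrite mulrAC ler_pdivlMr ?exprn_gt0//.
have := ler_wpM2l n0 h4.
by rewrite -subr_ge0 => h5; rewrite -subr_ge0; apply: le_trans h5 _; rewrite le_eqVlt; apply/orP; left; apply/eqP; ring.
Qed.

Lemma sum_double (F : nat -> R) k :
  \sum_(i < k.*2) F i = \sum_(i < k) F i.*2 + \sum_(i < k) F i.*2.+1.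
Proof.
elim: k => [|k ih]; first by rewrite !big_ord0 addr0.
by rewrite doubleS !big_ord_recr /= ih; ring.
Qed.

Variables (n : nat) (M eta : R).
Hypotheses (M_gt0 : 0 < M) (n_gt0 : (0 < n)%N) (eta0 : 0 < eta) (eta1 : eta <= 1).
Hypotheses (rE : r = 1 + eta) (dE : delta = eta / (2 * n%:R)).
Hypotheses (nM : 4 * n%:R <= eta * M) (nM2 : 64 * n%:R ^+ 8 <= eta ^+ 3 * M ^+ 2).

Let n0 : 0 < n%:R :> R. Proof. by rewrite ltr0n. Qed.

(** Pairs of even indices give the Catalan convolution exactly. Pairs of odd indices cost (delta
    n)^2 = eta^2 / 4, which is why delta is eta / (2 n). *)
Let sum_even k : (k < n)%N ->
  \sum_(i < k.*2.+1) majorant i * majorant (k.*2 - i) <= (1 + eta / 4) * (cat k.+1 * r ^+ k).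
Proof.
move=> kn; rewrite big_ord_recr /= subnn (sum_double (fun i => majorant i * majorant (k.*2 - i))).
have e1 : \sum_(i < k) majorant i.*2 * majorant (k.*2 - i.*2) + majorant k.*2 * majorant 0 = cat k.+1 * r ^+ k.
  rewrite -catalan_convolution mulr_suml big_ord_recr /= subnn; congr (_ + _); last first.
    by rewrite majorant_even -[0%N]double0 majorant_even expr0 !mulr1; ring.
  apply: eq_bigr => i _; rewrite -doubleB !majorant_even.
  rewrite (_ : r ^+ k = r ^+ i * r ^+ (k - i)); first by ring.
  by rewrite -exprD subnKC// ltnW.
have e2 : \sum_(i < k) majorant i.*2.+1 * majorant (k.*2 - i.*2.+1) <= eta / 4 * (cat k.+1 * r ^+ k).
  case: k kn e1 => [|k] kn _.
    by rewrite big_ord0 mulr_ge0 ?divr_ge0 ?(ltW eta0)// mulr_ge0 ?exprn_ge0 ?(ltW r0)// ltW// catalan_gt0.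
  apply: (@le_trans _ _ (\sum_(i < k.+1) (delta * n%:R) ^+ 2 * (cat i * cat (k - i)) * r ^+ k)).
    apply: ler_sum => i _.
    have -> : (k.+1.*2 - i.*2.+1 = (k - i).*2.+1)%N by have := ltn_ord i; clear; lia.
    rewrite !majorant_odd.
    rewrite (_ : r ^+ k = r ^+ i * r ^+ (k - i)); last by rewrite -exprD subnKC// -ltnS.
    have p0 : 0 <= delta ^+ 2 * (cat i * cat (k - i)) * (r ^+ i * r ^+ (k - i)).
      by rewrite !mulr_ge0 ?exprn_ge0 ?(ltW (catalan_gt0 _)) ?(ltW r0)// ltW.
    have p1 : i.+1%:R * (k - i).+1%:R <= n%:R ^+ 2 :> R.
      rewrite expr2; apply: ler_pM; rewrite // ler_nat; have := ltn_ord i; move: kn; clear; lia.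
    have := ler_wpM2l p0 p1.
    by rewrite -subr_ge0 => h5; rewrite -subr_ge0; apply: le_trans h5 _; rewrite le_eqVlt; apply/orP; left; apply/eqP; ring.
  rewrite -mulr_suml -mulr_sumr catalan_convolution.
  have -> : (delta * n%:R) ^+ 2 = eta ^+ 2 / 4 by rewrite dE; field; rewrite gt_eqF.
  rewrite -mulrA; apply: ler_pM.
  - by rewrite divr_ge0// sqr_ge0.
  - by rewrite mulr_ge0 ?exprn_ge0 ?(ltW (catalan_gt0 _)) ?(ltW r0).
  - by rewrite ler_pM2r// expr2 ler_piMl// ltW.
  - apply: ler_pM; rewrite ?exprn_ge0 ?(ltW (catalan_gt0 _)) ?(ltW r0) ?catalan_nondecr//.
    by apply: ler_weXn2l.
by rewrite mulrDl mul1r -e1; move: e2; rewrite -e1; lra.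
Qed.

(** One index is odd and the other even. By symmetry the weights i + 1 and k - i + 1 add up to k +
    2, so the linear factor in the odd majorant reproduces itself exactly. *)
Let sum_odd k : \sum_(i < k.+1.*2) majorant i * majorant (k.*2.+1 - i) =
  delta * k.+2%:R * cat k.+1 * r ^+ k.
Proof.
rewrite (sum_double (fun i => majorant i * majorant (k.*2.+1 - i)) k.+1).
have e1 : \sum_(i < k.+1) majorant i.*2.+1 * majorant (k.*2.+1 - i.*2.+1) =
    \sum_(i < k.+1) majorant i.*2 * majorant (k.*2.+1 - i.*2).
  rewrite (reindex_inj rev_ord_inj) /=; apply: eq_bigr => i _.
  have ik : (i <= k)%N by rewrite -ltnS.
  rewrite mulrC; congr (majorant _ * majorant _); move: ik; clear; lia.
rewrite e1.
have e2 : \sum_(i < k.+1) majorant i.*2 * majorant (k.*2.+1 - i.*2) =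
   delta * r ^+ k * \sum_(i < k.+1) (k - i).+1%:R * (cat i * cat (k - i)).
  rewrite mulr_sumr; apply: eq_bigr => i _.
  have ik : (i <= k)%N by rewrite -ltnS.
  have -> : (k.*2.+1 - i.*2 = (k - i).*2.+1)%N by move: ik; clear; lia.
  rewrite majorant_even majorant_odd (_ : r ^+ k = r ^+ i * r ^+ (k - i)); first by ring.
  by rewrite -exprD subnKC.
rewrite e2.
have e3 : \sum_(i < k.+1) (k - i).+1%:R * (cat i * cat (k - i)) + \sum_(i < k.+1) (k - i).+1%:R * (cat i * cat (k - i)) = k.+2%:R * cat k.+1.
  rewrite {1}(reindex_inj rev_ord_inj) /= -catalan_convolution mulr_sumr -big_split.
  apply: eq_bigr => i _ /=; have ik : (i <= k)%N by rewrite -ltnS.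
  rewrite subSS subKn// [cat (k - i) * _]mulrC -mulrDl -natrD; congr (_%:R * _); move: ik; clear; lia.
by rewrite -mulrDr e3; ring.
Qed.

(** M stands for the matrix size and B for the total degree of the other traces. For a > 0 the
    right-hand side is r A, with A the leading Catalan term on the left; the surplus eta A pays eta
    / 4 for odd pairs, eta / 4 for the 1 / M term and (eta / 8) r for the merging term. *)
Lemma majorant_recursion a (B : R) : (a < n)%N -> 0 <= B <= n%:R ->
  \sum_(k < a) majorant k * majorant (a.-1 - k) + a%:R / M * majorant a.-1
  + 2 / M ^+ 2 * (B * (n%:R ^+ 5 / delta ^+ 2 * majorant a.+1)) <= majorant a.+1.
Proof.
move=> an /andP[B0 Bn].
have Mn0 : M != 0 by rewrite gt_eqF.
have nn0 : n%:R != 0 :> R by rewrite gt_eqF.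
have en0 : eta != 0 by rewrite gt_eqF.
have h3 : 2 / M ^+ 2 * (B * (n%:R ^+ 5 / delta ^+ 2 * majorant a.+1)) <= eta / 8 * majorant a.+1.
  rewrite 2!mulrA ler_pM2r ?majorant_gt0//.
  apply: (@le_trans _ _ (2 / M ^+ 2 * (n%:R * (n%:R ^+ 5 / delta ^+ 2)))).
    rewrite -mulrA ler_wpM2l ?divr_ge0 ?exprn_ge0 ?(ltW M_gt0)//.
    by rewrite ler_wpM2r// divr_ge0 ?exprn_ge0 ?(ltW delta_gt0).
  (* The powers n, n^5 and the n^2 in delta^(-2) make n^8; this is where [nM2] comes from. *)
  have -> : 2 / M ^+ 2 * (n%:R * (n%:R ^+ 5 / delta ^+ 2)) = (64 * n%:R ^+ 8) / (8 * eta ^+ 2 * M ^+ 2).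
    by rewrite dE; field; rewrite Mn0 nn0 en0.
  rewrite ler_pdivrMr ?mulr_gt0 ?exprn_gt0//.
  by apply: le_trans nM2 _; rewrite le_eqVlt; apply/orP; left; apply/eqP; field.
have h2 : a%:R / M <= eta / 4.
  rewrite ler_pdivrMr//; apply: (@le_trans _ _ n%:R); first by rewrite ler_nat ltnW.
  by move: nM; lra.
have a_ge0 := majorant_gt0 a.+1.
case: a an h2 h3 a_ge0 => [|a] an h2 h3 a_ge0.
  rewrite big_ord0 mul0r mul0r !add0r; apply: (le_trans h3).
  by rewrite ger_pMl//; move: eta1; lra.
suff [A [AE h1]] : exists A, majorant a.+2 = r * A /\
    \sum_(k < a.+1) majorant k * majorant (a.+1.-1 - k) + a.+1%:R / M * majorant a.+1.-1
      <= (1 + eta / 2) * A.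
  apply: (le_trans (lerD h1 h3)); rewrite AE rE.
  have A0 : 0 <= A by move: a_ge0; rewrite AE pmulr_rgt0// => /ltW.
  have e3 : 0 <= 3 - eta by move: eta1; lra.
  by move: (mulr_ge0 (mulr_ge0 (ltW eta0) A0) e3); lra.
have aE : a = (if odd a then a./2.*2.+1 else a./2.*2).
  by rewrite -[LHS]odd_double_half; case: (odd a).
move: (a./2) aE => k; case: (odd a) => aE; subst a.
  exists (delta * k.+2%:R * cat k.+1 * r ^+ k); split.
    by rewrite (_ : k.*2.+3 = k.+1.*2.+1)// majorant_odd exprS; ring.
  rewrite (_ : k.*2.+2 = k.+1.*2)// in h2 *; rewrite sum_odd.
  have : majorant k.*2.+1 <= delta * k.+2%:R * cat k.+1 * r ^+ k.
    rewrite majorant_odd ler_pM2r ?exprn_gt0//; apply: ler_pM.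
    - by rewrite mulr_ge0// ltW.
    - exact/ltW/catalan_gt0.
    - by rewrite ler_pM2l// ler_nat.
    - exact: catalan_nondecr.
  move=> /(ler_pM (divr_ge0 (ler0n _ _) (ltW M_gt0)) (ltW (majorant_gt0 _)) h2).
  have : 0 <= delta * k.+2%:R * cat k.+1 * r ^+ k.
    by rewrite !mulr_ge0 ?exprn_ge0 ?(ltW r0) ?(ltW (catalan_gt0 _)) ?(ltW delta_gt0).
  move=> /(mulr_ge0 (ltW eta0)); rewrite (_ : k.+1.*2.-1 = k.*2.+1)//; lra.
exists (cat k.+1 * r ^+ k); split.
  by rewrite (_ : k.*2.+2 = k.+1.*2)// majorant_even exprS; ring.
have kn : (k < n)%N by move: an; clear; lia.
have := sum_even kn.
have : majorant k.*2 <= cat k.+1 * r ^+ k.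
  by rewrite majorant_even ler_pM2r ?exprn_gt0// catalan_nondecr.
move=> /(ler_pM (divr_ge0 (ler0n _ _) (ltW M_gt0)) (ltW (majorant_gt0 _)) h2).
move=> /=; lra.
Qed.

End Majorant.

Lemma perm_del (bs : seq nat) i : (i < size bs)%N ->
  perm_eq bs (nth 0%N bs i :: del i bs).
Proof.
move=> ibs; rewrite -{1}[bs](cat_take_drop i) (drop_nth 0%N)// /del.
by rewrite -cat1s perm_catCA.
Qed.

Lemma sumn_perm (s1 s2 : seq nat) : perm_eq s1 s2 -> sumn s1 = sumn s2.
Proof. by move=> s12; rewrite !sumnE; exact: perm_big. Qed.

Section MomentBound.
Context d (T : measurableType d) (R : realType) (P : probability T R) (m : nat).
Local Notation N := m.+1.
Context (H : 'I_N -> 'I_N -> {RV P >-> R}).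
Hypothesis goeH : is_GOE H.
Variables (n : nat) (eta : R).
Hypotheses (n_gt0 : (0 < n)%N) (eta0 : 0 < eta) (eta1 : eta <= 1).
Hypotheses (nM : 4 * n%:R <= eta * N%:R) (nM2 : 64 * n%:R ^+ 8 <= eta ^+ 3 * N%:R ^+ 2).

Let r := 1 + eta.
Let delta := eta / (2 * n%:R).
Let r_ge1 : 1 <= r. Proof. by rewrite /r lerDl ltW. Qed.
Let n0 : 0 < n%:R :> R. Proof. by rewrite ltr0n. Qed.
Let delta_gt0 : 0 < delta. Proof. by rewrite divr_gt0// mulr_gt0. Qed.
Let delta_le1 : delta <= 1.
Proof.
rewrite ler_pdivrMr ?mulr_gt0// mul1r; apply: (le_trans eta1).
by rewrite -natrM ler1n muln_gt0.
Qed.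
Local Notation c := (majorant r delta).
Let c_gt0 a : 0 < c a. Proof. exact: majorant_gt0. Qed.
Let prodc_ge0 bs : 0 <= \prod_(b <- bs) c b.
Proof. by apply: prodr_ge0 => b _; exact: ltW. Qed.

Let prodc_cons a bs : c a * \prod_(b <- bs) c b = \prod_(b <- a :: bs) c b.
Proof. by rewrite big_cons. Qed.

(** Induction on total degree plus number of traces: splitting adds one trace but removes two
    degrees, and a trace of degree 0, equal to 1, is simply dropped. *)
Lemma ntr_moment_le bs : (sumn bs < n)%N -> ntr_moment H bs <= \prod_(b <- bs) c b.
Proof.
have [k] := ubnP (sumn bs + size bs); elim: k bs => // k ih [|[|a] bs].
- by rewrite ntr_moment_nil big_nil.
- rewrite /= add0n addnS ltnS => hk hn; rewrite ntr_moment0 big_cons.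
  by rewrite -[0%N]/(0.*2)%N majorant_even expr0 mulr1 mul1r ih//; lia.
move=> hk hn; rewrite loop_equation// big_cons.
have hsum : (sumn bs + a.+1 < n)%N by rewrite addnC.
have hk' : (sumn bs + a.+1 + (size bs).+1 <= k)%N by move: hk => /=; clear; lia.
have an : (a < n)%N by move: hsum; clear; lia.
pose B : R := (sumn bs)%:R; pose L : R := n%:R ^+ 5 / delta ^+ 2.
have Bn : 0 <= B <= n%:R by rewrite ler0n ler_nat; move: hsum; clear; lia.
have N0 : 0 < N%:R :> R by [].
have rec := majorant_recursion r_ge1 delta_gt0 N0 n_gt0 eta0 eta1 erefl erefl nM nM2 an Bn.
apply: (le_trans _ (ler_wpM2r (prodc_ge0 bs) rec)); rewrite [leRHS]mulrDl [X in _ <= X + _]mulrDl.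
apply: lerD; first apply: lerD.
- rewrite mulr_suml; apply: ler_sum => i _; rewrite -mulrA !prodc_cons.
  have ia := ltn_ord i.
  apply: ih; rewrite /=; move: hk' hsum ia; clear; lia.
- case: a {hk hn} hsum hk' an rec => [|a] hsum hk' an rec.
    by rewrite !mul0r.
  rewrite -[leRHS]mulrA ler_wpM2l ?divr_ge0//= prodc_cons; apply: ih => /=;
    move: hk' hsum; clear; lia.
rewrite -[leRHS]mulrA ler_wpM2l ?divr_ge0//.
have -> : B = \sum_(i < size bs) (nth 0%N bs i)%:R.
  by rewrite /B sumnE (big_nth 0%N) big_mkord natr_sum.
rewrite -[leRHS]mulrA mulr_suml; apply: ler_sum => i _.
(* For degree 0 the predecessor is truncated, but the coefficient in the loop equation vanishes. *)
have [b0|b0] := posnP (nth 0%N bs i); first by rewrite b0 !mul0r.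
rewrite ler_wpM2l//.
rewrite (perm_big _ (perm_del (ltn_ord i))) /= -prodc_cons.
move: (sumn_perm (perm_del (ltn_ord i))) (perm_size (perm_del (ltn_ord i))) b0.
move: (nth _ _ _) (del _ _) => b bs' /= sm sz b0.
apply: (@le_trans _ _ (c (a + b.-1) * \prod_(b <- bs') c b)).
  rewrite prodc_cons; apply: ih => /=; move: hk' hsum; rewrite sm sz; move: b0; clear; lia.
rewrite -/L; move: (\prod_(b <- bs') c b) (prodc_ge0 bs') => p p0.
rewrite (_ : _ * (c b * p) = L * (c a.+1 * c b) * p); last by move: (c b) (c a.+1); clear => u v; ring.
rewrite ler_wpM2r//.
apply: (@majorant_submul _ _ _ _ _ _ n a.+1 b) => //; move: hsum; rewrite sm; move: b0; clear; lia.
Qed.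

End MomentBound.

(** * From traces of powers to the quadratic form *)

Section NumericalRadius.
Context {R : realType} {m : nat}.
Local Notation N := m.+1.
Implicit Types (A : 'M[R]_N) (u f g : 'rV[R]_N).

Lemma vdot_cauchy_schwarz f g : vdot f g ^+ 2 <= vdot f f * vdot g g.
Proof.
have [g0|g0] := eqVneq (vdot g g) 0.
  by rewrite (vdot_eq0 g0) -[X in vdot f X](scale0r (0 : 'rV[R]_N)) vdotZr mul0r expr0n mulr_ge0// vdot_ge0.
have gg : 0 < vdot g g by rewrite lt_neqAle eq_sym g0 vdot_ge0.
have := vdot_ge0 (vdot g g *: f - vdot f g *: g).
have e a b : vdot (a *: f - b *: g) (a *: f - b *: g) =
    a ^+ 2 * vdot f f - 2 * a * b * vdot f g + b ^+ 2 * vdot g g.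
  rewrite /vdot !mulr_sumr -sumrB -big_split; apply: eq_bigr => x _ /=.
  by rewrite !mxE; ring.
rewrite e (_ : _ + _ = vdot g g * (vdot f f * vdot g g - vdot f g ^+ 2)); last by ring.
by rewrite pmulr_rge0// subr_ge0.
Qed.

Lemma bil_vdot A u w : bil A u w = vdot (u *m A) w.
Proof. by rewrite /bil mxE; apply: eq_bigr => x _; rewrite [w^T _ _]mxE. Qed.

Lemma vdot_mulmx A u : A^T = A -> vdot (u *m A) (u *m A) = bil (A *m A) u u.
Proof.
move=> sA; rewrite bil_vdot /vdot mulmxA.
have -> : \sum_x (u *m A *m A) 0 x * u 0 x = (u *m A *m A *m u^T) 0 0.
  by rewrite [RHS]mxE; apply: eq_bigr => x _; rewrite [u^T _ _]mxE.
have -> : u *m A *m A *m u^T = (u *m A) *m (u *m A)^T by rewrite trmx_mul sA !mulmxA.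
rewrite [RHS]mxE; apply: eq_bigr => x _.
by rewrite [_^T _ _]mxE.
Qed.

Lemma bil_sqr_trace A u : A^T = A -> bil (A *m A) u u <= vdot u u * \tr (A *m A).
Proof.
move=> sA; rewrite -vdot_mulmx// {1}/vdot /mxtrace mulr_sumr.
apply: ler_sum => x _.
have -> : (u *m A) 0 x = vdot u (row x A).
  by rewrite mxE; apply: eq_bigr => y _; rewrite mxE -{1}sA mxE.
have -> : (A *m A) x x = vdot (row x A) (row x A).
  by rewrite mxE; apply: eq_bigr => y _; rewrite !mxE -{2}sA mxE.
by rewrite -expr2 vdot_cauchy_schwarz.
Qed.

Lemma bil_sqr A u : A^T = A -> bil A u u ^+ 2 <= vdot u u * bil (A *m A) u u.
Proof. by move=> sA; rewrite -vdot_mulmx// mulrC bil_vdot vdot_cauchy_schwarz. Qed.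

(** Each Cauchy-Schwarz step replaces A by A^2; the last one, applied row by row, bounds the form by
    a trace. This replaces diagonalization and forces the exponent to be a power of two. *)
Lemma bil_expn_trace A u s : A^T = A ->
  bil A u u ^+ (2 ^ s.+1) <= vdot u u ^+ (2 ^ s.+1) * \tr (A ^+ (2 ^ s.+1)).
Proof.
elim: s A => [|s ih] A sA.
  rewrite expn1; apply: (le_trans (bil_sqr _ sA)); rewrite [_ ^+ 2 as X in _ <= X * _]expr2.
  by rewrite -mulrA ler_wpM2l ?vdot_ge0// bil_sqr_trace.
have sA2 : (A *m A)^T = A *m A by rewrite trmx_mul sA.
rewrite expnS !exprM.
apply: (@le_trans _ _ ((vdot u u * bil (A *m A) u u) ^+ (2 ^ s.+1))).
  by apply: lerXn2r; rewrite ?nnegrE ?sqr_ge0 ?bil_sqr// mulr_ge0 ?vdot_ge0// -vdot_mulmx// vdot_ge0.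
rewrite exprMn [vdot u u ^+ 2]expr2 exprMn -mulrA ler_wpM2l ?exprn_ge0 ?vdot_ge0//.
exact: ih.
Qed.

Lemma numerical_radius_le A rho s u : A^T = A -> 0 <= rho ->
  \tr (A ^+ (2 ^ s.+1)) <= rho ^+ (2 ^ s.+1) -> `|bil A u u| <= rho * vdot u u.
Proof.
move=> sA rho0 h.
rewrite -(@ler_pXn2r _ (2 ^ s.+1)) ?expn_gt0 ?nnegrE ?mulr_ge0 ?vdot_ge0//.
have -> : `|bil A u u| ^+ (2 ^ s.+1) = bil A u u ^+ (2 ^ s.+1).
  by rewrite -normrX ger0_norm// expnS exprM exprn_ge0// sqr_ge0.
apply: (le_trans (bil_expn_trace _ _ sA)).
by rewrite exprMn mulrC ler_wpM2r// exprn_ge0// vdot_ge0.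
Qed.

Lemma trace_expn_ge0 A s : A^T = A -> 0 <= \tr (A ^+ (2 ^ s.+1)).
Proof.
have trA k : A^T = A -> (A ^+ k)^T = A ^+ k.
  move=> sA; elim: k => [|k ih]; first by rewrite expr0 trmx1.
  by rewrite exprSr trmx_mul ih sA mulmxE -exprS exprSr.
move=> sA; rewrite expnSr exprM expr2.
rewrite /mxtrace sumr_ge0// => x _; rewrite mxE sumr_ge0// => y _.
by rewrite -{1}trA// mxE -expr2 sqr_ge0.
Qed.

End NumericalRadius.

Section Tail.
Context d (T : measurableType d) (R : realType) (P : probability T R) (m : nat).
Local Notation N := m.+1.
Context (H : 'I_N -> 'I_N -> {RV P >-> R}).
Hypothesis goeH : is_GOE H.

Lemma random_matrix_sym w : (random_matrix H w)^T = random_matrix H w.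
Proof. by case: goeH => Hs _ _; apply/matrixP => x y; rewrite !mxE Hs. Qed.

Let integrable_ntr a : P.-integrable setT (EFin \o ntr H a).
Proof. exact/ispoly_integrable/ispoly_ntr. Qed.

Lemma measurable_ntr a : measurable_fun setT (ntr H a).
Proof. exact/measurable_EFinP/(measurable_int P)/integrable_ntr. Qed.

Lemma ntr_tail (s : nat) (a : R) : 0 < a ->
  (P [set w | (a <= ntr H (2 ^ s.+1)%N w)%R] <= (ntr_moment H [:: (2 ^ s.+1)%N] / a)%:E)%E.
Proof.
move=> a0; set k := (2 ^ s.+1)%N.
have k0 w : 0 <= ntr H k w by rewrite mulr_ge0// trace_expn_ge0// random_matrix_sym.
have mk := measurable_ntr k.
have := @le_integral_comp_abse _ _ _ P setT measurableT (EFin \o ntr H k) a id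
  (@measurable_id _ _ _) (fun _ h => h) _ ((measurable_EFinP _ _).2 mk) a0.
move=> /(_ (fun _ _ _ _ h => h)); rewrite setTI.
rewrite (_ : [set w | _] = [set w | a <= ntr H k w]); last first.
  by apply/seteqP; split => w /=; rewrite lee_fin ger0_norm.
rewrite (eq_integral (EFin \o ntr H k)); last first.
  by move=> w _ /=; rewrite ger0_norm.
have -> : (\int[P]_w (EFin \o ntr H k) w)%E = (ntr_moment H [:: k])%:E.
  rewrite /ntr_moment /expect fineK; last first.
    rewrite (eq_integral (EFin \o ntr H k)); last by move=> w _; rewrite big_seq1.
    exact: integrable_fin_num (integrable_ntr k).
  by apply: eq_integral => w _; rewrite big_seq1.
by move=> h; rewrite EFinM lee_pdivlMr// muleC.
Qed.

(** The exceptional set is a level set of one trace, hence measurable, although the conclusion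
    concerns all u at once. *)
Lemma goe_radius_tail n (eta rho : R) (s : nat) : 0 < eta -> eta <= 1 -> 0 < rho ->
  64 * n%:R ^+ 8 <= eta ^+ 3 * N%:R ^+ 2 -> (2 ^ s.+1 < n)%N ->
  exists B : set T, [/\ measurable B,
    (P B <= (N%:R * (4 * (1 + eta) / rho ^+ 2) ^+ (2 ^ s))%:E)%E &
    forall w, ~ B w -> forall u, `|bil (random_matrix H w) u u| <= rho * vdot u u].
Proof.
move=> eta0 eta1 rho0 nN2 sn.
have n1 : (0 < n)%N by apply: leq_ltn_trans sn.
have nN : 4 * n%:R <= eta * N%:R.
  rewrite -(@ler_pXn2r _ 2) ?nnegrE ?mulr_ge0 ?(ltW eta0)//.
  apply: (@le_trans _ _ (64 * n%:R ^+ 8)).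
    rewrite exprMn; apply: ler_pM => //; rewrite ?exprn_ge0//.
      by rewrite -natrX ler_nat.
    by apply: ler_weXn2l => //; rewrite ler1n.
  apply: (le_trans nN2); rewrite exprMn ler_wpM2r ?exprn_ge0//.
  by rewrite exprS ler_piMl// exprn_ge0// ltW.
set k := (2 ^ s.+1)%N.
have := @ntr_moment_le _ _ _ _ _ _ goeH n eta n1 eta0 eta1 nN nN2 [:: k].
rewrite /= addn0 => /(_ sn); rewrite big_seq1.
have -> : k = (2 ^ s).*2 by rewrite /k expnS mul2n.
rewrite majorant_even => mom.
(* Outside the level set the unnormalized trace is below rho^k, exactly the hypothesis of
   [numerical_radius_le]. *)
pose a : R := rho ^+ k / N%:R.
have a0 : 0 < a by rewrite divr_gt0// exprn_gt0.
exists [set w | a <= ntr H k w]; split.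
- rewrite -[X in measurable X]setTI -[X in _ `&` X]/(ntr H k @^-1` [set x | a <= x]).
  rewrite (_ : [set x | a <= x] = `[a, +oo[%classic); first exact: measurable_ntr.
  by apply/seteqP; split => x /=; rewrite in_itv /= andbT.
- apply: (le_trans (ntr_tail s a0)); rewrite lee_fin /a -/k invf_div mulrA mulrC.
  rewrite (_ : k = (2 ^ s).*2); last by rewrite /k expnS mul2n.
  rewrite expr_div_n -exprM mul2n exprMn [X in _ <= X]mulrA [X in _ <= X]mulrC ler_wpM2l ?invr_ge0 ?exprn_ge0 ?(ltW rho0)//.
  rewrite mulrC ler_wpM2l//; apply: (le_trans mom).
  by rewrite ler_wpM2r ?catalan_le// exprn_ge0// addr_ge0// ltW.
- move=> w /negP; rewrite -ltNge => h u; apply: (numerical_radius_le (s := s)).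
  + exact: random_matrix_sym.
  + exact: ltW.
  + by move: h; rewrite /a /ntr -/k mulrC ltr_pM2r ?invr_gt0// => /ltW.
Qed.

End Tail.

(** Apply y^9 <= 9^9 exp y at y = - K ln q; the ninth power leaves the decay 1 / K. *)
Lemma geometric_decay {R : realType} (q : R) : 0 < q < 1 -> exists2 C : R, 0 < C &
  forall K : nat, (0 < K)%N -> K%:R ^+ 8 * q ^+ K <= C / K%:R.
Proof.
move=> /andP[q0 q1]; pose a := - ln q.
have a0 : 0 < a by rewrite oppr_gt0 ln_lt0// q0.
exists (9%:R ^+ 9 / a ^+ 9) => [|K K0]; first by rewrite divr_gt0// exprn_gt0.
have K0' : 0 < K%:R :> R by rewrite ltr0n.
have h : (a * K%:R) ^+ 9 <= 9%:R ^+ 9 * expR (a * K%:R) by apply: expr_le_expR; rewrite mulr_ge0// ltW.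
have e : expR (a * K%:R) * q ^+ K = 1.
  rewrite -[q in q ^+ K](lnK (x := q)) ?posrE// -expRM_natr -expRD (_ : _ + _ = 0) ?expR0//.
  by rewrite /a; ring.
have qK : 0 < q ^+ K by rewrite exprn_gt0.
rewrite ler_pdivlMr// mulrAC -exprSr ler_pdivlMr ?exprn_gt0//.
have := ler_wpM2r (ltW qK) h; rewrite -[X in _ <= X -> _]mulrA e mulr1; apply: le_trans.
by rewrite exprMn [leLHS]mulrC !mulrA.
Qed.

Lemma dyadic_scale (R : realType) (q eta e : R) : 0 < q < 1 -> 0 < eta -> 0 < e ->
  exists N0 : nat, forall N, (N0 <= N)%N -> exists s : nat,
    64 * (2 ^ s.+1).+1%:R ^+ 8 <= eta ^+ 3 * N%:R ^+ 2 /\ N%:R * q ^+ (2 ^ s) <= e.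
Proof.
move=> q01 eta0 e0; have [C C0 hC] := geometric_decay q01.
(* N >= a1 will give the first inequality, because 2 K + 1 <= 3 K; a2 is chosen so that N >= a2
   forces K >= b C / e, hence the second. *)
pose a1 : R := 64 * 3 ^+ 8 / eta ^+ 3.
have [b b0 bE] : exists2 b : R, 0 < b & 256%:R = b by exists 256%:R; rewrite ?ltr0n.
pose a2 : R := b * (b * C / e) ^+ 8.
have a10 : 0 <= a1 by rewrite divr_ge0 ?exprn_ge0 ?(ltW eta0)// mulr_ge0// exprn_ge0.
exists (Num.bound (Num.max a1 a2)).+1 => N hN.
have N0 : (0 < N)%N by exact: leq_trans hN.
have : Num.max a1 a2 <= N%:R.
  apply: (@le_trans _ _ (Num.bound (Num.max a1 a2))%:R); last by rewrite ler_nat ltnW.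
  apply: ltW; rewrite archi_boundP//.
  by rewrite le_max a10.
rewrite ge_max => /andP[h1 h2].
have /andP[l1 l2] := trunc_log_bounds (isT : 1 < 256)%N N0.
(* K = 2^s is the dyadic approximation of N^(1/8): K^8 <= N < 256 K^8. *)
set s := trunc_log 256 N in l1 l2; set K := (2 ^ s)%N.
have KE : (K ^ 8 = 256 ^ s)%N by rewrite /K -expnM mulnC expnM.
have KN : (K ^ 8 <= N)%N by rewrite KE.
have NK : (N <= 256 * K ^ 8)%N by rewrite KE -expnS ltnW.
have K0 : (0 < K)%N by rewrite expn_gt0.
have K0' : 0 < K%:R :> R by rewrite ltr0n.
have KNr : K%:R ^+ 8 <= N%:R :> R by rewrite -natrX ler_nat.
have NKr : N%:R <= b * K%:R ^+ 8 :> R by rewrite -bE -natrX -natrM ler_nat.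
exists s; split.
  apply: (@le_trans _ _ (64 * (3 * K%:R) ^+ 8)).
    rewrite ler_wpM2l// lerXn2r ?nnegrE ?mulr_ge0// -natrM ler_nat expnS -/K.
    by move: K0; clear; lia.
  rewrite exprMn mulrA; apply: (@le_trans _ _ (64 * 3 ^+ 8 * N%:R)); first by rewrite ler_wpM2l// mulr_ge0// exprn_ge0.
  rewrite expr2 mulrA ler_wpM2r//.
  by move: h1; rewrite /a1 ler_pdivrMr ?exprn_gt0// [X in _ <= X]mulrC.
have qK : 0 <= q ^+ K by case/andP: q01 => q0 _; rewrite exprn_ge0// ltW.
apply: (le_trans (ler_wpM2r qK NKr)); rewrite -mulrA.
apply: (@le_trans _ _ (b * (C / K%:R))); first by rewrite ler_wpM2l ?hC// ltW.
rewrite mulrA ler_pdivrMr// -ler_pdivrMl// mulrC.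
rewrite -(@ler_pXn2r _ 8) ?nnegrE ?divr_ge0 ?mulr_ge0 ?(ltW C0) ?(ltW e0) ?(ltW b0)//.
by have := le_trans h2 NKr; rewrite ler_pM2l.
Qed.

(** N0 is fixed before the probability space, since matrices of different sizes may live on
    unrelated spaces. *)
Lemma goe_numerical_radius (R : realType) (rho e : R) : 2 < rho -> 0 < e ->
  exists N0 : nat, forall m, (N0 <= m)%N ->
  forall d (T : measurableType d) (P : probability T R)
    (H : 'I_m.+1 -> 'I_m.+1 -> {RV P >-> R}), is_GOE H ->
  exists B : set T, [/\ measurable B, (P B <= e%:E)%E &
    forall w, ~ B w -> forall u, `|bil (random_matrix H w) u u| <= rho * vdot u u].
Proof.
move=> rho2 e0; have rho0 : 0 < rho by rewrite (lt_trans _ rho2).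
(* For rho < 3 the choice (rho - 2) / 2 gives 4 (1 + eta) = 2 rho < rho^2; for rho >= 3 the choice 1
   gives 8 < 9. *)
have [eta [eta0 eta1 etar]] : exists eta : R, [/\ 0 < eta, eta <= 1 & 4 * (1 + eta) < rho ^+ 2].
  have [h|h] := leP 3 rho.
    by exists 1; split => //; have := ler_pM (ler0n R 3) (ler0n R 3) h h; lra.
  exists ((rho - 2) / 2); split; first by lra.
    by lra.
  have : 0 < (rho - 2) * rho by rewrite mulr_gt0// subr_gt0.
  by rewrite expr2; lra.
have q01 : 0 < 4 * (1 + eta) / rho ^+ 2 < 1.
  rewrite divr_gt0 ?mulr_gt0 ?addr_gt0 ?exprn_gt0//=.
  by rewrite ltr_pdivrMr ?exprn_gt0// mul1r.
have [N0 hN] := dyadic_scale q01 eta0 e0.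
exists N0 => m mN d T P H goeH.
have [s [h1 h2]] := hN m.+1 (leqW mN).
have [B [mB PB hB]] := goe_radius_tail goeH eta0 eta1 rho0 h1 (ltnSn _).
by exists B; split => //; apply: (le_trans PB); rewrite lee_fin.
Qed.

Theorem corollary2 (R : realType) (beta : R) (beta_gt0 : 0 < beta)
    (beta_lt : beta < 4^-1) :
  exists c : R,
    forall (d : nat -> measure_display) (T : forall N, measurableType (d N))
      (P : forall N, probability (T N) R)
      (H : forall N, 'I_N -> 'I_N -> {RV (P N) >-> R}),
      (forall N, (1 <= N)%N -> is_GOE (H N)) ->
      (P N [set w | (log_sobolev_constant (beta *: random_matrix (H N) w)
                       < c%:E)%E]) @[N --> \oo] --> 1%E.
Proof.
have [rho [rho2 brho]] : exists rho : R, 2 < rho /\ 2 * (beta * rho) < 1.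
  (* The midpoint of 2 and 1 / (2 beta), the two bounds that rho must satisfy. *)
  exists (1 + (4 * beta)^-1).
  have b4 : 0 < 4 * beta by rewrite mulr_gt0.
  have : 1 < (4 * beta)^-1 by rewrite invf_cp1//; move: beta_lt; lra.
  have e : beta * (4 * beta)^-1 = 4^-1 by field; rewrite gt_eqF.
  split; first by lra.
  by rewrite mulrDr mulr1 e; move: beta_lt; lra.
have br0 : 0 <= beta * rho by rewrite mulr_ge0 ?(ltW beta_gt0)// ltW// (lt_trans _ rho2).
pose g : R := 2 / (1 - 2 * (beta * rho)).
have g0 : 0 <= g by rewrite divr_ge0// subr_ge0 ltW.
(* The added 1 makes the inequality for the log-Sobolev constant strict. *)
exists (g + 1) => d T P H goeH.
set E := fun N => [set w | (log_sobolev_constant (beta *: random_matrix (H N) w) < (g + 1)%:E)%E].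
have mE N : measurable (E N).
  apply: measurable_log_sobolev_constant_lt => x y.
  rewrite (_ : (fun w => _) = (fun w => beta * H N x y w)); last by apply/funext => w; rewrite !mxE.
  exact: measurable_funM.
apply: cvg_EFin; first by near=> N; exact: fin_num_measure.
apply/cvgrPdist_le => e e0; have [N0 hN] := goe_numerical_radius rho2 e0.
exists N0.+1 => // -[//|m]; rewrite /= ltnS => Nm.
have [B [mB PB hB]] := hN m Nm _ _ _ _ (goeH m.+1 isT).
have EB : ~` E m.+1 `<=` B.
  move=> w; apply: contra_notP => nB; apply: (@le_lt_trans _ _ g%:E); last by rewrite lte_fin ltrDl.
  apply: ereal_inf_lbound; exists g => //; split => //.
  apply: log_sobolev_of_numerical_radius => // [|u].
    by rewrite linearZ /= (random_matrix_sym (goeH m.+1 isT)).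
  have -> : bil (beta *: random_matrix (H m.+1) w) u u = beta * bil (random_matrix (H m.+1) w) u u.
    by rewrite /bil -scalemxAr -scalemxAl mxE.
  by rewrite normrM (gtr0_norm beta_gt0) -mulrA ler_wpM2l ?hB// ltW.
have PE : (P m.+1 (~` E m.+1) <= e%:E)%E.
  by apply: le_trans PB; apply: le_measure; rewrite ?inE//; exact: measurableC.
move: PE; rewrite probability_setC//.
have := probability_le1 (P m.+1) (mE m.+1); have := fin_num_measure (P m.+1) _ (mE m.+1).
case: (P _ _) => // p _; rewrite -EFinB !lee_fin /= => p1 h.
by rewrite ger0_norm// subr_ge0.
Unshelve. all: by end_near.
Qed.
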